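(* Let $b,c\in\mathbb{N}$ and let $\theta\in\mathbb{R}$ be fixed with $0<\theta<1$. (i) If $1<c<b$, then as $T\to\infty$ $$M_{1,b,c}^{\theta}(T)=K_{1,b,c}T-C_{1,c,b}T^{1-\theta(1/2-1/(2c))}-C_{1,b,c}T^{1-\theta(1/2-1/(2b))}+O\big(T^{1-\theta/2}(\log T)^2+T^{1/2+\theta/2}\big).$$ (ii) If $b=c>1$, then $$M_{1,b,b}^{\theta}(T)=K_{1,b,b}T-H_b(\log T)\,T^{1-\theta(1/2-1/(2b))}+O\big(T^{1-\theta/2}(\log T)^2+T^{1/2+\theta/2}\big).$$
   Context: For $\theta>0$ and real $\sigma$, $\tau>0$, let $D_\theta(\sigma+i\tau)=\sum_{1\le n\le (\tau/2\pi)^{\theta}} n^{-\sigma-i\tau}$, and $$M_{1,b,c}^{\theta}(T)=\int_0^T D_\theta(1/2+it)\,\zeta(1/2-ibt)\,\zeta(1/2-ict)\,dt.$$ Let $\gamma$ be Euler's constant and $\lambda_\theta=2/\theta-1$. Define $K_{1,b,c}=\zeta((1+b)/2)\zeta((1+c)/2)$ and, for $r,s\in\mathbb{N}$, $r>1$, $$C_{1,r,s}=\frac{4r}{\theta(r-1)(\lambda_\theta r+1)}\,\zeta\Big(\frac{s}{2r}+\frac12\Big)(2\pi)^{\theta(1/2-1/(2r))}.$$ For $r>1$ let $E_{0,r}=\frac{4\gamma}{r-1}+\frac{4}{(r-1)^2}$, $E_{1,r}=\frac{2}{r(r-1)}$, $F_{0,r}=\frac{4\gamma}{\lambda_\theta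 r+1}-\frac{4}{(\lambda_\theta r+1)^2}$, $F_{1,r}=\frac{2}{r(\lambda_\theta r+1)}$, $H_{0,r}=E_{0,r}+F_{0,r}$, $H_{1,r}=E_{1,r}+F_{1,r}$, and define the linear polynomial $$H_r(x)=(2\pi)^{\theta(1/2-1/(2r))}\big(\theta H_{1,r}x+H_{0,r}-\theta H_{1,r}\log 2\pi\big).$$ Implied constants depend on $b,c,\theta$. *)

(* Defs.v *)
From Stdlib Require Import Reals.
From Coquelicot Require Import Coquelicot.
Open Scope R_scope.

Definition cpow (a : R) (z : C) : C :=
  (Rpower a (Re z) * cos (Im z * ln a), Rpower a (Re z) * sin (Im z * ln a)).

Definition CRInt (f : R -> C) (a b : R) : C :=
  (RInt (fun t => Re (f t)) a b, RInt (fun t => Im (f t)) a b).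

Definition Clim_seq (u : nat -> C) : C :=
  (real (Lim_seq (fun n => Re (u n))), real (Lim_seq (fun n => Im (u n)))).

Definition eta_partial (s : C) (N : nat) : C :=
  sum_n_m (fun n : nat => Cmult (RtoC ((-1) ^ (n - 1))) (cpow (INR n) (Copp s))) 1 N.

(* Riemann zeta function for Re s > 0, s <> 1, via the (convergent) eta series:
   zeta(s) = eta(s) / (1 - 2^(1-s)). *)
Definition zeta (s : C) : C :=
  Cdiv (Clim_seq (eta_partial s)) (Cminus (RtoC 1) (cpow 2 (Cminus (RtoC 1) s))).

Definition nat_floor (x : R) : nat := Z.to_nat (Int_part x).

Definition D_theta (theta sigma tau : R) : C :=
  sum_n_m (fun n : nat => cpow (INR n) ((- sigma)%R, (- tau)%R))
          1 (nat_floor (Rpower (tau / (2 * PI)) theta)).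

Definition M1 (theta : R) (b c : nat) (T : R) : C :=
  CRInt (fun t => Cmult (Cmult (D_theta theta (1/2) t)
                               (zeta ((1/2)%R, (- (INR b) * t)%R)))
                        (zeta ((1/2)%R, (- (INR c) * t)%R))) 0 T.

Definition euler_gamma : R :=
  real (Lim_seq (fun n => sum_f_R0 (fun k => / INR (S k)) n - ln (INR (S n)))).

Definition lambda_theta (theta : R) : R := 2 / theta - 1.

Definition K1 (b c : nat) : C :=
  Cmult (zeta (RtoC ((1 + INR b) / 2))) (zeta (RtoC ((1 + INR c) / 2))).

Definition pow2pi (theta : R) (r : nat) : R :=
  Rpower (2 * PI) (theta * (1/2 - 1 / (2 * INR r))).

Definition Ccoef (theta : R) (r s : nat) : C :=
  Cmult (RtoC (4 * INR r / (theta * (INR r - 1) * (lambda_theta theta * INR r + 1))))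
        (Cmult (zeta (RtoC (INR s / (2 * INR r) + 1/2))) (RtoC (pow2pi theta r))).

Definition E0 (r : nat) : R := 4 * euler_gamma / (INR r - 1) + 4 / (INR r - 1) ^ 2.
Definition E1 (r : nat) : R := 2 / (INR r * (INR r - 1)).
Definition F0 (theta : R) (r : nat) : R :=
  4 * euler_gamma / (lambda_theta theta * INR r + 1)
  - 4 / (lambda_theta theta * INR r + 1) ^ 2.
Definition F1 (theta : R) (r : nat) : R :=
  2 / (INR r * (lambda_theta theta * INR r + 1)).
Definition H0 (theta : R) (r : nat) : R := E0 r + F0 theta r.
Definition H1 (theta : R) (r : nat) : R := E1 r + F1 theta r.

Definition Hpoly (theta : R) (r : nat) (x : R) : R :=
  pow2pi theta r *
  (theta * H1 theta r * x + H0 theta r - theta * H1 theta r * ln (2 * PI)).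

Definition err_term (theta T : R) : R :=
  Rpower T (1 - theta / 2) * (ln T) ^ 2 + Rpower T (1/2 + theta / 2).

(* Main.v *)
(* M1 is the sum over n <= (T/2pi)^theta of the integrals of
   n^(-1/2-it) zeta(1/2-ibt) zeta(1/2-ict) over [2 pi n^(1/theta), T].  The integrand is
   holomorphic in z = u - it, and Cauchy's theorem moves the line u = 0 to u = 1/2, where both
   zeta factors are absolutely convergent Dirichlet series.  On the horizontal sides
   zeta(1/2+bu-ibt) = O(t^(1/4-u/2)), which follows from the Kusmin-Landau inequality and
   van der Corput's second derivative test, without the functional equation; these sides cost
   O(n^(-1/2) T^(1/2)) for each n, in total O(T^(1/2+theta/2)).  On u = 1/2 the terms with
   m^b k^c <> n cost O(T^theta log T), and m^b k^c = n gives, with V = (T/2pi)^theta,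
     T * sum_{m^b k^c <= V} m^(-(1+b)/2) k^(-(1+c)/2) (1 - (m^b k^c / V)^(1/theta)),
   which the hyperbola method evaluates up to O(T V^(-1/2)).  The zeta function only enters
   through Z_X(s) = sum_{m <= X} m^(-s) + X^(1-s)/(s-1) with X large depending on T. *)
Require Import Defs.
From Stdlib Require Import FunctionalExtensionality ZArith Reals Lra Lia Psatz.
From Coquelicot Require Import Coquelicot.
Open Scope R_scope.

(** * Complex powers, finite sums and curves *)

(** The target u = 1/2 is dictated by the factor n^(u-1/2): there it is unimodular, and since b, c
    >= 2 the zeta factors have real parts (1+b)/2 and (1+c)/2, both at least 3/2. On the way the two
    zeta factors together are O(t^(1/2-u)), and n <= t turns n^(u-1/2) t^(1/2-u) into n^(-1/2)
    t^(1/2) uniformly in u. Working with Z_X replaces analytic continuation by finitely many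
    exponentials and one quotient, whose holomorphy is explicit; the bounds are uniform in X once X
    exceeds a suitable power of T. All powers of V come from one parameter y with y^(b+c) = V, the
    side of the square in the hyperbola method. For b <> c the boundary terms at the corner m = k =
    y cancel exactly, and zeta(1/2 + c/(2b)) and zeta(1/2 + b/(2c)) remain. For b = c these
    arguments meet the pole at 1, and the harmonic sum that takes their place produces gamma and log
    T in H_b. The constants of the statement are elementary functions of p = (r-1)/2 and p' =
    r/theta - p = (lambda_theta r + 1)/2. *)

Definition cis (x : R) : C := (cos x, sin x).

Lemma C_eq (z w : C) : Re z = Re w -> Im z = Im w -> z = w.
Proof. destruct z, w; simpl; intros -> ->; reflexivity. Qed.

Lemma Re_mult (z w : C) : Re (z * w)%C = Re z * Re w - Im z * Im w.
Proof. reflexivity. Qed.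

Lemma Im_mult (z w : C) : Im (z * w)%C = Re z * Im w + Im z * Re w.
Proof. reflexivity. Qed.

Lemma Cmod_sqr (z : C) : Cmod z ^ 2 = Re z ^ 2 + Im z ^ 2.
Proof.
  unfold Cmod. rewrite pow2_sqrt; [reflexivity|].
  generalize (pow2_ge_0 (fst z)) (pow2_ge_0 (snd z)); lra.
Qed.

Lemma Rabs_Re_le (z : C) : Rabs (Re z) <= Cmod z.
Proof. eapply Rle_trans; [apply Rmax_l|apply Rmax_Cmod]. Qed.

Lemma Rabs_Im_le (z : C) : Rabs (Im z) <= Cmod z.
Proof. eapply Rle_trans; [apply Rmax_r|apply Rmax_Cmod]. Qed.

Lemma Cmod_cis (x : R) : Cmod (cis x) = 1.
Proof.
  unfold Cmod, cis; simpl.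
  replace (cos x * (cos x * 1) + sin x * (sin x * 1)) with 1; [apply sqrt_1|].
  generalize (sin2_cos2 x); unfold Rsqr; lra.
Qed.

Lemma cis_plus (x y : R) : cis (x + y) = (cis x * cis y)%C.
Proof.
  apply C_eq; unfold cis; simpl; [rewrite cos_plus | rewrite sin_plus]; ring.
Qed.

Lemma cpow_cis (a : R) (z : C) :
  cpow a z = (RtoC (Rpower a (Re z)) * cis (Im z * ln a))%C.
Proof. apply C_eq; unfold cpow, cis; simpl; ring. Qed.

Lemma Cmod_RtoC_nneg (x : R) : 0 <= x -> Cmod (RtoC x) = x.
Proof. intros H; rewrite Cmod_R; apply Rabs_pos_eq, H. Qed.

Lemma Cmod_self_minus (z : C) (b : R) : 0 <= b -> Cmod (z - z) <= b.
Proof. intros Hb. replace (z - z)%C with (RtoC 0) by ring. rewrite Cmod_0. exact Hb. Qed.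

Lemma div_le_1 (x y : R) : 0 < y -> x <= y -> x / y <= 1.
Proof.
  intros Hy H. apply (Rmult_le_reg_r y); [exact Hy|]. unfold Rdiv. rewrite Rmult_assoc, Rinv_l; lra.
Qed.

Lemma one_le_div (x y : R) : 0 < y -> y <= x -> 1 <= x / y.
Proof.
  intros Hy H. apply (Rmult_le_reg_r y); [exact Hy|]. unfold Rdiv. rewrite Rmult_assoc, Rinv_l; lra.
Qed.

Lemma Rabs_scal_le (c x e : R) : 0 <= c -> Rabs x <= e -> Rabs (c * x) <= c * e.
Proof.
  intros Hc H. rewrite Rabs_mult, (Rabs_pos_eq c) by exact Hc. apply Rmult_le_compat_l; assumption.
Qed.

Lemma INR_double (N : nat) : INR (2 * N) = 2 * INR N.
Proof. rewrite mult_INR. simpl. ring. Qed.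

Lemma sqrt_ge_1 (x : R) : 1 <= x -> 1 <= sqrt x.
Proof. intros H. rewrite <- sqrt_1. apply sqrt_le_1_alt, H. Qed.

Lemma sqrt_2_ge : 7 / 5 <= sqrt 2.
Proof. rewrite <- (sqrt_Rsqr (7 / 5)) by lra. apply sqrt_le_1_alt. unfold Rsqr; lra. Qed.

Lemma Rpower_pos (a x : R) : 0 < Rpower a x.
Proof. apply exp_pos. Qed.

Lemma Rpower_nneg (a x : R) : 0 <= Rpower a x.
Proof. apply Rlt_le, Rpower_pos. Qed.

Lemma Rpower_ge_1 (x e : R) : 1 <= x -> 0 <= e -> 1 <= Rpower x e.
Proof. intros Hx He. rewrite <- (Rpower_O x) at 1 by lra. apply Rle_Rpower; lra. Qed.

Lemma Cmod_cpow (a : R) (z : C) : Cmod (cpow a z) = Rpower a (Re z).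
Proof.
  rewrite cpow_cis, Cmod_mult, Cmod_cis, Cmod_RtoC_nneg, Rmult_1_r; [reflexivity|].
  apply Rpower_nneg.
Qed.

Lemma cpow_plus (a : R) (z w : C) : cpow a (z + w)%C = (cpow a z * cpow a w)%C.
Proof.
  rewrite !cpow_cis.
  change (Re (z + w)%C) with (Re z + Re w). change (Im (z + w)%C) with (Im z + Im w).
  rewrite Rpower_plus, Rmult_plus_distr_r, cis_plus, RtoC_mult.
  ring.
Qed.

Lemma cpow_mult_base (a b : R) (z : C) :
  0 < a -> 0 < b -> cpow (a * b) z = (cpow a z * cpow b z)%C.
Proof.
  intros Ha Hb. rewrite !cpow_cis, ln_mult, Rmult_plus_distr_l, cis_plus by assumption.
  rewrite <- (Rpower_mult_distr a b (Re z)), RtoC_mult by assumption. ring.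
Qed.

Lemma cpow_RtoC (a x : R) : cpow a (RtoC x) = RtoC (Rpower a x).
Proof.
  apply C_eq; unfold cpow; simpl; rewrite Rmult_0_l; rewrite ?cos_0, ?sin_0; ring.
Qed.

Lemma cpow_0 (a : R) : cpow a (RtoC 0) = RtoC 1.
Proof. rewrite cpow_RtoC; unfold Rpower; rewrite Rmult_0_l, exp_0; reflexivity. Qed.

(** Both sums run over 1 <= m <= n, the range of Dirichlet polynomials, and unfold at the last term;
    [csum_sum_n_m] links them to [sum_n_m]. *)
Fixpoint rsum (f : nat -> R) (n : nat) : R :=
  match n with O => 0 | S k => rsum f k + f (S k) end.

Fixpoint csum (f : nat -> C) (n : nat) : C :=
  match n with O => RtoC 0 | S k => (csum f k + f (S k))%C end.

Lemma rsum_ext (f g : nat -> R) (n : nat) :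
  (forall m, (1 <= m <= n)%nat -> f m = g m) -> rsum f n = rsum g n.
Proof.
  induction n as [|n IH]; intros H; simpl; [reflexivity|].
  rewrite IH, H; [reflexivity|lia|intros; apply H; lia].
Qed.

Lemma csum_ext (f g : nat -> C) (n : nat) :
  (forall m, (1 <= m <= n)%nat -> f m = g m) -> csum f n = csum g n.
Proof.
  induction n as [|n IH]; intros H; simpl; [reflexivity|].
  rewrite IH, H; [reflexivity|lia|intros; apply H; lia].
Qed.

Lemma rsum_le (f g : nat -> R) (n : nat) :
  (forall m, (1 <= m <= n)%nat -> f m <= g m) -> rsum f n <= rsum g n.
Proof.
  induction n as [|n IH]; intros H; simpl; [lra|].
  apply Rplus_le_compat; [apply IH; intros; apply H; lia|apply H; lia].
Qed.

Lemma rsum_nneg (f : nat -> R) (n : nat) :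
  (forall m, (1 <= m <= n)%nat -> 0 <= f m) -> 0 <= rsum f n.
Proof.
  induction n as [|n IH]; intros H; simpl; [lra|].
  apply Rplus_le_le_0_compat; [apply IH; intros; apply H; lia|apply H; lia].
Qed.

Lemma rsum_plus (f g : nat -> R) (n : nat) :
  rsum (fun m => f m + g m) n = rsum f n + rsum g n.
Proof. induction n as [|n IH]; simpl; [ring|rewrite IH; ring]. Qed.

Lemma rsum_scal (c : R) (f : nat -> R) (n : nat) :
  rsum (fun m => c * f m) n = c * rsum f n.
Proof. induction n as [|n IH]; simpl; [ring|rewrite IH; ring]. Qed.

Lemma csum_scal (c : C) (f : nat -> C) (n : nat) :
  csum (fun m => c * f m)%C n = (c * csum f n)%C.
Proof. induction n as [|n IH]; simpl; [ring|rewrite IH; ring]. Qed.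

Lemma csum_minus (f g : nat -> C) (n : nat) :
  csum (fun m => f m - g m)%C n = (csum f n - csum g n)%C.
Proof. induction n as [|n IH]; simpl; [ring|rewrite IH; ring]. Qed.

Lemma rsum_minus (f g : nat -> R) (n : nat) :
  rsum (fun m => f m - g m) n = rsum f n - rsum g n.
Proof. induction n as [|n IH]; simpl; [ring|rewrite IH; ring]. Qed.

Lemma csum_Cmod (f : nat -> C) (n : nat) :
  Cmod (csum f n) <= rsum (fun m => Cmod (f m)) n.
Proof.
  induction n as [|n IH]; simpl; [rewrite Cmod_0; lra|].
  eapply Rle_trans; [apply Cmod_triangle|]. lra.
Qed.

Lemma csum_RtoC (f : nat -> R) (n : nat) :
  csum (fun m => RtoC (f m)) n = RtoC (rsum f n).
Proof. induction n as [|n IH]; simpl; [reflexivity|rewrite IH, <- RtoC_plus; reflexivity]. Qed.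

Lemma rsum_const (c : R) (n : nat) : rsum (fun _ => c) n = INR n * c.
Proof. induction n as [|n IH]; [simpl; ring|]. rewrite S_INR; simpl; rewrite IH; ring. Qed.

Lemma csum_sum_n_m (f : nat -> C) (n : nat) :
  sum_n_m (G := C_AbelianMonoid) f 1 n = csum f n.
Proof.
  induction n as [|n IH].
  - rewrite sum_n_m_zero by lia. reflexivity.
  - rewrite sum_n_Sm by lia. rewrite IH. reflexivity.
Qed.

Lemma rsum_exchange (f : nat -> nat -> R) (n p : nat) :
  rsum (fun m => rsum (f m) p) n = rsum (fun k => rsum (fun m => f m k) n) p.
Proof.
  induction n as [|n IH]; simpl.
  - induction p as [|p IHp]; simpl; [reflexivity|rewrite <- IHp; ring].
  - rewrite IH, <- rsum_plus; reflexivity.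
Qed.

Lemma rsum_split (f : nat -> R) (n p : nat) :
  rsum f (n + p) = rsum f n + rsum (fun k => f (n + k)%nat) p.
Proof.
  induction p as [|p IH]; simpl; [rewrite Nat.add_0_r; ring|].
  rewrite Nat.add_succ_r; simpl. rewrite IH. ring.
Qed.

Lemma rsum_sub_le (f : nat -> R) (n p : nat) :
  (n <= p)%nat -> (forall m, (1 <= m <= p)%nat -> 0 <= f m) -> rsum f n <= rsum f p.
Proof.
  intros Hnp Hf. replace p with (n + (p - n))%nat by lia. rewrite rsum_split.
  assert (0 <= rsum (fun k => f (n + k)%nat) (p - n)).
  { apply rsum_nneg; intros; apply Hf; lia. }
  lra.
Qed.

Definition is_cderive (F : R -> C) (x : R) (v : C) : Prop :=
  is_derive (fun t => Re (F t)) x (Re v) /\ is_derive (fun t => Im (F t)) x (Im v).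

Lemma is_cderive_eq (F : R -> C) (x : R) (v w : C) :
  is_cderive F x v -> v = w -> is_cderive F x w.
Proof. intros H <-; exact H. Qed.

Lemma is_cderive_plus (F G : R -> C) (x : R) (v w : C) :
  is_cderive F x v -> is_cderive G x w -> is_cderive (fun t => F t + G t)%C x (v + w)%C.
Proof.
  intros [F1 F2] [G1 G2]; split.
  - apply (is_derive_plus (fun t => Re (F t)) (fun t => Re (G t))); assumption.
  - apply (is_derive_plus (fun t => Im (F t)) (fun t => Im (G t))); assumption.
Qed.

Lemma is_cderive_minus (F G : R -> C) (x : R) (v w : C) :
  is_cderive F x v -> is_cderive G x w -> is_cderive (fun t => F t - G t)%C x (v - w)%C.
Proof.
  intros [F1 F2] [G1 G2]; split.
  - apply (is_derive_minus (fun t => Re (F t)) (fun t => Re (G t))); assumption.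
  - apply (is_derive_minus (fun t => Im (F t)) (fun t => Im (G t))); assumption.
Qed.

Lemma is_derive_Rmult (f g : R -> R) (x a b : R) :
  is_derive f x a -> is_derive g x b ->
  is_derive (fun t => f t * g t) x (a * g x + f x * b).
Proof.
  intros Hf Hg. apply (is_derive_mult f g); try assumption. intros; apply Rmult_comm.
Qed.

Lemma is_cderive_mult (F G : R -> C) (x : R) (v w : C) :
  is_cderive F x v -> is_cderive G x w ->
  is_cderive (fun t => F t * G t)%C x (v * G x + F x * w)%C.
Proof.
  intros [F1 F2] [G1 G2]; split.
  - evar_last.
    + apply (is_derive_minus (fun t => Re (F t) * Re (G t)) (fun t => Im (F t) * Im (G t)));
        apply is_derive_Rmult; eassumption.
    + unfold minus, plus, opp; simpl. unfold Re, Im. ring.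
  - evar_last.
    + apply (is_derive_plus (fun t => Re (F t) * Im (G t)) (fun t => Im (F t) * Re (G t)));
        apply is_derive_Rmult; eassumption.
    + unfold plus; simpl. unfold Re, Im. ring.
Qed.

Lemma is_cderive_const (c : C) (x : R) : is_cderive (fun _ => c) x (RtoC 0).
Proof. split; apply (is_derive_const (K := R_AbsRing) (V := R_NormedModule)). Qed.

(* The mean value theorem is applied to the projection onto the direction of F b - F a. *)
Lemma curve_increment_le (F dF : R -> C) (G dG : R -> R) (a b : R) :
  a <= b ->
  (forall x, a <= x <= b -> is_cderive F x (dF x)) ->
  (forall x, a <= x <= b -> is_derive G x (dG x)) ->
  (forall x, a <= x <= b -> Cmod (dF x) <= dG x) ->
  Cmod (F b - F a) <= G b - G a.
Proof.
  intros Hab HF HG Hle.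
  set (w := (F b - F a)%C).
  set (h := fun x => Re w * Re (F x) + Im w * Im (F x) - Cmod w * G x).
  set (dh := fun x => Re w * Re (dF x) + Im w * Im (dF x) - Cmod w * dG x).
  assert (Hh : forall x, a <= x <= b -> is_derive h x (dh x)).
  { intros x Hx. destruct (HF x Hx) as [H1 H2]. specialize (HG x Hx).
    apply (is_derive_minus (fun x => Re w * Re (F x) + Im w * Im (F x)) (fun x => Cmod w * G x)).
    - apply (is_derive_plus (fun x => Re w * Re (F x)) (fun x => Im w * Im (F x)));
        apply (is_derive_scal (fun x => _)); assumption.
    - apply (is_derive_scal (fun x => _)); assumption. }
  destruct (MVT_gen h a b dh) as [c [Hc Heq]].
  - intros x Hx. rewrite Rmin_left, Rmax_right in Hx by lra. apply Hh; lra.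
  - intros x Hx. rewrite Rmin_left, Rmax_right in Hx by lra.
    apply derivable_continuous_pt. exists (dh x). apply is_derive_Reals, Hh, Hx.
  - rewrite Rmin_left, Rmax_right in Hc by lra.
    assert (Hd : dh c <= 0).
    { unfold dh. assert (Re w * Re (dF c) + Im w * Im (dF c) <= Cmod w * Cmod (dF c)).
      { apply Rle_trans with (Cmod (Cconj w * dF c)).
        - apply Rle_trans with (Rabs (Re (Cconj w * dF c)%C)); [|apply Rabs_Re_le].
          + eapply Rle_trans; [|apply Rle_abs]. rewrite Re_mult. simpl. right. unfold Im, Re. ring.
        - rewrite Cmod_mult, Cmod_conj. lra. }
      specialize (Hle c Hc). generalize (Cmod_ge_0 w). nra. }
    assert (Hhh : h b - h a <= 0) by (rewrite Heq; nra).
    assert (Hw : h b - h a = Cmod w ^ 2 - Cmod w * (G b - G a)).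
    { assert (Hr : Re w = Re (F b) - Re (F a)) by reflexivity.
      assert (Hi : Im w = Im (F b) - Im (F a)) by reflexivity.
      rewrite Cmod_sqr. unfold h. clearbody w. rewrite Hr, Hi. ring. }
    (* The bound |w|^2 <= |w| (G b - G a) can be divided by |w| only if w <> 0. For w = 0 the claim
       is G a <= G b, which follows from dG >= |dF| >= 0. *)
    destruct (Rle_lt_or_eq_dec 0 (Cmod w) (Cmod_ge_0 w)) as [Hpos|H0].
    + nra.
    + rewrite <- H0.
      destruct (MVT_gen G a b dG) as [e [He HGe]].
      * intros x Hx. rewrite Rmin_left, Rmax_right in Hx by lra. apply HG; lra.
      * intros x Hx. rewrite Rmin_left, Rmax_right in Hx by lra.
        apply derivable_continuous_pt. exists (dG x). apply is_derive_Reals, HG, Hx.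
      * rewrite Rmin_left, Rmax_right in He by lra. rewrite HGe.
        specialize (Hle e He). generalize (Cmod_ge_0 (dF e)). nra.
Qed.

Lemma is_cderive_cpow (s : C) (x : R) :
  0 < x -> is_cderive (fun x => cpow x s) x (s * cpow x (s - 1))%C.
Proof.
  intros Hx. destruct s as [p q].
  assert (He : exp ((p + - (1)) * ln x) = exp (p * ln x) / x).
  { replace ((p + - (1)) * ln x) with (p * ln x + - ln x) by ring.
    rewrite exp_plus, exp_Ropp, exp_ln by assumption. field. lra. }
  split; unfold cpow, Rpower; simpl.
  - auto_derive; [tauto|]. rewrite He. replace ((q + - 0)) with q by ring. field. lra.
  - auto_derive; [tauto|]. rewrite He. replace ((q + - 0)) with q by ring. field. lra.
Qed.

Lemma is_derive_Rpower (p x : R) :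
  0 < x -> is_derive (fun x => Rpower x p) x (p * Rpower x (p - 1)).
Proof.
  intros Hx. unfold Rpower. auto_derive; [tauto|].
  replace ((p - 1) * ln x) with (p * ln x + - ln x) by ring.
  rewrite exp_plus, exp_Ropp, exp_ln by assumption. field. lra.
Qed.

(** * The eta series and the truncated zeta function *)

Definition zapprox (N : nat) (s : C) : C :=
  (csum (fun m => cpow (INR m) (- s)) N + cpow (INR N) (1 - s) / (s - 1))%C.

Lemma INR_pos (n : nat) : (1 <= n)%nat -> 0 < INR n.
Proof. intros H; apply lt_0_INR; lia. Qed.

Lemma INR_ge_1 (n : nat) : (1 <= n)%nat -> 1 <= INR n.
Proof. intros H. apply (le_INR 1 n) in H. exact H. Qed.

Lemma Cminus_neq_0 (z w : C) : z <> w -> (z - w)%C <> RtoC 0.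
Proof.
  intros Hzw H. apply Hzw. replace z with (w + (z - w))%C by ring. rewrite H. ring.
Qed.

(** The curve x^(-s) has speed |s| x^(-Re s - 1), whose primitive is -(|s| / Re s) x^(-Re s). *)
Lemma cpow_increment_le (s : C) (x y : R) :
  0 < Re s -> 0 < x <= y ->
  Cmod (cpow y (- s) - cpow x (- s))
    <= Cmod s / Re s * (Rpower x (- Re s) - Rpower y (- Re s)).
Proof.
  intros Hs [Hx Hxy].
  eapply Rle_trans.
  - apply (curve_increment_le (fun x => cpow x (- s)) (fun x => (- s) * cpow x (- s - 1))%C
      (fun x => - (Cmod s / Re s) * Rpower x (- Re s))
      (fun x => Cmod s * Rpower x (- Re s - 1)) x y Hxy).
    + intros u Hu. apply is_cderive_cpow; lra.
    + intros u Hu. evar_last.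
      * apply (is_derive_scal (fun u => Rpower u (- Re s))), is_derive_Rpower; lra.
      * simpl. field. lra.
    + intros u Hu. rewrite Cmod_mult, Cmod_opp, Cmod_cpow. simpl. right. reflexivity.
  - simpl. right. ring.
Qed.

(** The difference is (n+1)^(-s) minus the integral of x^(-s) over [n, n+1]. With b = n+1, the curve
    [F] is a primitive of x^(-s) - b^(-s), so the variation of x^(-s) over the interval bounds its
    increment. *)
Lemma zapprox_step (s : C) (n : nat) :
  0 < Re s -> s <> RtoC 1 -> (1 <= n)%nat ->
  Cmod (zapprox (S n) s - zapprox n s)
    <= Cmod s / Re s * (Rpower (INR n) (- Re s) - Rpower (INR (S n)) (- Re s)).
Proof.
  intros Hs Hs1 Hn. apply INR_pos in Hn.
  pose proof (Cminus_neq_0 _ _ Hs1) as Hs1''.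
  assert (Hs1' : (1 - s)%C <> RtoC 0) by (apply Cminus_neq_0; auto).
  set (a := INR n). set (b := INR (S n)). fold a in Hn.
  assert (Hb : b = a + 1) by (unfold a, b; rewrite S_INR; reflexivity).
  set (K := Cmod s / Re s * (Rpower a (- Re s) - Rpower b (- Re s))).
  set (F := fun x => (/ (1 - s) * cpow x (1 - s) - RtoC x * cpow b (- s))%C).
  replace (zapprox (S n) s - zapprox n s)%C with (- (F b - F a))%C.
  2:{ unfold F, zapprox. fold a b. cbn [csum]. fold b. rewrite Hb.
      replace (RtoC (a + 1)) with (RtoC a + 1)%C by (rewrite RtoC_plus; reflexivity).
      field. split; assumption. }
  rewrite Cmod_opp.
  eapply Rle_trans.
  - apply (curve_increment_le F (fun x => cpow x (- s) - cpow b (- s))%C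
      (fun x => K * x) (fun x => K) a b); [lra| | |].
    + intros x Hx. unfold F. apply is_cderive_minus.
      * eapply is_cderive_eq.
        -- apply is_cderive_mult; [apply is_cderive_const|apply is_cderive_cpow; lra].
        -- replace (1 - s - 1)%C with (- s)%C by ring. field. assumption.
      * eapply is_cderive_eq.
        -- apply is_cderive_mult; [|apply is_cderive_const].
           instantiate (1 := RtoC 1). split; simpl; auto_derive; auto.
        -- cbv beta. ring.
    + intros x Hx. auto_derive; auto. ring.
    + intros x Hx. rewrite <- Cmod_opp.
      replace (- (cpow x (- s) - cpow b (- s)))%C with (cpow b (- s) - cpow x (- s))%C by ring.
      eapply Rle_trans; [apply cpow_increment_le; lra|].
      unfold K. apply Rmult_le_compat_l.
      * apply Rmult_le_pos; [apply Cmod_ge_0|left; apply Rinv_0_lt_compat, Hs].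
      * apply Rplus_le_compat_r. rewrite !Rpower_Ropp.
        apply Rinv_le_contravar; [apply Rpower_pos|].
        apply Rle_Rpower_l; lra.
  - right. transitivity (K * (b - a)); [ring|]. replace (b - a) with 1 by lra. ring.
Qed.

Lemma zapprox_diff (s : C) (N M : nat) :
  0 < Re s -> s <> RtoC 1 -> (1 <= N <= M)%nat ->
  Cmod (zapprox M s - zapprox N s) <= Cmod s / Re s * Rpower (INR N) (- Re s).
Proof.
  intros Hs Hs1 [HN HNM].
  (* The induction needs the telescoping form; the term in M is dropped only afterwards. *)
  assert (H : Cmod (zapprox M s - zapprox N s)
    <= Cmod s / Re s * (Rpower (INR N) (- Re s) - Rpower (INR M) (- Re s))).
  { induction HNM as [|M HM IH].
    - apply Cmod_self_minus. right; ring.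
    - replace (zapprox (S M) s - zapprox N s)%C
        with ((zapprox (S M) s - zapprox M s) + (zapprox M s - zapprox N s))%C by ring.
      eapply Rle_trans; [apply Cmod_triangle|].
      eapply Rle_trans; [apply Rplus_le_compat; [apply zapprox_step|apply IH]|];
        try assumption; try lia. right; ring. }
  assert (0 <= Cmod s / Re s * Rpower (INR M) (- Re s)).
  { apply Rmult_le_pos; [apply Rmult_le_pos; [apply Cmod_ge_0|]|];
      left; [apply Rinv_0_lt_compat, Hs|apply Rpower_pos]. }
  lra.
Qed.

Lemma Rpower_INR_small (p eps : R) :
  0 < p -> 0 < eps ->
  exists N0, (1 <= N0)%nat /\ forall N, (N0 <= N)%nat -> Rpower (INR N) (- p) < eps.
Proof.
  intros Hp He.
  destruct (INR_unbounded (Rpower eps (- / p))) as [N0 HN0].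
  exists (S N0). split; [lia|]. intros N HN.
  assert (H : Rpower eps (- / p) < INR N).
  { eapply Rlt_le_trans; [apply HN0|]. apply le_INR; lia. }
  replace eps with (Rpower (Rpower eps (- / p)) (- p)).
  - rewrite !(Rpower_Ropp _ p). apply Rinv_0_lt_contravar; [apply Rpower_pos|].
    apply Rlt_Rpower_l; [assumption|]. split; [apply Rpower_pos|exact H].
  - rewrite Rpower_mult. replace (- / p * - p) with 1 by (field; lra).
    apply Rpower_1, He.
Qed.

(** Cauchy's criterion with a rate: since [e N] bounds |u M - u N| for every later M, it also bounds
    the distance from u N to the limit. The limit is built from the two coordinate projections,
    which are 1-Lipschitz. *)
Lemma C_Cauchy_bound (u : nat -> C) (e : nat -> R) :
  (forall N M, (1 <= N <= M)%nat -> Cmod (u M - u N) <= e N) ->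
  (forall eps, 0 < eps -> exists N0, (1 <= N0)%nat /\ forall N, (N0 <= N)%nat -> e N < eps) ->
  exists l, forall N, (1 <= N)%nat -> Cmod (l - u N) <= e N.
Proof.
  intros Hu He.
  assert (HC : forall p : C -> R, (forall z w, Rabs (p z - p w) <= Cmod (z - w)%C) ->
    exists l, is_lim_seq (fun n => p (u n)) (Finite l)).
  { intros p Hp. apply ex_lim_seq_cauchy_corr. intros eps.
    destruct (He (eps / 2)) as [N0 [H1 H2]]; [destruct eps; simpl; lra|].
    exists N0. intros n m Hn Hm.
    replace (p (u n) - p (u m)) with ((p (u n) - p (u N0)) - (p (u m) - p (u N0))) by ring.
    eapply Rle_lt_trans; [apply Rabs_triang|]. rewrite Rabs_Ropp.
    specialize (H2 N0 (le_n _)).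
    pose proof (Hp (u n) (u N0)). pose proof (Hp (u m) (u N0)).
    pose proof (Hu N0 n ltac:(lia)). pose proof (Hu N0 m ltac:(lia)). lra. }
  destruct (HC Re) as [l1 Hl1].
  { intros z w. apply (Rabs_Re_le (z - w)). }
  destruct (HC Im) as [l2 Hl2].
  { intros z w. apply (Rabs_Im_le (z - w)). }
  exists (l1, l2). intros N HN.
  apply Rnot_lt_le. intros Hlt.
  set (d := Cmod ((l1, l2) - u N)%C - e N) in *.
  assert (Hd : 0 < d) by (unfold d; lra).
  apply is_lim_seq_spec in Hl1. apply is_lim_seq_spec in Hl2.
  destruct (Hl1 (mkposreal (d / 4) ltac:(lra))) as [N1 H1].
  destruct (Hl2 (mkposreal (d / 4) ltac:(lra))) as [N2 H2].
  set (M := (N + N1 + N2)%nat).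
  specialize (H1 M ltac:(lia)). specialize (H2 M ltac:(lia)). simpl in H1, H2.
  pose proof (Hu N M ltac:(lia)) as H3.
  assert (H4 : Cmod ((l1, l2) - u M)%C <= d / 2).
  { eapply Rle_trans; [apply Cmod_2Rmax|].
    change (fst ((l1, l2) - u M)%C) with (l1 - Re (u M)).
    change (snd ((l1, l2) - u M)%C) with (l2 - Im (u M)).
    rewrite (Rabs_minus_sym l1), (Rabs_minus_sym l2).
    assert (Hm : Rmax (Rabs (Re (u M) - l1)) (Rabs (Im (u M) - l2)) <= d / 4).
    { apply Rmax_lub; lra. }
    assert (Hs : sqrt 2 <= 2).
    { rewrite <- (sqrt_Rsqr 2) at 2 by lra. apply sqrt_le_1_alt. unfold Rsqr; lra. }
    assert (0 <= sqrt 2) by apply sqrt_pos.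
    assert (0 <= Rmax (Rabs (Re (u M) - l1)) (Rabs (Im (u M) - l2))).
    { eapply Rle_trans; [|apply Rmax_l]. apply Rabs_pos. }
    nra. }
  assert (H5 : Cmod ((l1, l2) - u N)%C <= Cmod ((l1, l2) - u M)%C + Cmod (u M - u N)%C).
  { replace ((l1, l2) - u N)%C with (((l1, l2) - u M) + (u M - u N))%C by ring.
    apply Cmod_triangle. }
  unfold d in *. lra.
Qed.

Lemma eta_partial_csum (s : C) (N : nat) :
  eta_partial s N = csum (fun n => RtoC ((-1) ^ (n - 1)) * cpow (INR n) (- s))%C N.
Proof. unfold eta_partial. apply csum_sum_n_m. Qed.

Lemma cpow_1_minus (a : R) (s : C) : 0 < a -> cpow a (1 - s) = (RtoC a * cpow a (- s))%C.
Proof.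
  intros Ha. replace (1 - s)%C with (RtoC 1 + - s)%C by ring.
  rewrite cpow_plus, cpow_RtoC, Rpower_1 by assumption. reflexivity.
Qed.

(** The alternating sum up to 2N is the full sum minus twice its even terms, and the even terms are
    2^(-s) times the sum up to N. The correction terms cancel because (2N)^(1-s) = 2^(1-s)
    N^(1-s). *)
Lemma eta_even (s : C) (N : nat) :
  s <> RtoC 1 -> (1 <= N)%nat ->
  eta_partial s (2 * N) = (zapprox (2 * N) s - cpow 2 (1 - s) * zapprox N s)%C.
Proof.
  intros Hs HN. rewrite eta_partial_csum.
  pose proof (Cminus_neq_0 _ _ Hs) as Hs1.
  assert (H : forall K, csum (fun n => RtoC ((-1) ^ (n - 1)) * cpow (INR n) (- s))%C (2 * K)
    = (csum (fun m => cpow (INR m) (- s)) (2 * K)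
       - cpow 2 (1 - s) * csum (fun m => cpow (INR m) (- s)) K)%C).
  { intros K. induction K as [|K IH]; [simpl; ring|].
    replace (2 * S K)%nat with (S (S (2 * K))) by lia.
    cbn [csum]. rewrite IH.
    replace (S (2 * K) - 1)%nat with (2 * K)%nat by lia.
    replace (S (S (2 * K)) - 1)%nat with (S (2 * K)) by lia.
    rewrite pow_1_odd, pow_1_even.
    rewrite (cpow_1_minus 2) by lra.
    replace (INR (S (S (2 * K)))) with (2 * INR (S K)).
    2:{ rewrite !S_INR, mult_INR. simpl. ring. }
    rewrite cpow_mult_base by (try lra; apply INR_pos; lia).
    replace (RtoC (-1)) with (- RtoC 1)%C by (apply C_eq; simpl; ring).
    ring. }
  rewrite H. unfold zapprox.
  rewrite (mult_INR 2 N). change (INR 2) with 2.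
  rewrite (cpow_mult_base 2) by (try lra; apply INR_pos; lia).
  field. assumption.
Qed.

(** If L is the limit of [zapprox n s], then by [eta_even] the eta series converges to (1 - 2^(1-s))
    L. The hypothesis 2^(1-s) <> 1 allows the division in [zeta] and also excludes s = 1. Hence
    zeta(s) = L, with the rate of the Cauchy bound. *)
Theorem zeta_zapprox (s : C) (N : nat) :
  0 < Re s -> cpow 2 (1 - s) <> RtoC 1 -> (1 <= N)%nat ->
  Cmod (zeta s - zapprox N s) <= Cmod s / Re s * Rpower (INR N) (- Re s).
Proof.
  intros Hs Hq HN.
  assert (Hs1 : s <> RtoC 1).
  { intros ->. apply Hq. replace (1 - 1)%C with (RtoC 0) by ring. apply cpow_0. }
  set (K := Cmod s / Re s).
  assert (HK : 0 <= K).
  { apply Rmult_le_pos; [apply Cmod_ge_0|left; apply Rinv_0_lt_compat, Hs]. }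
  destruct (C_Cauchy_bound (fun n => zapprox n s) (fun n => K * Rpower (INR n) (- Re s)))
    as [L HL].
  { intros; apply zapprox_diff; assumption. }
  { intros eps He. destruct (Rpower_INR_small (Re s) (eps / (K + 1)) Hs) as [N0 [H1 H2]].
    - apply Rdiv_lt_0_compat; lra.
    - exists N0. split; [assumption|]. intros M HM. specialize (H2 M HM).
      pose proof (Rpower_pos (INR M) (- Re s)).
      assert (eps / (K + 1) * (K + 1) = eps) by (field; lra). nra. }
  set (q := cpow 2 (1 - s)). fold q in Hq.
  set (A := ((1 - q) * L)%C).
  assert (Heven : forall M, (1 <= M)%nat -> Cmod (eta_partial s (2 * M) - A)
     <= K * (1 + Cmod q) * Rpower (INR M) (- Re s)).
  { intros M HM. rewrite eta_even by assumption. fold q. unfold A.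
    replace (zapprox (2 * M) s - q * zapprox M s - (1 - q) * L)%C
      with (- (L - zapprox (2 * M) s) + q * (L - zapprox M s))%C by ring.
    eapply Rle_trans; [apply Cmod_triangle|]. rewrite Cmod_opp, Cmod_mult.
    pose proof (HL (2 * M)%nat ltac:(lia)) as H1. pose proof (HL M HM) as H2.
    simpl in H1, H2.
    assert (H3 : Rpower (INR (M + (M + 0))) (- Re s) <= Rpower (INR M) (- Re s)).
    { rewrite !Rpower_Ropp. apply Rinv_le_contravar; [apply Rpower_pos|].
      apply Rle_Rpower_l; [lra|]. split; [apply INR_pos, HM|apply le_INR; lia]. }
    apply (Rmult_le_compat_l K _ _ HK) in H3.
    apply (Rmult_le_compat_l (Cmod q) _ _ (Cmod_ge_0 q)) in H2.
    eapply Rle_trans; [apply Rplus_le_compat; [apply H1|apply H2]|]. lra. }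
  assert (Hlim : forall eps, 0 < eps -> exists N0, forall n, (N0 <= n)%nat ->
    Cmod (eta_partial s n - A) < eps).
  { intros eps He.
    (* The summand 1 pays for the additional term (2M+1)^(-s) of an odd partial sum, which is at
       most M^(-Re s) in modulus. *)
    set (B := K * (1 + Cmod q) + 1).
    assert (HB : 1 <= B).
    { unfold B. pose proof (Cmod_ge_0 q).
      assert (0 <= K * (1 + Cmod q)) by (apply Rmult_le_pos; lra). lra. }
    destruct (Rpower_INR_small (Re s) (eps / B) Hs) as [N0 [H1 H2]].
    { apply Rdiv_lt_0_compat; lra. }
    exists (2 * N0 + 1)%nat. intros n Hn.
    assert (Hfin : forall M, (N0 <= M)%nat -> B * Rpower (INR M) (- Re s) < eps).
    { intros M HM. specialize (H2 M HM).
      apply (Rmult_lt_compat_l B) in H2; [|lra].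
      replace (B * (eps / B)) with eps in H2 by (field; lra). exact H2. }
    destruct (Nat.Even_or_Odd n) as [[M ->]|[M ->]].
    - specialize (Heven M ltac:(lia)). specialize (Hfin M ltac:(lia)).
      pose proof (Rpower_pos (INR M) (- Re s)). unfold B in Hfin. lra.
    - specialize (Heven M ltac:(lia)). specialize (Hfin M ltac:(lia)).
      assert (Hodd : eta_partial s (2 * M + 1)
        = (eta_partial s (2 * M) + RtoC ((-1) ^ (2 * M)) * cpow (INR (2 * M + 1)) (- s))%C).
      { rewrite !eta_partial_csum. rewrite Nat.add_1_r. cbn [csum].
        replace (S (2 * M) - 1)%nat with (2 * M)%nat by lia. reflexivity. }
      rewrite Hodd, pow_1_even.
      replace (eta_partial s (2 * M) + RtoC 1 * cpow (INR (2 * M + 1)) (- s) - A)%C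
        with ((eta_partial s (2 * M) - A) + cpow (INR (2 * M + 1)) (- s))%C by ring.
      eapply Rle_lt_trans; [apply Cmod_triangle|]. rewrite Cmod_cpow.
      assert (H3 : Rpower (INR (2 * M + 1)) (Re (- s)%C) <= Rpower (INR M) (- Re s)).
      { change (Re (- s)%C) with (- Re s). rewrite !Rpower_Ropp.
        apply Rinv_le_contravar; [apply Rpower_pos|].
        apply Rle_Rpower_l; [lra|]. split; [apply INR_pos; lia|apply le_INR; lia]. }
      unfold B in Hfin. lra. }
  assert (HA : Clim_seq (eta_partial s) = A).
  { assert (Hp : forall p : C -> R, (forall z w, Rabs (p z - p w) <= Cmod (z - w)%C) ->
      real (Lim_seq (fun n => p (eta_partial s n))) = p A).
    { intros p Hp. rewrite (is_lim_seq_unique _ (Finite (p A))); [reflexivity|].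
      apply is_lim_seq_spec. intros eps.
      destruct (Hlim eps (cond_pos eps)) as [N0 HN0]. exists N0. intros n Hn.
      eapply Rle_lt_trans; [apply Hp|apply HN0, Hn]. }
    apply C_eq; unfold Clim_seq; simpl.
    - apply (Hp Re). intros z w. apply (Rabs_Re_le (z - w)).
    - apply (Hp Im). intros z w. apply (Rabs_Im_le (z - w)). }
  assert (Hz : zeta s = L).
  { unfold zeta. rewrite HA. fold q. unfold A. field.
    apply Cminus_neq_0. auto. }
  rewrite Hz. apply HL, HN.
Qed.

(** * Exponential sums *)

Lemma sin_ge_half (d : R) : 0 <= d <= 1 -> d / 2 <= sin d.
Proof.
  intros Hd. pose proof PI2_3_2 as HPI.
  destruct (MVT_gen sin 0 d cos) as [c [Hc Heq]].
  - intros x _. apply is_derive_Reals, derivable_pt_lim_sin.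
  - intros x _. apply continuity_sin.
  - rewrite Rmin_left, Rmax_right in Hc by lra.
    rewrite sin_0 in Heq.
    assert (1 / 2 <= cos c).
    { rewrite <- cos_PI3. apply cos_decr_1; lra. }
    nra.
Qed.

Lemma sin_ge_half_sym (d x : R) : 0 < d <= 1 -> d <= x <= PI - d -> d / 2 <= sin x.
Proof.
  intros Hd Hx. pose proof PI2_3_2 as HPI.
  eapply Rle_trans; [apply sin_ge_half; lra|].
  destruct (Rle_dec x (PI / 2)).
  - apply sin_incr_1; lra.
  - rewrite <- (sin_PI_x x). apply sin_incr_1; lra.
Qed.

(** The difference of the cotangents is sin(b - a) / (sin a sin b). *)
Lemma cot_antitone (a b : R) :
  0 < a <= b -> b < PI -> cos b / sin b <= cos a / sin a.
Proof.
  intros Ha Hb.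
  assert (Hsa : 0 < sin a) by (apply sin_gt_0; lra).
  assert (Hsb : 0 < sin b) by (apply sin_gt_0; lra).
  assert (Hs : 0 <= sin (b - a)) by (apply sin_ge_0; lra).
  rewrite sin_minus in Hs.
  assert (H : cos a / sin a - cos b / sin b
    = (sin b * cos a - cos b * sin a) / (sin a * sin b)) by (field; lra).
  assert (0 <= (sin b * cos a - cos b * sin a) / (sin a * sin b)).
  { apply Rdiv_le_0_compat; [exact Hs|]. apply Rmult_lt_0_compat; assumption. }
  lra.
Qed.

Lemma csum_range_le (e : nat -> C) (b : R) (N M : nat) :
  (N <= M)%nat -> (forall m, (N < m <= M)%nat -> Cmod (e m) <= b) ->
  Cmod (csum e M - csum e N) <= INR (M - N) * b.
Proof.
  intros HNM. induction HNM as [|M HM IH]; intros Hb.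
  - apply Cmod_self_minus. rewrite Nat.sub_diag. simpl; lra.
  - cbn [csum]. replace (csum e M + e (S M) - csum e N)%C
      with ((csum e M - csum e N) + e (S M))%C by ring.
    replace (S M - N)%nat with (S (M - N)) by lia. rewrite S_INR.
    eapply Rle_trans; [apply Cmod_triangle|].
    specialize (Hb (S M) ltac:(lia)) as H1.
    assert (Cmod (csum e M - csum e N) <= INR (M - N) * b)
      by (apply IH; intros; apply Hb; lia).
    lra.
Qed.

(* The weight [-1/2 - i cot(x)/2 = 1 / (cis (2 x) - 1)]: it makes the exponential sum
   of a sequence with increments [2 x] telescope. *)
Definition kl_weight (x : R) : C := (- (1 / 2), - (cos x / sin x / 2)).

Lemma kl_weight_cis (x : R) :
  sin x <> 0 -> (kl_weight x * cis (2 * x) = kl_weight x + 1)%C.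
Proof.
  intros Hs. pose proof (sin2_cos2 x) as H. unfold Rsqr in H.
  apply C_eq; rewrite ?Re_mult, ?Im_mult; unfold kl_weight, cis; simpl;
    rewrite ?cos_2a, ?sin_2a.
  - transitivity ((sin x * sin x + cos x * cos x) / 2); [field; assumption|rewrite H; field].
  - replace (cos x * cos x - sin x * sin x) with (1 - 2 * (sin x * sin x)) by lra.
    field. assumption.
Qed.

Lemma Cmod_le_of_sqr (z : C) (b : R) : 0 <= b -> Re z ^ 2 + Im z ^ 2 <= b ^ 2 -> Cmod z <= b.
Proof. intros Hb. rewrite <- Cmod_sqr. pose proof (Cmod_ge_0 z). nra. Qed.

(** The modulus of the weight is exactly 1 / (2 sin x). *)
Lemma Cmod_kl_weight (d x : R) :
  0 < d <= 1 -> d <= x <= PI - d -> Cmod (kl_weight x) <= 1 / d.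
Proof.
  intros Hd Hx. pose proof (sin_ge_half_sym d x Hd Hx) as Hs.
  apply Cmod_le_of_sqr; [apply Rlt_le, Rdiv_lt_0_compat; lra|].
  unfold kl_weight; simpl Re; simpl Im.
  replace ((- (1 / 2)) ^ 2 + (- (cos x / sin x / 2)) ^ 2) with ((/ (2 * sin x)) ^ 2).
  - apply pow_incr. split; [left; apply Rinv_0_lt_compat; lra|].
    unfold Rdiv. rewrite Rmult_1_l. apply Rinv_le_contravar; lra.
  - pose proof (sin2_cos2 x) as H. unfold Rsqr in H.
    replace ((- (cos x / sin x / 2)) ^ 2) with ((1 - sin x * sin x) / (sin x ^ 2 * 4)).
    + field. lra.
    + replace (1 - sin x * sin x) with (cos x * cos x) by lra. field. lra.
Qed.

(** Here x m is half of the phase increment, so 2 x m stays at distance 2d from the multiples of 2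
    pi. With g = [kl_weight] one has e m = g m (e (m+1) - e m), and summation by parts leaves two
    boundary terms and the variation of g. The real part of g is constant and its imaginary part is
    monotone along the sequence, so this variation telescopes to a difference of cotangents. The
    total is 1/d + 2/d + 1/d. *)
Lemma kusmin_landau (e : nat -> C) (x : nat -> R) (d : R) (N M : nat) :
  0 < d <= 1 -> (N <= M)%nat ->
  (forall m, (N < m <= M)%nat -> Cmod (e m) = 1) ->
  (forall m, (N < m <= M)%nat -> e (S m) = (e m * cis (2 * x m))%C) ->
  (forall m, (N < m <= M)%nat -> d <= x m <= PI - d) ->
  (forall m, (N < m < M)%nat -> x (S m) <= x m) ->
  Cmod (csum e M - csum e N) <= 4 / d.
Proof.
  intros Hd HNM H1 Hrec Hx Hmono.
  destruct (Nat.eq_dec N M) as [<-|Hne].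
  { apply Cmod_self_minus, Rdiv_le_0_compat; lra. }
  set (g := fun m => kl_weight (x m)). set (c := fun m => cos (x m) / sin (x m)).
  assert (Hsin : forall m, (N < m <= M)%nat -> d / 2 <= sin (x m))
    by (intros; apply sin_ge_half_sym; auto).
  (* The partial sum up to K, without its upper boundary term g K e (K+1), is bounded by the lower
     boundary term plus the variation accumulated so far. *)
  assert (Hinv : forall K, (S N <= K)%nat -> (K <= M)%nat ->
    Cmod (csum e K - csum e N - g K * e (S K)) <= Cmod (g (S N)) + (c K - c (S N)) / 2).
  { intros K HK. induction HK as [|K HK IH]; intros HKM.
    - rewrite Hrec by lia. cbn [csum].
      replace (csum e N + e (S N) - csum e N - g (S N) * (e (S N) * cis (2 * x (S N))))%C
        with (e (S N) * (1 - g (S N) * cis (2 * x (S N))))%C by ring.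
      unfold g at 1. rewrite kl_weight_cis by (specialize (Hsin (S N) ltac:(lia)); lra).
      fold (g (S N)).
      replace (e (S N) * (1 - (g (S N) + 1)))%C with (- (e (S N) * g (S N)))%C by ring.
      rewrite Cmod_opp, Cmod_mult, H1 by lia. lra.
    - cbn [csum].
      assert (He : (e (S K) - g (S K) * e (S (S K)) = - (g (S K) * e (S K)))%C).
      { rewrite (Hrec (S K)) by lia.
        replace (e (S K) - g (S K) * (e (S K) * cis (2 * x (S K))))%C
          with (e (S K) * (1 - g (S K) * cis (2 * x (S K))))%C by ring.
        unfold g at 1. rewrite kl_weight_cis by (specialize (Hsin (S K) ltac:(lia)); lra).
        fold (g (S K)). ring. }
      replace (csum e K + e (S K) - csum e N - g (S K) * e (S (S K)))%C
        with ((csum e K - csum e N - g K * e (S K)) + (e (S K) - g (S K) * e (S (S K)))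
              + g K * e (S K))%C by ring.
      rewrite He.
      replace (csum e K - csum e N - g K * e (S K) + - (g (S K) * e (S K)) + g K * e (S K))%C
        with ((csum e K - csum e N - g K * e (S K)) + (g K - g (S K)) * e (S K))%C by ring.
      eapply Rle_trans; [apply Cmod_triangle|].
      rewrite Cmod_mult, H1, Rmult_1_r by lia.
      assert (Hg : Cmod (g K - g (S K)) <= (c (S K) - c K) / 2).
      { assert (Hc : c K <= c (S K)).
        { apply cot_antitone; [|specialize (Hx K ltac:(lia)); lra].
          split; [specialize (Hx (S K) ltac:(lia)); lra|apply Hmono; lia]. }
        apply Cmod_le_of_sqr; [lra|]. right. unfold g, kl_weight; simpl Re; simpl Im.
        fold (c K) (c (S K)). field. }
      specialize (IH ltac:(lia)). lra. }
  specialize (Hinv M ltac:(lia) (le_n _)).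
  assert (Hcb : forall m, (N < m <= M)%nat -> Rabs (c m) <= 2 / d).
  { intros m Hm. pose proof (Hsin m Hm) as Hs. unfold c, Rdiv.
    rewrite Rabs_mult, (Rabs_pos_eq (/ sin (x m))) by (left; apply Rinv_0_lt_compat; lra).
    assert (/ sin (x m) <= 2 * / d).
    { replace (2 * / d) with (/ (d / 2)) by (field; lra). apply Rinv_le_contravar; lra. }
    assert (Rabs (cos (x m)) <= 1) by (apply Rabs_le, COS_bound).
    assert (0 < / sin (x m)) by (apply Rinv_0_lt_compat; lra).
    apply Rle_trans with (1 * / sin (x m)); [apply Rmult_le_compat_r; lra|lra]. }
  pose proof (Cmod_kl_weight d (x M) Hd (Hx M ltac:(lia))) as HgM. fold (g M) in HgM.
  pose proof (Cmod_kl_weight d (x (S N)) Hd (Hx (S N) ltac:(lia))) as HgN.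
  fold (g (S N)) in HgN.
  pose proof (Hcb M ltac:(lia)) as HcM. pose proof (Hcb (S N) ltac:(lia)) as HcN.
  apply Rabs_le_between in HcM. apply Rabs_le_between in HcN.
  replace (csum e M - csum e N)%C
    with ((csum e M - csum e N - g M * e (S M)) + g M * e (S M))%C by ring.
  eapply Rle_trans; [apply Cmod_triangle|].
  rewrite Cmod_mult.
  replace (Cmod (e (S M))) with 1 by (rewrite Hrec, Cmod_mult, H1, Cmod_cis by lia; ring).
  assert (4 / d = 4 * (1 / d)) by (field; lra).
  assert (2 / d = 2 * (1 / d)) by (field; lra). lra.
Qed.

Lemma antitone_split (x : nat -> R) (v : R) (N M : nat) :
  (N <= M)%nat -> (forall m, (N < m < M)%nat -> x (S m) <= x m) ->
  exists P, (N <= P <= M)%nat /\ (forall m, (N < m <= P)%nat -> v <= x m) /\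
    (forall m, (P < m <= M)%nat -> x m < v).
Proof.
  intros HNM. induction HNM as [|M HM IH]; intros Hx.
  - exists N. split; [lia|]. split; intros; lia.
  - destruct IH as [P [HP [H1 H2]]]; [intros; apply Hx; lia|].
    destruct (Nat.eq_dec P M) as [->|HPM].
    + destruct (Rle_dec v (x (S M))) as [Hv|Hv].
      * exists (S M). split; [lia|]. split; [|intros; lia].
        intros m Hm. destruct (Nat.eq_dec m (S M)) as [->|]; [exact Hv|apply H1; lia].
      * exists M. split; [lia|]. split; [exact H1|].
        intros m Hm. replace m with (S M) by lia. lra.
    + exists P. split; [lia|]. split; [exact H1|].
      intros m Hm. destruct (Nat.eq_dec m (S M)) as [->|]; [|apply H2; lia].
      apply Rle_lt_trans with (x M); [apply Hx; lia|apply H2; lia].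
Qed.

Lemma gap_sum (x : nat -> R) (l : R) (N M : nat) :
  (forall m, (N < m < M)%nat -> x (S m) + l <= x m) ->
  forall p q, (N < p <= q)%nat -> (q <= M)%nat -> x q + INR (q - p) * l <= x p.
Proof.
  intros Hx p q [Hp Hpq]. induction Hpq as [|q Hq IH]; intros HM.
  - rewrite Nat.sub_diag. simpl. lra.
  - specialize (IH ltac:(lia)). specialize (Hx q ltac:(lia)).
    replace (S q - p)%nat with (S (q - p)) by lia. rewrite S_INR. lra.
Qed.

Lemma cis_double_shift (x : R) (J : nat) : cis (2 * (x - PI * INR J)) = cis (2 * x).
Proof.
  unfold cis. rewrite <- (cos_period (2 * (x - PI * INR J)) J).
  rewrite <- (sin_period (2 * (x - PI * INR J)) J). f_equal; f_equal; ring.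
Qed.

(** Induction on J removes the topmost period. Values x >= pi J + d are handled by [kusmin_landau]
    after a shift by pi J, which leaves cis(2x) unchanged. The window from pi J - d to pi J + d has
    length 2d and consecutive values differ by at least l, so it holds at most 2d/l + 1 terms,
    estimated trivially. For J = 0 the range of x is empty. *)
Lemma second_derivative_test (e : nat -> C) (x : nat -> R) (d l : R) (J N M : nat) :
  0 < d <= 1 -> 0 < l -> (N <= M)%nat ->
  (forall m, (N < m <= M)%nat -> Cmod (e m) = 1) ->
  (forall m, (N < m <= M)%nat -> e (S m) = (e m * cis (2 * x m))%C) ->
  (forall m, (N < m <= M)%nat -> - d <= x m < PI * INR J - d) ->
  (forall m, (N < m < M)%nat -> x (S m) + l <= x m) ->
  Cmod (csum e M - csum e N) <= INR J * (4 / d + 2 * d / l + 1).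
Proof.
  intros Hd Hl. revert N M. induction J as [|J IH]; intros N M HNM H1 Hrec Hx Hgap.
  - destruct (Nat.eq_dec N M) as [<-|Hne].
    + apply Cmod_self_minus. simpl; lra.
    + exfalso. specialize (Hx M ltac:(lia)). simpl in Hx. lra.
  - assert (Hmono : forall m, (N < m < M)%nat -> x (S m) <= x m).
    { intros m Hm. specialize (Hgap m Hm). lra. }
    destruct (antitone_split x (PI * INR J - d) N M HNM Hmono) as [P [HP [HP1 HP2]]].
    assert (Hmono' : forall m, (N < m < P)%nat -> x (S m) <= x m)
      by (intros; apply Hmono; lia).
    destruct (antitone_split x (PI * INR J + d) N P ltac:(lia) Hmono') as [Q [HQ [HQ1 HQ2]]].
    replace (csum e M - csum e N)%C with
      ((csum e M - csum e P) + (csum e P - csum e Q) + (csum e Q - csum e N))%C by ring.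
    assert (B1 : Cmod (csum e M - csum e P) <= INR J * (4 / d + 2 * d / l + 1)).
    { apply IH; try lia; intros m Hm.
      - apply H1; lia.
      - apply Hrec; lia.
      - split; [apply Hx; lia|apply HP2; lia].
      - apply Hgap; lia. }
    assert (B2 : Cmod (csum e P - csum e Q) <= 2 * d / l + 1).
    { eapply Rle_trans; [apply (csum_range_le e 1)|].
      - lia.
      - intros m Hm. right. apply H1. lia.
      - rewrite Rmult_1_r. destruct (Nat.eq_dec Q P) as [->|HQP].
        + rewrite Nat.sub_diag. simpl.
          assert (0 < 2 * d / l) by (apply Rdiv_lt_0_compat; lra). lra.
        + pose proof (gap_sum x l N M Hgap (S Q) P ltac:(lia) ltac:(lia)) as Hg.
          specialize (HQ2 (S Q) ltac:(lia)). specialize (HP1 P ltac:(lia)).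
          replace (P - Q)%nat with (S (P - S Q)) by lia. rewrite S_INR.
          assert (INR (P - S Q) <= 2 * d / l).
          { apply (Rmult_le_reg_r l); [assumption|].
            replace (2 * d / l * l) with (2 * d) by (field; lra). lra. }
          lra. }
    assert (B3 : Cmod (csum e Q - csum e N) <= 4 / d).
    { apply (kusmin_landau e (fun m => x m - PI * INR J) d); try lia; try assumption.
      - intros; apply H1; lia.
      - intros m Hm. rewrite cis_double_shift. apply Hrec; lia.
      - intros m Hm. specialize (HQ1 m ltac:(lia)). specialize (Hx m ltac:(lia)).
        rewrite S_INR in Hx. lra.
      - intros m Hm. specialize (Hmono m ltac:(lia)). lra. }
    rewrite S_INR. eapply Rle_trans; [apply Cmod_triangle|].
    eapply Rle_trans; [apply Rplus_le_compat_r, Cmod_triangle|]. lra.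
Qed.

(** * Sums of m^(i tau) over dyadic blocks *)

Lemma ln_le_pred (y : R) : 0 < y -> ln y <= y - 1.
Proof.
  intros Hy. pose proof (exp_ineq1_le (ln y)) as H. rewrite exp_ln in H by assumption. lra.
Qed.

Lemma ln_ge_1_inv (y : R) : 0 < y -> 1 - / y <= ln y.
Proof.
  intros Hy. pose proof (ln_le_pred (/ y) (Rinv_0_lt_compat _ Hy)) as H.
  rewrite ln_Rinv in H by assumption. lra.
Qed.

Lemma ln_sub (a b : R) : 0 < a -> 0 < b -> ln a - ln b = ln (a / b).
Proof. intros. rewrite ln_div by assumption. reflexivity. Qed.

(** Half of the phase increment of m^(i tau), in the normalisation cis(2x) of the exponential sum
    bounds. *)
Definition log_phase (tau : R) (m : nat) : R := tau / 2 * (ln (INR (S m)) - ln (INR m)).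

Lemma log_phase_bounds (tau : R) (m : nat) :
  0 < tau -> (1 <= m)%nat ->
  tau / 2 / (INR m + 1) <= log_phase tau m <= tau / 2 / INR m.
Proof.
  intros Ht Hm. apply INR_pos in Hm. unfold log_phase. rewrite S_INR.
  rewrite ln_sub by lra.
  assert (H0 : 0 < (INR m + 1) / INR m) by (apply Rdiv_lt_0_compat; lra).
  pose proof (ln_le_pred _ H0) as H1. pose proof (ln_ge_1_inv _ H0) as H2.
  split.
  - replace (tau / 2 / (INR m + 1)) with (tau / 2 * (1 - / ((INR m + 1) / INR m))) by (field; lra).
    apply Rmult_le_compat_l; lra.
  - replace (tau / 2 / INR m) with (tau / 2 * ((INR m + 1) / INR m - 1)) by (field; lra).
    apply Rmult_le_compat_l; lra.
Qed.

(** The gap is (tau/2) ln((m+1)^2 / (m (m+2))), and ln y >= 1 - 1/y gives exactly (tau/2) /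
    (m+1)^2. *)
Lemma log_phase_gap (tau : R) (m : nat) :
  0 < tau -> (1 <= m)%nat ->
  log_phase tau (S m) + tau / 2 / (INR m + 1) ^ 2 <= log_phase tau m.
Proof.
  intros Ht Hm. apply INR_pos in Hm. unfold log_phase. rewrite !S_INR.
  set (a := INR m) in *.
  assert (H : 1 - / ((a + 1) / a / ((a + 1 + 1) / (a + 1)))
    <= ln ((a + 1) / a / ((a + 1 + 1) / (a + 1)))).
  { apply ln_ge_1_inv. apply Rdiv_lt_0_compat; apply Rdiv_lt_0_compat; lra. }
  rewrite <- !ln_sub in H by (try apply Rdiv_lt_0_compat; lra).
  replace (1 - / ((a + 1) / a / ((a + 1 + 1) / (a + 1)))) with (1 / (a + 1) ^ 2) in H
    by (field; split; [lra|split; lra]).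
  apply (Rmult_le_compat_l (tau / 2)) in H; [|lra].
  replace (tau / 2 / (a + 1) ^ 2) with (tau / 2 * (1 / (a + 1) ^ 2)) by (field; lra).
  lra.
Qed.

Lemma log_phase_cis (tau : R) (m : nat) :
  cis (tau * ln (INR (S m))) = (cis (tau * ln (INR m)) * cis (2 * log_phase tau m))%C.
Proof. rewrite <- cis_plus. f_equal. unfold log_phase. field. Qed.

Lemma nat_ceil (x : R) : 0 <= x -> exists n : nat, x <= INR n <= x + 1.
Proof.
  intros Hx. destruct (nfloor_ex x Hx) as [n Hn]. exists (S n). rewrite S_INR. lra.
Qed.

(** Second derivative test with d = sqrt(tau)/N and gap l = tau/(8 N^2). Each period costs 20
    N/sqrt(tau) + 1 and there are O(tau/N) periods, so N drops out of the product. *)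
Lemma dyadic_sum_small (tau : R) (N M : nat) :
  1 <= tau -> sqrt tau <= INR N <= 2 * tau -> (N <= M <= 2 * N)%nat ->
  Cmod (csum (fun m => cis (tau * ln (INR m))) M - csum (fun m => cis (tau * ln (INR m))) N)
    <= 60 * sqrt tau.
Proof.
  intros Ht [HN1 HN2] [HM1 HM2].
  assert (Hr : 1 <= sqrt tau) by (apply sqrt_ge_1; lra).
  assert (Hrr : sqrt tau * sqrt tau = tau) by (apply sqrt_sqrt; lra).
  set (r := sqrt tau) in *.
  assert (HN : (1 <= N)%nat).
  { destruct N; [simpl in HN1; lra|lia]. }
  assert (Hn : 0 < INR N) by lra.
  (* The half-increments are below tau/(2N) and d <= 1, so 3 J >= tau/(2N) + 1 together with pi > 3
     puts them below pi J - d. *)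
  destruct (nat_ceil (tau / (6 * INR N) + 1 / 3)) as [J HJ].
  { assert (0 < tau / (6 * INR N)) by (apply Rdiv_lt_0_compat; lra). lra. }
  eapply Rle_trans.
  - apply (second_derivative_test _ (log_phase tau) (r / INR N) (tau / (8 * INR N ^ 2)) J N M).
    + split; [apply Rdiv_lt_0_compat; lra|].
      apply div_le_1; lra.
    + apply Rdiv_lt_0_compat; [lra|]. nra.
    + assumption.
    + intros; apply Cmod_cis.
    + intros; apply log_phase_cis.
    + intros m Hm. pose proof (log_phase_bounds tau m ltac:(lra) ltac:(lia)) as [B1 B2].
      assert (0 < r / INR N <= 1).
      { split; [apply Rdiv_lt_0_compat; lra|].
        apply div_le_1; lra. }
      split.
      * assert (0 < tau / 2 / (INR m + 1)).
        { apply Rdiv_lt_0_compat; [lra|]. pose proof (pos_INR m). lra. }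
        lra.
      * assert (tau / 2 / INR m < tau / 2 / INR N).
        { apply Rmult_lt_compat_l; [lra|]. apply Rinv_lt_contravar.
          - apply Rmult_lt_0_compat; [lra|apply INR_pos; lia].
          - apply lt_INR; lia. }
        assert (3 * (tau / (6 * INR N)) = tau / 2 / INR N) by (field; lra).
        pose proof PI2_3_2. assert (3 * INR J <= PI * INR J).
        { apply Rmult_le_compat_r; [apply pos_INR|lra]. }
        lra.
    + intros m Hm. pose proof (log_phase_gap tau m ltac:(lra) ltac:(lia)) as B.
      assert (tau / (8 * INR N ^ 2) <= tau / 2 / (INR m + 1) ^ 2); [|lra].
      assert (Hm1 : INR m + 1 <= 2 * INR N).
      { rewrite <- S_INR. rewrite <- INR_double.
        apply le_INR. lia. }
      pose proof (pos_INR m).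
      replace (tau / (8 * INR N ^ 2)) with (tau / 2 * / (4 * INR N ^ 2)) by (field; lra).
      apply Rmult_le_compat_l; [lra|]. apply Rinv_le_contravar; [nra|].
      replace (4 * INR N ^ 2) with ((2 * INR N) ^ 2) by ring. apply pow_incr; lra.
  - replace (4 / (r / INR N) + 2 * (r / INR N) / (tau / (8 * INR N ^ 2)) + 1)
      with (20 * (INR N / r) + 1) by (rewrite <- Hrr; field; lra).
    assert (H1 : 1 <= INR N / r).
    { apply one_le_div; lra. }
    assert (H2 : 1 <= 2 * (tau / INR N)).
    { apply (Rmult_le_reg_r (INR N)); [lra|].
      replace (2 * (tau / INR N) * INR N) with (2 * tau) by (field; lra). lra. }
    assert (H3 : tau / (6 * INR N) = (tau / INR N) / 6) by (field; lra).
    assert (H4 : (tau / INR N) * (INR N / r) = r) by (rewrite <- Hrr; field; lra).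
    assert (HJ' : INR J <= (17 / 6) * (tau / INR N)) by lra.
    apply Rle_trans with ((17 / 6) * (tau / INR N) * (21 * (INR N / r))).
    + apply Rmult_le_compat; [apply pos_INR| | |]; lra.
    + replace (17 / 6 * (tau / INR N) * (21 * (INR N / r)))
        with (17 / 6 * 21 * ((tau / INR N) * (INR N / r))) by ring.
      rewrite H4. lra.
Qed.

(** For N >= tau the half-increments lie between tau/(6N) and 1/2, inside a single period, so
    [kusmin_landau] applies to the whole block with d = tau/(6N). *)
Lemma dyadic_sum_large (tau : R) (N M : nat) :
  1 <= tau -> tau <= INR N -> (N <= M <= 2 * N)%nat ->
  Cmod (csum (fun m => cis (tau * ln (INR m))) M - csum (fun m => cis (tau * ln (INR m))) N)
    <= 24 * INR N / tau.
Proof.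
  intros Ht HN1 [HM1 HM2].
  assert (Hn : 0 < INR N) by lra.
  assert (HN : (1 <= N)%nat) by (destruct N; [simpl in Hn; lra|lia]).
  replace (24 * INR N / tau) with (4 / (tau / (6 * INR N))) by (field; lra).
  assert (Hd : 0 < tau / (6 * INR N) <= 1).
  { split; [apply Rdiv_lt_0_compat; lra|].
    apply div_le_1; lra. }
  apply (kusmin_landau _ (log_phase tau)); try assumption.
  - intros; apply Cmod_cis.
  - intros; apply log_phase_cis.
  - intros m Hm. pose proof (log_phase_bounds tau m ltac:(lra) ltac:(lia)) as [B1 B2].
    assert (Hm1 : INR m <= 2 * INR N).
    { rewrite <- INR_double.
      apply le_INR. lia. }
    assert (Hm2 : INR N <= INR m) by (apply le_INR; lia).
    assert (1 <= INR N) by lra.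
    split.
    + eapply Rle_trans; [|apply B1].
      replace (tau / (6 * INR N)) with (tau / 2 * / (3 * INR N)) by (field; lra).
      apply Rmult_le_compat_l; [lra|]. apply Rinv_le_contravar; lra.
    + assert (tau / 2 / INR m <= 1 / 2).
      { apply (Rmult_le_reg_r (INR m)); [lra|].
        replace (tau / 2 / INR m * INR m) with (tau / 2) by (field; lra). lra. }
      pose proof PI2_3_2. lra.
  - intros m Hm. pose proof (log_phase_gap tau m ltac:(lra) ltac:(lia)) as B.
    assert (0 < tau / 2 / (INR m + 1) ^ 2); [|lra].
    apply Rdiv_lt_0_compat; [lra|]. pose proof (pos_INR m). nra.
Qed.

(** Partial summation: each decrease of the weight costs at most B times that decrease, and these
    costs telescope to w (N+1) - w M; the last boundary term adds w M times B. *)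
Lemma abel_summation_bound (w : nat -> R) (e : nat -> C) (B : R) (N M : nat) :
  (N <= M)%nat ->
  (forall m, (N < m)%nat -> 0 <= w m) -> (forall m, (N < m)%nat -> w (S m) <= w m) ->
  (forall K, (N <= K <= M)%nat -> Cmod (csum e K - csum e N) <= B) ->
  Cmod (csum (fun m => RtoC (w m) * e m)%C M - csum (fun m => RtoC (w m) * e m)%C N)
    <= w (S N) * B.
Proof.
  intros HNM Hw Hmono HB.
  assert (HB0 : 0 <= B) by (eapply Rle_trans; [apply Cmod_ge_0|apply (HB N); lia]).
  set (W := csum (fun m => RtoC (w m) * e m)%C).
  destruct (Nat.eq_dec N M) as [<-|Hne].
  { apply Cmod_self_minus.
    apply Rmult_le_pos; [apply Hw; lia|assumption]. }
  assert (Hinv : forall K, (S N <= K)%nat -> (K <= M)%nat ->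
    Cmod (W K - W N - RtoC (w K) * (csum e K - csum e N)) <= B * (w (S N) - w K)).
  { intros K HK. induction HK as [|K HK IH]; intros HKM.
    - unfold W; cbn [csum].
      match goal with |- Cmod ?z <= _ => replace z with (RtoC 0) by ring end.
      rewrite Cmod_0. right; ring.
    - replace (W (S K) - W N - RtoC (w (S K)) * (csum e (S K) - csum e N))%C
        with ((W K - W N - RtoC (w K) * (csum e K - csum e N))
               + RtoC (w K - w (S K)) * (csum e K - csum e N))%C.
      + eapply Rle_trans; [apply Cmod_triangle|].
        specialize (Hmono K ltac:(lia)).
        rewrite Cmod_mult, Cmod_RtoC_nneg by lra.
        specialize (IH ltac:(lia)). specialize (HB K ltac:(lia)).
        apply (Rmult_le_compat_l (w K - w (S K))) in HB; lra.
      + unfold W; cbn [csum]. rewrite RtoC_minus. ring. }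
  specialize (Hinv M ltac:(lia) (le_n _)).
  replace (W M - W N)%C with ((W M - W N - RtoC (w M) * (csum e M - csum e N))
    + RtoC (w M) * (csum e M - csum e N))%C by ring.
  eapply Rle_trans; [apply Cmod_triangle|].
  rewrite Cmod_mult, Cmod_RtoC_nneg by (apply Hw; lia).
  specialize (HB M ltac:(lia)).
  apply (Rmult_le_compat_l (w M)) in HB; [lra|apply Hw; lia].
Qed.

Lemma Rpower_neg_antitone (p x y : R) : 0 <= p -> 0 < x <= y -> Rpower y (- p) <= Rpower x (- p).
Proof.
  intros Hp Hxy. rewrite !Rpower_Ropp. apply Rinv_le_contravar; [apply Rpower_pos|].
  apply Rle_Rpower_l; assumption.
Qed.

Lemma abel_power_bound (sigma B : R) (e : nat -> C) (N M : nat) :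
  0 <= sigma -> (1 <= N <= M)%nat ->
  (forall K, (N <= K <= M)%nat -> Cmod (csum e K - csum e N) <= B) ->
  Cmod (csum (fun m => RtoC (Rpower (INR m) (- sigma)) * e m)%C M
        - csum (fun m => RtoC (Rpower (INR m) (- sigma)) * e m)%C N)
    <= Rpower (INR N) (- sigma) * B.
Proof.
  intros Hs HN HB.
  eapply Rle_trans; [apply abel_summation_bound with (B := B)|].
  - lia.
  - intros; apply Rpower_nneg.
  - intros. apply Rpower_neg_antitone; [assumption|].
    split; [apply INR_pos; lia|apply le_INR; lia].
  - assumption.
  - apply Rmult_le_compat_r.
    + eapply Rle_trans; [apply Cmod_ge_0|apply (HB N); lia].
    + apply Rpower_neg_antitone; [assumption|].
      split; [apply INR_pos; lia|apply le_INR; lia].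
Qed.

(** The term m^(-s) at s = sigma - i tau; this sign of the imaginary part makes the phase increase
    with m. *)
Definition zterm (sigma tau : R) (m : nat) : C :=
  (RtoC (Rpower (INR m) (- sigma)) * cis (tau * ln (INR m)))%C.

Lemma zterm_cpow (sigma tau : R) (m : nat) :
  cpow (INR m) (- (sigma, - tau)) = zterm sigma tau m.
Proof.
  rewrite cpow_cis. unfold zterm. simpl. rewrite Ropp_involutive. reflexivity.
Qed.

Lemma Rpower_half (x : R) : 0 < x -> Rpower x (1 / 2) = sqrt x.
Proof. intros H. replace (1 / 2) with (/ 2) by lra. apply Rpower_sqrt, H. Qed.

Lemma Rpower_neg_le_sqrt (sigma x : R) :
  1 / 2 <= sigma -> 1 <= x -> Rpower x (- sigma) <= / sqrt x.
Proof.
  intros Hs Hx. rewrite <- Rpower_half by lra. rewrite <- Rpower_Ropp.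
  apply Rle_Rpower; lra.
Qed.

(** Induction over dyadic blocks, k being a bound for the length. A block costs 60 sqrt(tau)
    N^(-sigma), and doubling N multiplies this by 2^(-sigma) <= 5/7; the geometric series gives 60 /
    (1 - 5/7) = 210. *)
Lemma zterm_sum_small (sigma tau : R) (k N M : nat) :
  1 / 2 <= sigma -> 1 <= tau -> (M - N <= k)%nat -> (N <= M)%nat ->
  sqrt tau <= INR N -> INR M <= 2 * tau ->
  Cmod (csum (zterm sigma tau) M - csum (zterm sigma tau) N)
    <= 210 * sqrt tau * Rpower (INR N) (- sigma).
Proof.
  intros Hs Ht. revert N M. induction k as [|k IH]; intros N M Hk HNM HN HM.
  - replace M with N by lia. apply Cmod_self_minus.
    apply Rmult_le_pos; [|apply Rpower_nneg].
    pose proof (sqrt_pos tau); lra.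
  - assert (Hr : 1 <= sqrt tau) by (apply sqrt_ge_1; lra).
    assert (HN1 : (1 <= N)%nat) by (destruct N; [simpl in HN; lra|lia]).
    assert (Hblock : forall M', (N <= M' <= 2 * N)%nat -> INR M' <= 2 * tau ->
      Cmod (csum (zterm sigma tau) M' - csum (zterm sigma tau) N)
        <= Rpower (INR N) (- sigma) * (60 * sqrt tau)).
    { intros M' HM' HM't. apply abel_power_bound; [lra|lia|].
      intros K HK. apply dyadic_sum_small; [lra| |lia].
      split; [lra|]. apply Rle_trans with (INR M'); [apply le_INR; lia|lra]. }
    pose proof (Rpower_pos (INR N) (- sigma)) as HP.
    destruct (le_lt_dec M (2 * N)) as [Hle|Hlt].
    + eapply Rle_trans; [apply Hblock; [lia|lra]|].
      replace (210 * sqrt tau * Rpower (INR N) (- sigma))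
        with (Rpower (INR N) (- sigma) * (210 * sqrt tau)) by ring.
      apply Rmult_le_compat_l; lra.
    + replace (csum (zterm sigma tau) M - csum (zterm sigma tau) N)%C
        with ((csum (zterm sigma tau) M - csum (zterm sigma tau) (2 * N))
          + (csum (zterm sigma tau) (2 * N) - csum (zterm sigma tau) N))%C by ring.
      eapply Rle_trans; [apply Cmod_triangle|].
      pose proof (INR_double N) as H2N.
      assert (Hlt' : INR (2 * N) <= INR M) by (apply le_INR; lia).
      eapply Rle_trans; [apply Rplus_le_compat; [apply IH|apply Hblock]|]; try lia; try lra.
      rewrite INR_double.
      rewrite <- Rpower_mult_distr by (try lra; apply INR_pos; assumption).
      assert (H2 : Rpower 2 (- sigma) <= 5 / 7).
      { eapply Rle_trans; [apply Rpower_neg_le_sqrt; lra|].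
        pose proof sqrt_2_ge.
        replace (5 / 7) with (/ (7 / 5)) by field. apply Rinv_le_contravar; lra. }
      pose proof (Rpower_pos 2 (- sigma)).
      assert (0 < sqrt tau * Rpower (INR N) (- sigma)) by (apply Rmult_lt_0_compat; lra).
      nra.
Qed.

(** A block costs 24 sqrt(N)/tau, which grows with N. The bound is shaped as a potential: passing
    from N to 2N releases 60 (sqrt 2 - 1) sqrt(N)/tau, at least 24 sqrt(N)/tau since sqrt 2 >=
    7/5. *)
Lemma zterm_sum_large (sigma tau : R) (k N M : nat) :
  1 / 2 <= sigma -> 1 <= tau -> (M - N <= k)%nat -> (N <= M)%nat -> tau <= INR N ->
  Cmod (csum (zterm sigma tau) M - csum (zterm sigma tau) N)
    <= 60 * (2 * sqrt (INR M) - sqrt (INR N)) / tau.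
Proof.
  intros Hs Ht. revert N M. induction k as [|k IH]; intros N M Hk HNM HN.
  - replace M with N by lia. apply Cmod_self_minus.
    apply Rdiv_le_0_compat; [|lra].
    pose proof (sqrt_pos (INR N)); lra.
  - assert (HN1 : (1 <= N)%nat) by (destruct N; [simpl in HN; lra|lia]).
    pose proof (INR_ge_1 N HN1) as HN1'.
    assert (Hr : 1 <= sqrt (INR N)) by (apply sqrt_ge_1; lra).
    assert (Hrr : sqrt (INR N) * sqrt (INR N) = INR N) by (apply sqrt_sqrt; lra).
    assert (Hblock : forall M', (N <= M' <= 2 * N)%nat ->
      Cmod (csum (zterm sigma tau) M' - csum (zterm sigma tau) N) <= 24 * sqrt (INR N) / tau).
    { intros M' HM'. eapply Rle_trans; [apply abel_power_bound; [lra|lia|]|].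
      - intros K HK. apply dyadic_sum_large; [lra|lra|lia].
      - replace (24 * sqrt (INR N) / tau) with (/ sqrt (INR N) * (24 * INR N / tau)).
        2:{ rewrite <- Hrr at 2. field. split; lra. }
        apply Rmult_le_compat_r; [apply Rdiv_le_0_compat; lra|].
        apply Rpower_neg_le_sqrt; lra. }
    destruct (le_lt_dec M (2 * N)) as [Hle|Hlt].
    + eapply Rle_trans; [apply Hblock; lia|].
      apply Rmult_le_compat_r; [left; apply Rinv_0_lt_compat; lra|].
      assert (sqrt (INR N) <= sqrt (INR M)) by (apply sqrt_le_1_alt, le_INR; lia). lra.
    + replace (csum (zterm sigma tau) M - csum (zterm sigma tau) N)%C
        with ((csum (zterm sigma tau) M - csum (zterm sigma tau) (2 * N))
          + (csum (zterm sigma tau) (2 * N) - csum (zterm sigma tau) N))%C by ring.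
      eapply Rle_trans; [apply Cmod_triangle|].
      pose proof (INR_double N) as H2N.
      eapply Rle_trans; [apply Rplus_le_compat; [apply IH|apply Hblock]|]; try lia; try lra.
      rewrite INR_double, sqrt_mult by lra.
      pose proof sqrt_2_ge.
      unfold Rdiv. rewrite <- Rmult_plus_distr_r.
      apply Rmult_le_compat_r; [left; apply Rinv_0_lt_compat; lra|]. nra.
Qed.

Lemma rsum_inv_sqrt (n : nat) : rsum (fun m => / sqrt (INR m)) n <= 2 * sqrt (INR n).
Proof.
  induction n as [|n IH]; [simpl; rewrite sqrt_0; lra|].
  cbn [rsum]. set (a := sqrt (INR n)) in *. set (b := sqrt (INR (S n))).
  assert (Hb : b * b = a * a + 1).
  { unfold a, b. rewrite !sqrt_sqrt by apply pos_INR. apply S_INR. }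
  assert (Hb0 : 0 < b) by (apply sqrt_lt_R0, INR_pos; lia).
  assert (/ b <= 2 * b - 2 * a); [|lra].
  apply (Rmult_le_reg_r b); [assumption|]. rewrite Rinv_l by lra. nra.
Qed.

Lemma Rpower_neg_three_halves (x : R) : 0 < x -> Rpower x (- (3 / 2)) = / (sqrt x * x).
Proof.
  intros Hx. rewrite Rpower_Ropp. f_equal. replace (3 / 2) with (1 / 2 + 1) by lra.
  rewrite Rpower_plus, Rpower_1, Rpower_half by assumption. reflexivity.
Qed.

Lemma rsum_three_halves (n : nat) : rsum (fun m => Rpower (INR m) (- (3 / 2))) n <= 3.
Proof.
  destruct n as [|n]; [simpl; lra|].
  (* Strengthened for the induction: 2/sqrt(n) - 2/sqrt(n+1) dominates (n+1)^(-3/2). *)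
  assert (H : rsum (fun m => Rpower (INR m) (- (3 / 2))) (S n) <= 3 - 2 / sqrt (INR (S n))).
  { induction n as [|n IH].
    - simpl. rewrite Rpower_neg_three_halves, sqrt_1 by lra. lra.
    - cbn [rsum] in *. rewrite (Rpower_neg_three_halves (INR (S (S n)))) by (apply INR_pos; lia).
      set (a := sqrt (INR (S n))) in *. set (b := sqrt (INR (S (S n)))).
      assert (Hbb : INR (S (S n)) = b * b) by (unfold b; rewrite sqrt_sqrt by apply pos_INR; auto).
      assert (Hb : b * b = a * a + 1).
      { unfold a, b. rewrite !sqrt_sqrt by apply pos_INR. apply S_INR. }
      assert (Hb0 : 0 < b) by (apply sqrt_lt_R0, INR_pos; lia).
      assert (Ha0 : 0 < a) by (apply sqrt_lt_R0, INR_pos; lia).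
      rewrite Hbb.
      assert (/ (b * (b * b)) <= 2 / a - 2 / b); [|lra].
      assert (Hab : a < b) by nra.
      replace (2 / a - 2 / b) with (2 * (b - a) / (a * b)) by (field; lra).
      replace (b - a) with (1 / (a + b)).
      2:{ apply (Rmult_eq_reg_r (a + b)); [|lra].
          replace (1 / (a + b) * (a + b)) with 1 by (field; lra). nra. }
      replace (2 * (1 / (a + b)) / (a * b)) with (/ (a * b * ((a + b) / 2))) by (field; lra).
      apply Rinv_le_contravar.
      + apply Rmult_lt_0_compat; [apply Rmult_lt_0_compat|]; lra.
      + replace (b * (b * b)) with (b * b * b) by ring.
        apply Rmult_le_compat; [left; apply Rmult_lt_0_compat; lra|lra| |lra].
        apply Rmult_le_compat_r; lra. }
  assert (0 < 2 / sqrt (INR (S n))).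
  { apply Rdiv_lt_0_compat; [lra|]. apply sqrt_lt_R0, INR_pos; lia. }
  lra.
Qed.

(* Interpolation between the cases u = 0 and u = 1/2 by [a^(1-v) b^v <= a + b]. *)
Lemma rsum_power_interpolate (u sigma : R) (n : nat) :
  0 <= u <= 1 / 2 -> 1 / 2 + 2 * u <= sigma -> (1 <= n)%nat ->
  rsum (fun m => Rpower (INR m) (- sigma)) n <= 5 * Rpower (INR n) (1 / 2 - u).
Proof.
  intros Hu Hs Hn.
  assert (Hn1 : 1 <= INR n) by (apply INR_ge_1, Hn).
  assert (Hterm : forall m, (1 <= m <= n)%nat -> Rpower (INR m) (- sigma)
    <= Rpower (INR n) (1 / 2 - u)
       * (/ sqrt (INR n) * / sqrt (INR m) + Rpower (INR m) (- (3 / 2)))).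
  { intros m Hm. assert (Hm1 : 1 <= INR m) by (apply INR_ge_1; lia).
    set (a := / sqrt (INR n) * / sqrt (INR m)). set (b := Rpower (INR m) (- (3 / 2))).
    assert (Ha : a = Rpower (INR n) (- (1 / 2)) * Rpower (INR m) (- (1 / 2))).
    { unfold a. rewrite !Rpower_Ropp, !Rpower_half by lra. reflexivity. }
    assert (Ha0 : 0 < a) by (rewrite Ha; apply Rmult_lt_0_compat; apply Rpower_pos).
    assert (Hb0 : 0 < b) by apply Rpower_pos.
    apply Rle_trans with (Rpower (INR n) (1 / 2 - u) * (Rpower a (1 - 2 * u) * Rpower b (2 * u))).
    - apply Rle_trans with (Rpower (INR m) (- (1 / 2 + 2 * u))); [apply Rle_Rpower; lra|].
      right. rewrite Ha. unfold b.
      rewrite <- (Rpower_mult_distr (Rpower (INR n) _)) by apply Rpower_pos.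
      rewrite !Rpower_mult.
      replace (Rpower (INR n) (1 / 2 - u)
        * (Rpower (INR n) (- (1 / 2) * (1 - 2 * u)) * Rpower (INR m) (- (1 / 2) * (1 - 2 * u))
           * Rpower (INR m) (- (3 / 2) * (2 * u))))
        with ((Rpower (INR n) (1 / 2 - u) * Rpower (INR n) (- (1 / 2) * (1 - 2 * u)))
           * (Rpower (INR m) (- (1 / 2) * (1 - 2 * u)) * Rpower (INR m) (- (3 / 2) * (2 * u))))
        by ring.
      rewrite <- !Rpower_plus.
      replace (1 / 2 - u + - (1 / 2) * (1 - 2 * u)) with 0 by field.
      replace (- (1 / 2) * (1 - 2 * u) + - (3 / 2) * (2 * u)) with (- (1 / 2 + 2 * u)) by field.
      rewrite Rpower_O by lra. ring.
    - apply Rmult_le_compat_l; [apply Rpower_nneg|].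
      apply Rle_trans with (Rpower (a + b) (1 - 2 * u) * Rpower (a + b) (2 * u)).
      + apply Rmult_le_compat; try apply Rpower_nneg; apply Rle_Rpower_l; lra.
      + rewrite <- Rpower_plus. replace (1 - 2 * u + 2 * u) with 1 by ring.
        rewrite Rpower_1 by lra. lra. }
  eapply Rle_trans; [apply rsum_le, Hterm|].
  rewrite rsum_scal, rsum_plus, rsum_scal, Rmult_comm.
  apply Rmult_le_compat_r; [apply Rpower_nneg|].
  pose proof (rsum_three_halves n). pose proof (rsum_inv_sqrt n).
  assert (Hr : 0 < sqrt (INR n)) by (apply sqrt_lt_R0; lra).
  assert (/ sqrt (INR n) * rsum (fun m => / sqrt (INR m)) n
    <= / sqrt (INR n) * (2 * sqrt (INR n))).
  { apply Rmult_le_compat_l; [left; apply Rinv_0_lt_compat|]; assumption. }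
  replace (/ sqrt (INR n) * (2 * sqrt (INR n))) with 2 in * by (field; lra). lra.
Qed.

(** * The truncated zeta function to the right of the critical line *)

Lemma Cmod_le_Rabs (z : C) : Cmod z <= Rabs (Re z) + Rabs (Im z).
Proof.
  pose proof (Rabs_pos (Re z)). pose proof (Rabs_pos (Im z)).
  apply Cmod_le_of_sqr; [lra|]. rewrite <- (pow2_abs (Re z)), <- (pow2_abs (Im z)). nra.
Qed.

(** The sum is cut near sqrt(tau), tau and tau^2. Up to sqrt(tau) absolute values suffice, by
    [rsum_power_interpolate]; up to tau the second derivative test gives O(sqrt(tau)^(1-sigma)); up
    to tau^2 [kusmin_landau] gives O(1). At N3 near tau^2 the term N3^(1-s)/(s-1) and the difference
    from [zapprox N3], at most (|s|/sigma) N3^(-sigma), are O(1) as well. Each piece is within a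
    constant of tau^(1/4 - u/2), which is at least 1. *)
Theorem zapprox_bound (tau u sigma : R) (X : nat) :
  12 <= tau -> 0 <= u <= 1 / 2 -> 1 / 2 + 2 * u <= sigma -> 2 * tau ^ 2 <= INR X ->
  Cmod (zapprox X (sigma, - tau)) <= 500 * Rpower tau (1 / 4 - u / 2).
Proof.
  intros Ht Hu Hs HX.
  set (W := Rpower tau (1 / 4 - u / 2)).
  assert (Hr : 3 <= sqrt tau).
  { rewrite <- (sqrt_Rsqr 3) by lra. apply sqrt_le_1_alt. unfold Rsqr; lra. }
  assert (Hrr : sqrt tau * sqrt tau = tau) by (apply sqrt_sqrt; lra).
  assert (HrW : Rpower (sqrt tau) (1 / 2 - u) = W).
  { rewrite <- Rpower_half by lra. rewrite Rpower_mult. unfold W. f_equal. field. }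
  assert (HW : 1 <= W).
  { apply Rpower_ge_1; lra. }
  destruct (nat_ceil (sqrt tau)) as [N1 HN1]; [lra|].
  destruct (nat_ceil tau) as [N2 HN2]; [lra|].
  destruct (nat_ceil (tau ^ 2)) as [N3 HN3]; [nra|].
  assert (H3r : 3 * sqrt tau <= tau) by nra.
  assert (H12t : 12 * tau <= tau ^ 2) by nra.
  assert (HN12 : (N1 <= N2)%nat) by (apply INR_le; lra).
  assert (HN23 : (N2 <= N3)%nat) by (apply INR_le; lra).
  assert (HN3X : (N3 <= X)%nat) by (apply INR_le; lra).
  assert (HN1' : (1 <= N1)%nat) by (destruct N1; [simpl in HN1; lra|lia]).
  set (s := (sigma, - tau) : C).
  assert (Hs1 : s <> RtoC 1).
  { intros H. apply (f_equal Im) in H. unfold s in H. simpl in H. lra. }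
  assert (HsN3 : sqrt (INR N3) <= 2 * tau).
  { rewrite <- (sqrt_Rsqr (2 * tau)) by lra. apply sqrt_le_1_alt. unfold Rsqr. nra. }
  assert (HsN3' : tau <= sqrt (INR N3)).
  { rewrite <- (sqrt_Rsqr tau) at 1 by lra. apply sqrt_le_1_alt. unfold Rsqr. nra. }
  set (Z := csum (zterm sigma tau)).
  assert (Hdec : zapprox X s = ((zapprox X s - zapprox N3 s) + Z N1 + (Z N2 - Z N1)
     + (Z N3 - Z N2) + cpow (INR N3) (1 - s) / (s - 1))%C).
  { unfold zapprox at 3.
    rewrite (csum_ext _ (zterm sigma tau)) by (intros; apply zterm_cpow).
    fold (Z N3). ring. }
  assert (B1 : Cmod (Z N1) <= 10 * W).
  { unfold Z. eapply Rle_trans; [apply csum_Cmod|].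
    rewrite (rsum_ext _ (fun m => Rpower (INR m) (- sigma))).
    2:{ intros m Hm. unfold zterm. rewrite Cmod_mult, Cmod_cis, Cmod_RtoC_nneg; [ring|].
        apply Rpower_nneg. }
    eapply Rle_trans; [apply (rsum_power_interpolate u); [lra|lra|assumption]|].
    replace (10 * W) with (5 * (2 * W)) by ring. apply Rmult_le_compat_l; [lra|].
    apply Rle_trans with (Rpower (2 * sqrt tau) (1 / 2 - u)); [apply Rle_Rpower_l; lra|].
    rewrite <- Rpower_mult_distr, HrW by lra. apply Rmult_le_compat_r; [lra|].
    apply Rle_trans with (Rpower 2 1); [apply Rle_Rpower; lra|rewrite Rpower_1; lra]. }
  assert (B2 : Cmod (Z N2 - Z N1) <= 210 * W).
  { eapply Rle_trans; [apply (zterm_sum_small sigma tau (N2 - N1)); try lia; lra|].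
    rewrite Rmult_assoc. apply Rmult_le_compat_l; [lra|].
    apply Rle_trans with (sqrt tau * Rpower (sqrt tau) (- sigma)).
    - apply Rmult_le_compat_l; [lra|]. apply Rpower_neg_antitone; lra.
    - apply Rle_trans with (Rpower (sqrt tau) 1 * Rpower (sqrt tau) (- sigma));
        [rewrite Rpower_1 by lra; lra|].
      rewrite <- Rpower_plus, <- HrW.
      apply Rle_Rpower; lra. }
  assert (B3 : Cmod (Z N3 - Z N2) <= 240).
  { eapply Rle_trans; [apply (zterm_sum_large sigma tau (N3 - N2)); try lia; lra|].
    apply (Rmult_le_reg_r tau); [lra|].
    unfold Rdiv. rewrite Rmult_assoc, Rinv_l by lra.
    pose proof (sqrt_pos (INR N2)). lra. }
  assert (B4 : Cmod (cpow (INR N3) (1 - s) / (s - 1)) <= 2).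
  { pose proof (Cminus_neq_0 _ _ Hs1) as Hs1'.
    rewrite Cmod_div by assumption. rewrite Cmod_cpow.
    assert (Hd : tau <= Cmod (s - 1)).
    { eapply Rle_trans; [|apply Rabs_Im_le]. unfold s; simpl.
      rewrite <- Rabs_Ropp. replace (- (- tau + - 0)) with tau by ring. apply Rle_abs. }
    apply (Rmult_le_reg_r (Cmod (s - 1))); [lra|].
    unfold Rdiv. rewrite Rmult_assoc, Rinv_l, Rmult_1_r by lra.
    apply Rle_trans with (Rpower (INR N3) (1 / 2)).
    - apply Rle_Rpower; [nra|]. unfold s; simpl. lra.
    - rewrite Rpower_half by nra. lra. }
  assert (B5 : Cmod (zapprox X s - zapprox N3 s) <= 3).
  { assert (Hre : Re s = sigma) by reflexivity.
    eapply Rle_trans; [apply zapprox_diff; [rewrite Hre; lra|assumption|lia]|].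
    rewrite Hre.
    assert (Ha : Cmod s / sigma <= 1 + 2 * tau).
    { apply (Rmult_le_reg_r sigma); [lra|].
      unfold Rdiv. rewrite Rmult_assoc, Rinv_l, Rmult_1_r by lra.
      eapply Rle_trans; [apply Cmod_le_Rabs|]. unfold s; simpl.
      rewrite Rabs_Ropp, !Rabs_pos_eq by lra. nra. }
    assert (Hb : Rpower (INR N3) (- sigma) <= / tau).
    { eapply Rle_trans; [apply Rpower_neg_le_sqrt; nra|]. apply Rinv_le_contravar; lra. }
    apply Rle_trans with ((1 + 2 * tau) * / tau).
    - apply Rmult_le_compat; try assumption; [|apply Rpower_nneg].
      apply Rmult_le_pos; [apply Cmod_ge_0|left; apply Rinv_0_lt_compat; lra].
    - apply (Rmult_le_reg_r tau); [lra|]. rewrite Rmult_assoc, Rinv_l by lra. lra. }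
  rewrite Hdec.
  eapply Rle_trans; [apply Cmod_triangle|].
  eapply Rle_trans; [apply Rplus_le_compat_r, Cmod_triangle|].
  eapply Rle_trans; [apply Rplus_le_compat_r, Rplus_le_compat_r, Cmod_triangle|].
  eapply Rle_trans; [apply Rplus_le_compat_r, Rplus_le_compat_r, Rplus_le_compat_r,
    Cmod_triangle|].
  lra.
Qed.

(** * Complex integrals and Cauchy's theorem on rectangles *)

Definition is_CRInt (f : R -> C) (a b : R) (l : C) : Prop :=
  is_RInt (fun t => Re (f t)) a b (Re l) /\ is_RInt (fun t => Im (f t)) a b (Im l).

Lemma is_CRInt_unique (f : R -> C) (a b : R) (l : C) : is_CRInt f a b l -> CRInt f a b = l.
Proof.
  intros [H1 H2]. unfold CRInt. apply C_eq; simpl; apply is_RInt_unique; assumption.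
Qed.

Lemma is_CRInt_ext (f g : R -> C) (a b : R) (l : C) :
  a <= b -> (forall t, a < t < b -> f t = g t) -> is_CRInt f a b l -> is_CRInt g a b l.
Proof.
  intros Hab H [H1 H2]. split.
  all: eapply is_RInt_ext; [|eassumption]; intros t Ht;
    rewrite Rmin_left, Rmax_right in Ht by assumption; simpl; rewrite H; auto.
Qed.

Lemma is_CRInt_plus (f g : R -> C) (a b : R) (l k : C) :
  is_CRInt f a b l -> is_CRInt g a b k -> is_CRInt (fun t => f t + g t)%C a b (l + k)%C.
Proof.
  intros [F1 F2] [G1 G2]; split.
  - apply (is_RInt_plus (fun t => Re (f t)) (fun t => Re (g t))); assumption.
  - apply (is_RInt_plus (fun t => Im (f t)) (fun t => Im (g t))); assumption.
Qed.

Lemma is_CRInt_scal (c : C) (f : R -> C) (a b : R) (l : C) :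
  is_CRInt f a b l -> is_CRInt (fun t => c * f t)%C a b (c * l)%C.
Proof.
  intros [F1 F2]; split.
  - apply (is_RInt_minus (fun t => Re c * Re (f t)) (fun t => Im c * Im (f t))).
    + apply (is_RInt_scal (fun t => Re (f t)) a b (Re c)); assumption.
    + apply (is_RInt_scal (fun t => Im (f t)) a b (Im c)); assumption.
  - apply (is_RInt_plus (fun t => Re c * Im (f t)) (fun t => Im c * Re (f t))).
    + apply (is_RInt_scal (fun t => Im (f t)) a b (Re c)); assumption.
    + apply (is_RInt_scal (fun t => Re (f t)) a b (Im c)); assumption.
Qed.

Lemma is_CRInt_minus (f g : R -> C) (a b : R) (l k : C) :
  is_CRInt f a b l -> is_CRInt g a b k -> is_CRInt (fun t => f t - g t)%C a b (l - k)%C.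
Proof.
  intros [F1 F2] [G1 G2]; split.
  - apply (is_RInt_minus (fun t => Re (f t)) (fun t => Re (g t))); assumption.
  - apply (is_RInt_minus (fun t => Im (f t)) (fun t => Im (g t))); assumption.
Qed.

Lemma is_CRInt_const (c : C) (a b : R) : is_CRInt (fun _ => c) a b (RtoC (b - a) * c)%C.
Proof.
  split; rewrite ?Re_mult, ?Im_mult; evar_last;
    try apply (is_RInt_const (V := R_NormedModule)); unfold scal; simpl; unfold mult; simpl; ring.
Qed.

Lemma is_CRInt_Chasles (f : R -> C) (a b c : R) (l k : C) :
  is_CRInt f a b l -> is_CRInt f b c k -> is_CRInt f a c (l + k)%C.
Proof.
  intros [F1 F2] [G1 G2]; split.
  - apply (is_RInt_Chasles (fun t => Re (f t)) a b c); assumption.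
  - apply (is_RInt_Chasles (fun t => Im (f t)) a b c); assumption.
Qed.

Lemma is_CRInt_csum (f : nat -> R -> C) (l : nat -> C) (a b : R) (n : nat) :
  (forall m, (1 <= m <= n)%nat -> is_CRInt (f m) a b (l m)) ->
  is_CRInt (fun t => csum (fun m => f m t) n) a b (csum l n).
Proof.
  induction n as [|n IH]; intros H.
  - simpl. pose proof (is_CRInt_const (RtoC 0) a b) as H0.
    replace (RtoC (b - a) * RtoC 0)%C with (RtoC 0) in H0 by ring. exact H0.
  - simpl. apply is_CRInt_plus; [apply IH; intros; apply H; lia|apply H; lia].
Qed.

(* The integral of [f] is estimated through that of [Re (Cconj l * f)], whose value is |l|^2. *)
Lemma is_CRInt_Cmod_le (f : R -> C) (a b K : R) (l : C) :
  a <= b -> (forall t, a < t < b -> Cmod (f t) <= K) -> is_CRInt f a b l ->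
  Cmod l <= K * (b - a).
Proof.
  intros Hab Hf H.
  destruct (Rle_lt_or_eq_dec _ _ (Cmod_ge_0 l)) as [Hl|Hl].
  - pose proof (is_CRInt_scal (Cconj l) f a b l H) as [H1 _].
    assert (Hle : Re (Cconj l * l)%C <= (b - a) * (Cmod l * K)).
    { apply (is_RInt_le (fun t => Re (Cconj l * f t)%C) (fun _ => Cmod l * K) a b); trivial.
      - apply (is_RInt_const (V := R_NormedModule)).
      - intros t Ht. eapply Rle_trans; [apply Rle_abs|].
        eapply Rle_trans; [apply Rabs_Re_le|]. rewrite Cmod_mult, Cmod_conj.
        apply Rmult_le_compat_l; [lra|apply Hf, Ht]. }
    replace (Re (Cconj l * l)%C) with (Cmod l ^ 2) in Hle.
    + apply (Rmult_le_reg_l (Cmod l)); [assumption|]. nra.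
    + rewrite Cmod_sqr. unfold Re, Im; simpl. ring.
  - rewrite <- Hl. destruct (Rle_lt_or_eq_dec _ _ Hab) as [Hab'|<-]; [|lra].
    assert (0 <= K); [|nra].
    eapply Rle_trans; [apply Cmod_ge_0|apply (Hf ((a + b) / 2))]. lra.
Qed.

Definition ccontinuous (f : R -> C) (t : R) : Prop :=
  continuous (fun t => Re (f t)) t /\ continuous (fun t => Im (f t)) t.

Lemma is_CRInt_derive (F f : R -> C) (a b : R) :
  a <= b ->
  (forall t, a <= t <= b -> is_cderive F t (f t)) ->
  (forall t, a <= t <= b -> ccontinuous f t) ->
  is_CRInt f a b (F b - F a)%C.
Proof.
  intros Hab HF Hf.
  split; [apply (is_RInt_derive (fun t => Re (F t)) (fun t => Re (f t)))
         |apply (is_RInt_derive (fun t => Im (F t)) (fun t => Im (f t)))];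
    intros t; rewrite Rmin_left, Rmax_right by assumption; intros Ht;
    solve [apply HF, Ht|apply Hf, Ht].
Qed.

Lemma is_CRInt_continuous (f : R -> C) (a b : R) :
  a <= b -> (forall t, a <= t <= b -> ccontinuous f t) -> is_CRInt f a b (CRInt f a b).
Proof.
  intros Hab Hf. split; apply (RInt_correct (V := R_CompleteNormedModule)), ex_RInt_continuous;
    intros t; rewrite Rmin_left, Rmax_right by assumption; intros Ht; apply Hf, Ht.
Qed.

Definition ccontinuous2 (f : R -> R -> C) (u t : R) : Prop :=
  continuity_2d_pt (fun u t => Re (f u t)) u t /\ continuity_2d_pt (fun u t => Im (f u t)) u t.

(* Holomorphy in z = u - i t on the half plane t > 0, with continuous derivative [df]:
   d/du = d/dz and d/dt = - i d/dz. *)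
Definition holo_deriv (f df : R -> R -> C) : Prop :=
  forall u t, 0 < t ->
    is_cderive (fun x => f x t) u (df u t) /\
    is_cderive (fun y => f u y) t ((0, -1) * df u t)%C /\
    ccontinuous2 f u t /\ ccontinuous2 df u t.

Definition holo (f : R -> R -> C) : Prop := exists df, holo_deriv f df.

Lemma continuity_2d_pt_slice (f : R -> R -> R) (u t : R) :
  continuity_2d_pt f u t -> continuous (f u) t.
Proof.
  intros H. apply filterlim_locally. intros eps. destruct (H eps) as [d Hd].
  exists d. intros y Hy. apply (Hd u y); [|exact Hy].
  rewrite Rminus_diag, Rabs_R0. apply cond_pos.
Qed.

Lemma holo_slice_continuous (f : R -> R -> C) (u t : R) :
  holo f -> 0 < t -> ccontinuous (f u) t.
Proof.
  intros [df Hf] Ht. destruct (Hf u t Ht) as [_ [_ [[H1 H2] _]]]. split.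
  - apply (continuity_2d_pt_slice (fun u t => Re (f u t))), H1.
  - apply (continuity_2d_pt_slice (fun u t => Im (f u t))), H2.
Qed.

(** Differentiation under the integral sign, followed by the fundamental theorem: q is a primitive
    in t of the u-derivative of p, as the Cauchy-Riemann equations will provide. *)
Lemma is_derive_RInt_slices (p dp : R -> R -> R) (q : R -> R) (a b u : R) :
  0 < a <= b ->
  (forall x t, 0 < t -> is_derive (fun y => p y t) x (dp x t)) ->
  (forall x t, 0 < t -> continuity_2d_pt p x t) ->
  (forall x t, 0 < t -> continuity_2d_pt dp x t) ->
  (forall t, 0 < t -> is_derive q t (dp u t)) ->
  is_derive (fun x => RInt (p x) a b) u (q b - q a).
Proof.
  intros Hab Hp Hcp Hcdp Hq.
  replace (q b - q a) with (RInt (fun t => Derive (fun x => p x t) u) a b).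
  - apply is_derive_RInt_param.
    + apply filter_forall. intros x t. rewrite Rmin_left by lra. intros Ht.
      exists (dp x t). apply Hp. lra.
    + intros t. rewrite Rmin_left by lra. intros Ht.
      apply continuity_2d_pt_ext_loc with dp; [|apply Hcdp; lra].
      (* [dp] is known to be the derivative only for positive second coordinate; the radius t keeps
         the neighbourhood there. *)
      assert (Hpos : 0 < t) by lra. exists (mkposreal t Hpos). intros x y _ Hy.
      symmetry. apply is_derive_unique, Hp. simpl in Hy.
      apply Rabs_lt_between' in Hy. lra.
    + apply filter_forall. intros x. apply (ex_RInt_continuous (p x)).
      intros t. rewrite Rmin_left by lra. intros Ht.
      apply (continuity_2d_pt_slice p), Hcp. lra.
  - apply is_RInt_unique.
    apply (is_RInt_ext (dp u)).
    + intros t. rewrite Rmin_left by lra. intros Ht. symmetry.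
      apply is_derive_unique, Hp. lra.
    + apply (is_RInt_derive q (dp u)).
      * intros t. rewrite Rmin_left by lra. intros Ht. apply Hq. lra.
      * intros t. rewrite Rmin_left by lra. intros Ht.
        apply (continuity_2d_pt_slice dp), Hcdp. lra.
Qed.

(* Cauchy's theorem on [u0, u1] x [a, b]: the u-derivative of the integral over a vertical
   segment is the difference of the values at its end points, up to the factor i. *)
Lemma holo_vertical_shift (f : R -> R -> C) (a b u0 u1 K : R) :
  holo f -> 0 < a <= b -> u0 <= u1 ->
  (forall u, u0 <= u <= u1 -> Cmod (f u a) <= K /\ Cmod (f u b) <= K) ->
  exists l0 l1, is_CRInt (f u0) a b l0 /\ is_CRInt (f u1) a b l1 /\
    Cmod (l1 - l0) <= 2 * K * (u1 - u0).
Proof.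
  intros [df Hf] Hab Hu HK.
  set (Phi := fun u => CRInt (f u) a b).
  assert (HPhi : forall u, is_CRInt (f u) a b (Phi u)).
  { intros u. apply is_CRInt_continuous; [lra|]. intros t Ht.
    apply holo_slice_continuous; [exists df; exact Hf|lra]. }
  exists (Phi u0), (Phi u1). split; [apply HPhi|]. split; [apply HPhi|].
  eapply Rle_trans.
  - apply (curve_increment_le Phi (fun u => (0, 1) * (f u b - f u a))%C
      (fun u => 2 * K * u) (fun _ => 2 * K) u0 u1 Hu).
    (* From df/dt = -i df/dz, the function - Im f is a t-primitive of the real part of [df], and Re
       f is one of its imaginary part. *)
    + intros u _. split.
      * evar_last.
        -- apply (is_derive_RInt_slices (fun u t => Re (f u t)) (fun u t => Re (df u t))
             (fun t => - Im (f u t)) a b u Hab).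
           ++ intros x t Ht. apply (Hf x t Ht).
           ++ intros x t Ht. apply (Hf x t Ht).
           ++ intros x t Ht. apply (Hf x t Ht).
           ++ intros t Ht. destruct (Hf u t Ht) as [_ [[_ H] _]].
              evar_last; [apply (is_derive_opp (fun t => Im (f u t))), H|].
              rewrite Im_mult. unfold opp; simpl. unfold Re, Im; simpl. ring.
        -- rewrite Re_mult. unfold Re, Im; simpl. ring.
      * evar_last.
        -- apply (is_derive_RInt_slices (fun u t => Im (f u t)) (fun u t => Im (df u t))
             (fun t => Re (f u t)) a b u Hab).
           ++ intros x t Ht. apply (Hf x t Ht).
           ++ intros x t Ht. apply (Hf x t Ht).
           ++ intros x t Ht. apply (Hf x t Ht).
           ++ intros t Ht. destruct (Hf u t Ht) as [_ [[H _] _]].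
              evar_last; [apply H|]. rewrite Re_mult. unfold Re, Im; simpl. ring.
        -- rewrite Im_mult. unfold Re, Im; simpl. ring.
    + intros u _. auto_derive; auto. ring.
    + intros u Hu'. destruct (HK u Hu') as [Ha Hb]. rewrite Cmod_mult.
      assert (H1 : Cmod (0, 1) = 1).
      { unfold Cmod; simpl. rewrite !Rmult_0_l, Rplus_0_l, !Rmult_1_r. apply sqrt_1. }
      rewrite H1, Rmult_1_l.
      unfold Cminus. eapply Rle_trans; [apply Cmod_triangle|]. rewrite Cmod_opp. lra.
  - right. ring.
Qed.

(** * Closure properties and examples of holomorphic functions *)

Lemma ccontinuous2_plus (f g : R -> R -> C) (u t : R) :
  ccontinuous2 f u t -> ccontinuous2 g u t -> ccontinuous2 (fun u t => f u t + g u t)%C u t.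
Proof. intros [F1 F2] [G1 G2]; split; apply continuity_2d_pt_plus; assumption. Qed.

Lemma ccontinuous2_mult (f g : R -> R -> C) (u t : R) :
  ccontinuous2 f u t -> ccontinuous2 g u t -> ccontinuous2 (fun u t => f u t * g u t)%C u t.
Proof.
  intros [F1 F2] [G1 G2]; split;
    [apply continuity_2d_pt_minus|apply continuity_2d_pt_plus];
    apply continuity_2d_pt_mult; assumption.
Qed.

Lemma ccontinuous2_const (c : C) (u t : R) : ccontinuous2 (fun _ _ => c) u t.
Proof. split; apply continuity_2d_pt_const. Qed.

Lemma holo_const (c : C) : holo (fun _ _ => c).
Proof.
  exists (fun _ _ => RtoC 0). intros u t _.
  split; [apply is_cderive_const|]. split.
  - eapply is_cderive_eq; [apply is_cderive_const|]. ring.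
  - split; apply ccontinuous2_const.
Qed.

Lemma holo_plus (f g : R -> R -> C) : holo f -> holo g -> holo (fun u t => f u t + g u t)%C.
Proof.
  intros [df Hf] [dg Hg]. exists (fun u t => df u t + dg u t)%C. intros u t Ht.
  destruct (Hf u t Ht) as [F1 [F2 [F3 F4]]]. destruct (Hg u t Ht) as [G1 [G2 [G3 G4]]].
  split; [apply is_cderive_plus; assumption|]. split.
  - eapply is_cderive_eq; [apply is_cderive_plus; eassumption|]. ring.
  - split; apply ccontinuous2_plus; assumption.
Qed.

Lemma holo_mult (f g : R -> R -> C) : holo f -> holo g -> holo (fun u t => f u t * g u t)%C.
Proof.
  intros [df Hf] [dg Hg]. exists (fun u t => df u t * g u t + f u t * dg u t)%C. intros u t Ht.
  destruct (Hf u t Ht) as [F1 [F2 [F3 F4]]]. destruct (Hg u t Ht) as [G1 [G2 [G3 G4]]].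
  split; [apply (is_cderive_mult (fun x => f x t) (fun x => g x t)); assumption|]. split.
  - eapply is_cderive_eq; [apply (is_cderive_mult (f u) (g u)); eassumption|]. ring.
  - split; [apply ccontinuous2_mult; assumption|].
    apply ccontinuous2_plus; apply ccontinuous2_mult; assumption.
Qed.

Lemma holo_csum (f : nat -> R -> R -> C) (n : nat) :
  (forall m, holo (f m)) -> holo (fun u t => csum (fun m => f m u t) n).
Proof.
  intros H. induction n as [|n IH]; simpl; [apply holo_const|].
  apply holo_plus; [exact IH|apply H].
Qed.

Lemma continuity_2d_pt_affine1 (A B u t : R) : continuity_2d_pt (fun u _ => A + B * u) u t.
Proof.
  apply continuity_2d_pt_plus; [apply continuity_2d_pt_const|].
  apply continuity_2d_pt_mult; [apply continuity_2d_pt_const|apply continuity_2d_pt_id1].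
Qed.

Lemma continuity_2d_pt_scal2 (B u t : R) : continuity_2d_pt (fun _ t => - (B * t)) u t.
Proof.
  apply continuity_2d_pt_opp.
  apply continuity_2d_pt_mult; [apply continuity_2d_pt_const|apply continuity_2d_pt_id2].
Qed.

Lemma ccontinuous2_cpow (x A B u t : R) :
  ccontinuous2 (fun u t => cpow x ((A + B * u)%R, (- (B * t))%R)) u t.
Proof.
  assert (H1 : continuity_2d_pt (fun u _ => exp ((A + B * u) * ln x)) u t).
  { apply (continuity_1d_2d_pt_comp exp (fun u _ => (A + B * u) * ln x)).
    - apply derivable_continuous_pt, derivable_pt_exp.
    - apply continuity_2d_pt_mult; [apply continuity_2d_pt_affine1|apply continuity_2d_pt_const]. }
  assert (H2 : continuity_2d_pt (fun _ t => - (B * t) * ln x) u t).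
  { apply continuity_2d_pt_mult; [apply continuity_2d_pt_scal2|apply continuity_2d_pt_const]. }
  split; (apply continuity_2d_pt_mult; [exact H1|]).
  - apply (continuity_1d_2d_pt_comp cos); [apply continuity_cos|exact H2].
  - apply (continuity_1d_2d_pt_comp sin); [apply continuity_sin|exact H2].
Qed.

Lemma holo_cpow (x A B : R) : holo (fun u t => cpow x ((A + B * u)%R, (- (B * t))%R)).
Proof.
  exists (fun u t => RtoC (B * ln x) * cpow x ((A + B * u)%R, (- (B * t))%R))%C. intros u t _.
  split; [|split]; [unfold cpow, Rpower; split; simpl; auto_derive; trivial;
    unfold Re, Im; simpl; ring ..|].
  split; [apply ccontinuous2_cpow|].
    apply ccontinuous2_mult; [apply ccontinuous2_const|apply ccontinuous2_cpow].
Qed.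

Lemma ccontinuous2_Cinv (A B u t : R) :
  B * t <> 0 -> ccontinuous2 (fun u t => / ((A + B * u)%R, (- (B * t))%R))%C u t.
Proof.
  intros Ht.
  assert (H1 : continuity_2d_pt (fun u t => / ((A + B * u) ^ 2 + (- (B * t)) ^ 2)) u t).
  { apply continuity_2d_pt_inv.
    - apply continuity_2d_pt_plus; simpl.
      + repeat apply continuity_2d_pt_mult; try apply continuity_2d_pt_affine1.
        apply continuity_2d_pt_const.
      + repeat apply continuity_2d_pt_mult; try apply continuity_2d_pt_scal2.
        apply continuity_2d_pt_const.
    - assert (0 < (B * t) ^ 2) by (apply pow2_gt_0; assumption).
      pose proof (pow2_ge_0 (A + B * u)). nra. }
  split; simpl; apply continuity_2d_pt_mult; try exact H1.
  - apply continuity_2d_pt_affine1.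
  - apply continuity_2d_pt_opp, continuity_2d_pt_scal2.
Qed.

(** The pole lies on t = 0, outside the open half plane of [holo]; this is the only singularity of
    the truncated zeta function. *)
Lemma holo_Cinv (A B : R) : B <> 0 -> holo (fun u t => / ((A + B * u)%R, (- (B * t))%R))%C.
Proof.
  intros HB.
  exists (fun u t => RtoC (- B) * (/ ((A + B * u)%R, (- (B * t))%R)
    * / ((A + B * u)%R, (- (B * t))%R)))%C.
  intros u t Ht.
  assert (HBt : B * t <> 0) by (apply Rmult_integral_contrapositive; split; lra).
  assert (Hd : (A + B * u) ^ 2 + (- (B * t)) ^ 2 <> 0).
  { assert (0 < (B * t) ^ 2) by (apply pow2_gt_0; assumption).
    pose proof (pow2_ge_0 (A + B * u)). nra. }
  split; [|split]; [split; unfold Cinv, Re, Im; simpl; auto_derive;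
    try (intros E; apply Hd; rewrite <- E; ring);
    trivial; simpl; field; intros E; apply Hd; rewrite <- E; ring ..|].
  split; [apply ccontinuous2_Cinv; assumption|].
  apply ccontinuous2_mult; [apply ccontinuous2_const|].
  apply ccontinuous2_mult; apply ccontinuous2_Cinv; assumption.
Qed.

Lemma holo_ext (f g : R -> R -> C) : (forall u t, f u t = g u t) -> holo f -> holo g.
Proof.
  intros H Hf. replace g with f; [exact Hf|].
  apply functional_extensionality; intros u. apply functional_extensionality; intros t. apply H.
Qed.

Lemma holo_zapprox (X : nat) (b : R) :
  b <> 0 -> holo (fun u t => zapprox X ((1 / 2 + b * u)%R, (- (b * t))%R)).
Proof.
  intros Hb.
  apply (holo_ext (fun u t =>
    csum (fun m => cpow (INR m) ((- (1 / 2) + - b * u)%R, (- (- b * t))%R)) X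
    + cpow (INR X) ((1 / 2 + - b * u)%R, (- (- b * t))%R)
      * / ((- (1 / 2) + b * u)%R, (- (b * t))%R))%C).
  - intros u t. unfold zapprox, Cdiv. f_equal.
    + apply csum_ext. intros m _. f_equal. apply C_eq; simpl; ring.
    + f_equal; f_equal; apply C_eq; simpl; field.
  - apply holo_plus; [|apply holo_mult].
    + apply holo_csum. intros m. apply holo_cpow.
    + apply holo_cpow.
    + apply holo_Cinv, Hb.
Qed.

(** * Shifting the line of integration *)

(* n^(u - 1/2 - i t) Z_X(1/2 + b (u - i t)) Z_X(1/2 + c (u - i t)); u = 0 is the critical line. *)
Definition shifted (X b c n : nat) (u t : R) : C :=
  (cpow (INR n) ((- (1 / 2) + 1 * u)%R, (- (1 * t))%R)
   * (zapprox X ((1 / 2 + INR b * u)%R, (- (INR b * t))%R)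
      * zapprox X ((1 / 2 + INR c * u)%R, (- (INR c * t))%R)))%C.

Lemma holo_shifted (X b c n : nat) :
  (1 <= b)%nat -> (1 <= c)%nat -> holo (shifted X b c n).
Proof.
  intros Hb Hc. apply holo_mult; [apply holo_cpow|].
  apply holo_mult; apply holo_zapprox; apply not_0_INR; lia.
Qed.

(** Here b >= 2 enters: it gives 1/2 + b u >= 1/2 + 2u, as [zapprox_bound] demands, and b t >= 12
    when t >= 6. *)
Lemma zapprox_bound_dilated (X b : nat) (u t : R) :
  (2 <= b)%nat -> 6 <= t -> 0 <= u <= 1 / 2 -> 2 * (INR b * t) ^ 2 <= INR X ->
  Cmod (zapprox X ((1 / 2 + INR b * u)%R, (- (INR b * t))%R))
    <= 500 * INR b * Rpower t (1 / 4 - u / 2).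
Proof.
  intros Hb Ht Hu HX. apply (le_INR 2) in Hb. change (INR 2) with 2 in Hb.
  eapply Rle_trans; [apply (zapprox_bound (INR b * t) u)|]; try assumption; try nra.
  rewrite <- Rpower_mult_distr by lra. rewrite Rmult_assoc.
  apply Rmult_le_compat_l; [lra|]. apply Rmult_le_compat_r; [apply Rpower_nneg|].
  apply Rle_trans with (Rpower (INR b) 1); [apply Rle_Rpower; lra|].
  rewrite Rpower_1; lra.
Qed.

(** The two zeta factors contribute t^(1/2-u) and the power of n contributes n^(-1/2) n^u; n <= t
    gives n^u <= t^u, and the dependence on u cancels. *)
Lemma shifted_bound (X b c n : nat) (u t : R) :
  (2 <= b)%nat -> (2 <= c)%nat -> (1 <= n)%nat -> 6 <= t -> INR n <= t -> 0 <= u <= 1 / 2 ->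
  2 * (INR b * t) ^ 2 <= INR X -> 2 * (INR c * t) ^ 2 <= INR X ->
  Cmod (shifted X b c n u t) <= 250000 * (INR b * INR c) * (/ sqrt (INR n) * sqrt t).
Proof.
  intros Hb Hc Hn Ht Hnt Hu HXb HXc. unfold shifted. rewrite !Cmod_mult, Cmod_cpow.
  pose proof (zapprox_bound_dilated X b u t Hb Ht Hu HXb) as Bb.
  pose proof (zapprox_bound_dilated X c u t Hc Ht Hu HXc) as Bc.
  set (P := Rpower t (1 / 4 - u / 2)) in *.
  assert (HP : 0 < P) by apply Rpower_pos.
  assert (Hn0 : 0 < INR n) by (apply INR_pos, Hn).
  apply Rle_trans with
    (Rpower (INR n) (- (1 / 2) + 1 * u) * ((500 * INR b * P) * (500 * INR c * P))).
  - apply Rmult_le_compat_l; [apply Rpower_nneg|].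
    apply Rmult_le_compat; try apply Cmod_ge_0; assumption.
  - replace (Rpower (INR n) (- (1 / 2) + 1 * u) * ((500 * INR b * P) * (500 * INR c * P)))
      with (250000 * (INR b * INR c) * (Rpower (INR n) (- (1 / 2) + 1 * u) * (P * P))) by ring.
    apply Rmult_le_compat_l.
    { pose proof (pos_INR b). pose proof (pos_INR c). nra. }
    rewrite Rpower_plus, Rpower_Ropp, Rpower_half by assumption. rewrite Rmult_assoc.
    apply Rmult_le_compat_l; [left; apply Rinv_0_lt_compat, sqrt_lt_R0, Hn0|].
    apply Rle_trans with (Rpower t (1 * u) * (P * P)).
    + apply Rmult_le_compat_r; [nra|]. apply Rle_Rpower_l; lra.
    + unfold P. rewrite <- !Rpower_plus.
      replace (1 * u + (1 / 4 - u / 2 + (1 / 4 - u / 2))) with (1 / 2) by field.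
      rewrite Rpower_half; lra.
Qed.

Lemma shifted_vertical_shift (X b c n : nat) (a T : R) :
  (2 <= b)%nat -> (2 <= c)%nat -> (1 <= n)%nat -> 6 <= a <= T -> INR n <= a ->
  2 * (INR b * T) ^ 2 <= INR X -> 2 * (INR c * T) ^ 2 <= INR X ->
  exists l0 l1, is_CRInt (shifted X b c n 0) a T l0 /\ is_CRInt (shifted X b c n (1 / 2)) a T l1 /\
    Cmod (l1 - l0) <= 250000 * (INR b * INR c) * (/ sqrt (INR n) * sqrt T).
Proof.
  intros Hb Hc Hn Ha Hna HXb HXc.
  set (K := 250000 * (INR b * INR c) * (/ sqrt (INR n) * sqrt T)).
  assert (Hsq : forall d t, 0 <= d -> 0 <= t <= T -> 2 * (d * t) ^ 2 <= 2 * (d * T) ^ 2).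
  { intros d t Hd Ht. apply Rmult_le_compat_l; [lra|]. apply pow_incr. nra. }
  destruct (holo_vertical_shift (shifted X b c n) a T 0 (1 / 2) K) as [l0 [l1 [H0 [H1 Hl]]]].
  - apply holo_shifted; lia.
  - lra.
  - lra.
  - intros u Hu. split.
    + eapply Rle_trans; [apply shifted_bound; try assumption; try lra|].
      * eapply Rle_trans; [apply Hsq with (t := a)|exact HXb]; [apply pos_INR|lra].
      * eapply Rle_trans; [apply Hsq with (t := a)|exact HXc]; [apply pos_INR|lra].
      * unfold K. apply Rmult_le_compat_l.
        { pose proof (pos_INR b). pose proof (pos_INR c). nra. }
        apply Rmult_le_compat_l; [left; apply Rinv_0_lt_compat, sqrt_lt_R0, INR_pos, Hn|].
        apply sqrt_le_1_alt. lra.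
    + apply shifted_bound; try assumption; lra.
  - exists l0, l1. split; [exact H0|]. split; [exact H1|]. lra.
Qed.

(** * Diagonal and off-diagonal terms on the line u = 1/2 *)

Lemma is_CRInt_cis_0 (a T : R) : is_CRInt (fun t => cis (0 * t)) a T (RtoC (T - a)).
Proof.
  pose proof (is_CRInt_const (RtoC 1) a T) as H.
  replace (RtoC (T - a) * RtoC 1)%C with (RtoC (T - a)) in H by ring.
  destruct H as [H1 H2]. split.
  - eapply is_RInt_ext; [|exact H1]. intros; unfold cis; simpl. rewrite Rmult_0_l, cos_0; auto.
  - eapply is_RInt_ext; [|exact H2]. intros; unfold cis; simpl. rewrite Rmult_0_l, sin_0; auto.
Qed.

Lemma is_CRInt_cis (lam a T : R) :
  lam <> 0 -> a <= T ->
  exists l, is_CRInt (fun t => cis (lam * t)) a T l /\ Cmod l <= 2 / Rabs lam.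
Proof.
  intros Hl HaT.
  set (F := fun t => ((0, - / lam)%R * cis (lam * t))%C).
  exists (F T - F a)%C. split.
  - apply is_CRInt_derive; [assumption| |].
    + intros t _. unfold F, cis. split; simpl; auto_derive; trivial; field; assumption.
    + intros t _. split; unfold cis; simpl;
        apply (ex_derive_continuous (K := R_AbsRing) (V := R_NormedModule)); auto_derive; trivial.
  - unfold Cminus. eapply Rle_trans; [apply Cmod_triangle|]. rewrite Cmod_opp.
    unfold F. rewrite !Cmod_mult, !Cmod_cis.
    assert (H : Cmod (0, - / lam) = / Rabs lam).
    { rewrite <- Rabs_inv, <- Rabs_Ropp, <- Cmod_R. unfold Cmod; simpl. f_equal. ring. }
    rewrite H. right. unfold Rdiv. ring.
Qed.

Definition harmonic (N : nat) : R := rsum (fun n => / INR n) N.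

Lemma harmonic_le (N : nat) : (1 <= N)%nat -> harmonic N <= 1 + ln (INR N).
Proof.
  intros HN. unfold harmonic. induction HN as [|N HN IH].
  - simpl. rewrite ln_1, Rinv_1. lra.
  - cbn [rsum]. apply INR_pos in HN.
    assert (H : 0 < INR (S N) / INR N) by (apply Rdiv_lt_0_compat; [apply INR_pos; lia|lra]).
    apply ln_ge_1_inv in H. rewrite ln_div in H by (first [assumption | apply INR_pos; lia]).
    replace (1 - / (INR (S N) / INR N)) with (/ INR (S N)) in H.
    + lra.
    + rewrite S_INR. field. lra.
Qed.

Lemma rsum_front (f : nat -> R) (n : nat) :
  rsum f (S n) = f 1%nat + rsum (fun k => f (S k)) n.
Proof.
  change (S n) with (1 + n)%nat. rewrite rsum_split. simpl. ring.
Qed.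

Lemma rsum_rev (f : nat -> R) (n : nat) : rsum (fun k => f (S n - k)%nat) n = rsum f n.
Proof.
  induction n as [|n IH]; [reflexivity|].
  rewrite rsum_front. cbn [rsum]. rewrite <- IH. rewrite Rplus_comm.
  replace (S (S n) - 1)%nat with (S n) by lia. reflexivity.
Qed.

Definition off_recip (A n : nat) : R :=
  if Nat.eq_dec A n then 0 else / Rabs (INR A - INR n).

(** On each side of A the distances to A are distinct positive integers. The bound is uniform in A,
    as it must be: A will be m^b k^c with m and k up to X. *)
Lemma rsum_off_recip (A N : nat) : rsum (off_recip A) N <= 2 * harmonic N.
Proof.
  assert (Hh : 0 <= harmonic N).
  { apply rsum_nneg. intros m Hm. left. apply Rinv_0_lt_compat, INR_pos; lia. }
  assert (Hbelow : forall K, (K < A)%nat -> rsum (off_recip A) K <= harmonic K).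
  { intros K HK. unfold harmonic. rewrite <- (rsum_rev (fun n => / INR n) K).
    apply rsum_le. intros m Hm. unfold off_recip.
    destruct (Nat.eq_dec A m) as [|_]; [lia|].
    assert (H : INR (S K - m) <= INR A - INR m).
    { rewrite minus_INR by lia. assert (INR (S K) <= INR A) by (apply le_INR; lia). lra. }
    assert (0 < INR (S K - m)) by (apply INR_pos; lia).
    rewrite Rabs_pos_eq by lra. apply Rinv_le_contravar; lra. }
  destruct (le_lt_dec A N) as [HAN|HAN]; [|specialize (Hbelow N HAN); lra].
  replace N with (A + (N - A))%nat at 1 by lia. rewrite rsum_split.
  assert (H1 : rsum (off_recip A) A <= harmonic N).
  { destruct A as [|A]; [exact Hh|]. cbn [rsum].
    unfold off_recip at 2. destruct (Nat.eq_dec (S A) (S A)) as [_|]; [|lia].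
    rewrite Rplus_0_r. eapply Rle_trans; [apply Hbelow; lia|].
    apply rsum_sub_le; [lia|]. intros m Hm. left. apply Rinv_0_lt_compat, INR_pos; lia. }
  assert (H2 : rsum (fun k => off_recip A (A + k)) (N - A) <= harmonic N).
  { eapply Rle_trans with (harmonic (N - A)).
    - right. apply rsum_ext. intros m Hm. unfold off_recip.
      destruct (Nat.eq_dec A (A + m)) as [|_]; [lia|].
      rewrite plus_INR. replace (INR A - (INR A + INR m)) with (- INR m) by ring.
      rewrite Rabs_Ropp, Rabs_pos_eq; [reflexivity|apply pos_INR].
    - apply rsum_sub_le; [lia|]. intros m Hm. left. apply Rinv_0_lt_compat, INR_pos; lia. }
  lra.
Qed.

(** 2/|lambda| bounds the integral of cis(lambda t) over any interval, here with lambda = ln A - ln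
    n; the value 0 at A = n leaves the diagonal to [diag_term]. *)
Definition off_log_recip (A n : nat) : R :=
  if Nat.eq_dec A n then 0 else 2 / Rabs (ln (INR A) - ln (INR n)).

Lemma log_gap_recip (x y : R) : 0 < x < y -> / Rabs (ln y - ln x) <= y * / (y - x).
Proof.
  intros Hxy. assert (H0 : 0 < y / x) by (apply Rdiv_lt_0_compat; lra).
  apply ln_ge_1_inv in H0. rewrite ln_div in H0 by lra.
  assert (H1 : 0 < (y - x) / y) by (apply Rdiv_lt_0_compat; lra).
  replace (1 - / (y / x)) with ((y - x) / y) in H0 by (field; lra).
  rewrite Rabs_pos_eq by lra.
  apply Rle_trans with (/ ((y - x) / y)); [apply Rinv_le_contravar; assumption|].
  right. field. lra.
Qed.

(** The inequality ln(y/x) >= (y-x)/y bounds the reciprocal by max(A, n)/|A - n|. When A is the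
    larger, A/(A-n) = 1 + n/(A-n), so only n <= N enters and never the size of A. *)
Lemma off_log_recip_le (A n N : nat) :
  (1 <= A)%nat -> (1 <= n <= N)%nat ->
  off_log_recip A n <= 2 * (1 + INR N * off_recip A n).
Proof.
  intros HA Hn. unfold off_log_recip, off_recip.
  destruct (Nat.eq_dec A n) as [|Hne]; [lra|].
  assert (HA0 : 0 < INR A) by (apply INR_pos; lia).
  assert (Hn0 : 0 < INR n) by (apply INR_pos; lia).
  assert (HnN : INR n <= INR N) by (apply le_INR; lia).
  unfold Rdiv. apply Rmult_le_compat_l; [lra|].
  assert (Hr : forall d, 0 < d -> INR n * / d <= INR N * / d).
  { intros d Hd. apply Rmult_le_compat_r; [left; apply Rinv_0_lt_compat, Hd|exact HnN]. }
  destruct (lt_dec n A) as [Hlt|Hge].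
  - apply lt_INR in Hlt. rewrite (Rabs_pos_eq (INR A - INR n)) by lra.
    eapply Rle_trans; [apply log_gap_recip; lra|].
    replace (INR A * / (INR A - INR n)) with (1 + INR n * / (INR A - INR n)) by (field; lra).
    apply Rplus_le_compat_l, Hr. lra.
  - assert (Hlt : INR A < INR n) by (apply lt_INR; lia).
    rewrite (Rabs_minus_sym (ln (INR A))), (Rabs_minus_sym (INR A)).
    rewrite (Rabs_pos_eq (INR n - INR A)) by lra.
    eapply Rle_trans; [apply log_gap_recip; lra|].
    specialize (Hr (INR n - INR A) ltac:(lra)). lra.
Qed.

Lemma rsum_off_log_recip (A N : nat) :
  (1 <= A)%nat -> (1 <= N)%nat ->
  rsum (off_log_recip A) N <= 2 * INR N * (3 + 2 * ln (INR N)).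
Proof.
  intros HA HN.
  eapply Rle_trans; [apply rsum_le; intros m Hm; apply (off_log_recip_le A m N HA Hm)|].
  rewrite rsum_scal, rsum_plus, rsum_const, rsum_scal.
  pose proof (rsum_off_recip A N). pose proof (harmonic_le N HN).
  assert (INR N * rsum (off_recip A) N <= INR N * (2 * (1 + ln (INR N)))).
  { apply Rmult_le_compat_l; [apply pos_INR|lra]. }
  lra.
Qed.

Definition diag_term (b c n m k : nat) : R :=
  if Nat.eq_dec (m ^ b * k ^ c) n then 1 else 0.

(** The value of 1/2 + b u at u = 1/2. *)
Definition half_exp (b : nat) : R := (1 + INR b) / 2.

Definition pair_weight (b c m k : nat) : R :=
  Rpower (INR m) (- half_exp b) * Rpower (INR k) (- half_exp c).

Lemma pair_weight_pos (b c m k : nat) : 0 < pair_weight b c m k.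
Proof. apply Rmult_lt_0_compat; apply Rpower_pos. Qed.

Lemma ln_pow_INR (m b : nat) : (1 <= m)%nat -> ln (INR (m ^ b)) = INR b * ln (INR m).
Proof. intros Hm. rewrite pow_INR. apply ln_pow. apply INR_pos, Hm. Qed.

Lemma pow_mul_pos (b c m k : nat) : (1 <= m)%nat -> (1 <= k)%nat -> (1 <= m ^ b * k ^ c)%nat.
Proof.
  intros Hm Hk.
  assert (m ^ b <> 0)%nat by (apply Nat.pow_nonzero; lia).
  assert (k ^ c <> 0)%nat by (apply Nat.pow_nonzero; lia). nia.
Qed.

Lemma ln_pow_mul (b c m k : nat) :
  (1 <= m)%nat -> (1 <= k)%nat ->
  ln (INR (m ^ b * k ^ c)) = INR b * ln (INR m) + INR c * ln (INR k).
Proof.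
  intros Hm Hk. rewrite mult_INR, ln_mult, !ln_pow_INR by
    (try assumption; rewrite pow_INR; apply pow_lt, INR_pos; assumption). reflexivity.
Qed.

Lemma oscillating_term_integral (b c n m k : nat) (a T : R) :
  (1 <= m)%nat -> (1 <= k)%nat -> (1 <= n)%nat -> a <= T ->
  exists l, is_CRInt (fun t => cis ((INR b * ln (INR m) + INR c * ln (INR k) - ln (INR n)) * t))
      a T l
    /\ Cmod (l - RtoC (diag_term b c n m k * (T - a))) <= off_log_recip (m ^ b * k ^ c) n.
Proof.
  intros Hm Hk Hn HaT. rewrite <- ln_pow_mul by assumption.
  unfold diag_term, off_log_recip. destruct (Nat.eq_dec (m ^ b * k ^ c) n) as [E|Hne].
  - exists (RtoC (T - a)). split.
    + rewrite E, Rminus_diag. apply is_CRInt_cis_0.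
    + rewrite Rmult_1_l. apply Cmod_self_minus. lra.
  - destruct (is_CRInt_cis (ln (INR (m ^ b * k ^ c)) - ln (INR n)) a T) as [l [H1 H2]].
    + intros E. apply Hne, INR_eq.
      apply ln_inv; [apply INR_pos, pow_mul_pos; assumption|apply INR_pos, Hn|lra].
    + assumption.
    + exists l. split; [exact H1|].
      replace (l - RtoC (0 * (T - a)))%C with l by (rewrite Rmult_0_l; ring). exact H2.
Qed.

(** The Dirichlet polynomial of [zapprox X] on the line u = 1/2, without the term X^(1-s)/(s-1). *)
Definition zpoly (X b : nat) (t : R) : C := csum (zterm (half_exp b) (INR b * t)) X.

Lemma zpoly_product (X b c n : nat) (t : R) :
  (cis (- t * ln (INR n)) * (zpoly X b t * zpoly X c t))%C
  = csum (fun m => csum (fun k => RtoC (pair_weight b c m k) *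
      cis ((INR b * ln (INR m) + INR c * ln (INR k) - ln (INR n)) * t))%C X) X.
Proof.
  transitivity (csum (fun m => cis (- t * ln (INR n)) * zterm (half_exp b) (INR b * t) m
     * zpoly X c t)%C X).
  - rewrite (csum_ext _ (fun m => (cis (- t * ln (INR n)) * zpoly X c t)
       * zterm (half_exp b) (INR b * t) m)%C) by (intros; ring).
    rewrite csum_scal. unfold zpoly. ring.
  - apply csum_ext. intros m _. unfold zpoly at 1. rewrite <- csum_scal.
    apply csum_ext. intros k _. unfold zterm, pair_weight.
    replace ((INR b * ln (INR m) + INR c * ln (INR k) - ln (INR n)) * t)
      with (- t * ln (INR n) + INR b * t * ln (INR m) + INR c * t * ln (INR k)) by ring.
    rewrite !cis_plus, RtoC_mult. ring.
Qed.

Lemma rsum_half_exp (b X : nat) :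
  (2 <= b)%nat -> rsum (fun m => Rpower (INR m) (- half_exp b)) X <= 3.
Proof.
  intros Hb. apply (le_INR 2) in Hb. change (INR 2) with 2 in Hb.
  eapply Rle_trans; [|apply (rsum_three_halves X)].
  apply rsum_le. intros m Hm. apply Rle_Rpower; [apply INR_ge_1; lia|].
  unfold half_exp. lra.
Qed.

Lemma Cmod_zpoly (X b : nat) (t : R) : (2 <= b)%nat -> Cmod (zpoly X b t) <= 3.
Proof.
  intros Hb. eapply Rle_trans; [apply csum_Cmod|].
  eapply Rle_trans; [|apply (rsum_half_exp b X Hb)].
  right. apply rsum_ext. intros m _. unfold zterm.
  rewrite Cmod_mult, Cmod_cis, Cmod_RtoC_nneg; [ring|apply Rpower_nneg].
Qed.

(** Only X^(1-s)/(s-1) is left: Re(1-s) = (1-b)/2 <= -1/2 and |s-1| >= b t >= 1. *)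
Lemma zapprox_zpoly (X b : nat) (t : R) :
  (2 <= b)%nat -> (1 <= X)%nat -> 1 <= t ->
  Cmod (zapprox X (half_exp b, (- (INR b * t))%R) - zpoly X b t) <= / sqrt (INR X).
Proof.
  intros Hb HX Ht. apply (le_INR 2) in Hb. change (INR 2) with 2 in Hb.
  unfold zapprox, zpoly. rewrite (csum_ext _ (zterm (half_exp b) (INR b * t)))
    by (intros; apply zterm_cpow).
  match goal with |- Cmod (?x + ?y - ?x) <= _ => replace (x + y - x)%C with y by ring end.
  set (s := (half_exp b, (- (INR b * t))%R) : C).
  assert (Hbt : 1 <= INR b * t) by nra.
  assert (Hs : 1 <= Cmod (s - 1)).
  { eapply Rle_trans; [|apply Rabs_Im_le]. unfold s; simpl.
    rewrite <- Rabs_Ropp. eapply Rle_trans; [|apply Rle_abs]. lra. }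
  assert (Hs' : (s - 1)%C <> RtoC 0).
  { intros H. rewrite H, Cmod_0 in Hs. lra. }
  rewrite Cmod_div, Cmod_cpow by assumption.
  assert (HX1 : 1 <= INR X) by (apply INR_ge_1, HX).
  assert (Hp : Rpower (INR X) (Re (1 - s)%C) <= / sqrt (INR X)).
  { rewrite <- Rpower_half by lra. rewrite <- Rpower_Ropp. apply Rle_Rpower; [assumption|].
    unfold s, half_exp; simpl. lra. }
  eapply Rle_trans; [|exact Hp].
  rewrite <- (Rmult_1_r (Rpower (INR X) (Re (1 - s)%C))) at 2.
  apply Rmult_le_compat_l; [apply Rpower_nneg|].
  apply Rle_trans with (/ 1); [apply Rinv_le_contravar; lra|rewrite Rinv_1; lra].
Qed.

Lemma shifted_half (X b c n : nat) (t : R) :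
  (1 <= n)%nat ->
  shifted X b c n (1 / 2) t
  = (cis (- t * ln (INR n)) * (zapprox X (half_exp b, (- (INR b * t))%R)
      * zapprox X (half_exp c, (- (INR c * t))%R)))%C.
Proof.
  intros Hn. unfold shifted. f_equal; [|f_equal].
  - rewrite cpow_cis. simpl. replace (- (1 / 2) + 1 * (1 / 2)) with 0 by lra.
    rewrite Rpower_O by (apply INR_pos, Hn). rewrite Rmult_1_l. ring.
  - f_equal. apply C_eq; unfold half_exp; simpl; field.
  - f_equal. apply C_eq; unfold half_exp; simpl; field.
Qed.

(** Expanding the product of the two polynomials yields pure oscillations, integrated one by one.
    Replacing each [zapprox] by [zpoly] changes the integrand by at most (3 + 3 + 1)/sqrt(X), since
    the polynomials are bounded by 3, and sqrt(X) >= T makes this at most 7 after integration. *)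
Lemma shifted_half_integral (X b c n : nat) (a T : R) (l : C) :
  (2 <= b)%nat -> (2 <= c)%nat -> (1 <= n)%nat -> 1 <= a <= T -> T ^ 2 <= INR X ->
  is_CRInt (shifted X b c n (1 / 2)) a T l ->
  Cmod (l - RtoC (rsum (fun m => rsum (fun k => pair_weight b c m k * diag_term b c n m k) X) X
                  * (T - a)))
    <= 7 + rsum (fun m => rsum (fun k =>
             pair_weight b c m k * off_log_recip (m ^ b * k ^ c) n) X) X.
Proof.
  intros Hb Hc Hn Ha HX Hl.
  assert (HX1 : (1 <= X)%nat).
  { destruct X; [simpl in HX; nra|lia]. }
  assert (HsX : T <= sqrt (INR X)).
  { rewrite <- (sqrt_Rsqr T) by lra. apply sqrt_le_1_alt. unfold Rsqr. lra. }
  set (P := fun t => (cis (- t * ln (INR n)) * (zpoly X b t * zpoly X c t))%C).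
  set (lam := fun m k => INR b * ln (INR m) + INR c * ln (INR k) - ln (INR n)).
  assert (HI : exists I, is_CRInt P a T I /\
    Cmod (I - RtoC (rsum (fun m => rsum (fun k => pair_weight b c m k * diag_term b c n m k) X) X
                  * (T - a)))
    <= rsum (fun m => rsum (fun k =>
             pair_weight b c m k * off_log_recip (m ^ b * k ^ c) n) X) X).
  { set (L := fun m k => CRInt (fun t => cis (lam m k * t)) a T).
    assert (HL : forall m k, (1 <= m)%nat -> (1 <= k)%nat ->
      is_CRInt (fun t => cis (lam m k * t)) a T (L m k) /\
      Cmod (L m k - RtoC (diag_term b c n m k * (T - a))) <= off_log_recip (m ^ b * k ^ c) n).
    { intros m k Hm Hk.
      destruct (oscillating_term_integral b c n m k a T Hm Hk Hn ltac:(lra)) as [x Hx].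
      unfold L. rewrite (is_CRInt_unique _ a T x); [exact Hx|apply Hx]. }
    exists (csum (fun m => csum (fun k => RtoC (pair_weight b c m k) * L m k)%C X) X). split.
    - apply (is_CRInt_ext (fun t => csum (fun m => csum (fun k => RtoC (pair_weight b c m k) *
        cis (lam m k * t))%C X) X)); [lra| |].
      + intros t _. symmetry. apply zpoly_product.
      + apply is_CRInt_csum. intros m Hm. apply is_CRInt_csum. intros k Hk.
        apply is_CRInt_scal, HL; lia.
    - rewrite Rmult_comm, <- rsum_scal, <- csum_RtoC, <- csum_minus.
      eapply Rle_trans; [apply csum_Cmod|]. apply rsum_le. intros m Hm.
      rewrite <- rsum_scal, <- csum_RtoC, <- csum_minus.
      eapply Rle_trans; [apply csum_Cmod|]. apply rsum_le. intros k Hk.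
      replace (RtoC ((T - a) * (pair_weight b c m k * diag_term b c n m k)))
        with (RtoC (pair_weight b c m k) * RtoC (diag_term b c n m k * (T - a)))%C
        by (rewrite <- RtoC_mult; f_equal; ring).
      match goal with |- Cmod (?w * ?x - ?w * ?y) <= _ =>
        replace (w * x - w * y)%C with (w * (x - y))%C by ring end.
      pose proof (pair_weight_pos b c m k).
      rewrite Cmod_mult, Cmod_RtoC_nneg by lra.
      apply Rmult_le_compat_l; [lra|]. apply HL; lia. }
  destruct HI as [I [HI1 HI2]].
  assert (HlI : Cmod (l - I) <= 7).
  { pose proof (is_CRInt_minus _ _ _ _ _ _ Hl HI1) as Hd.
    eapply Rle_trans; [apply (is_CRInt_Cmod_le (fun t => shifted X b c n (1 / 2) t - P t)%C
      a T (7 * / sqrt (INR X)) _)|]; [lra| |exact Hd|].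
    - intros t Ht. cbv beta. rewrite shifted_half by assumption. unfold P.
      match goal with |- Cmod (?w * ?x - ?w * ?y) <= _ =>
        replace (w * x - w * y)%C with (w * (x - y))%C by ring end.
      rewrite Cmod_mult, Cmod_cis, Rmult_1_l.
      pose proof (zapprox_zpoly X b t Hb HX1 ltac:(lra)) as Eb.
      pose proof (zapprox_zpoly X c t Hc HX1 ltac:(lra)) as Ec.
      set (zb := zapprox X (half_exp b, (- (INR b * t))%R)) in *.
      set (zc := zapprox X (half_exp c, (- (INR c * t))%R)) in *.
      replace (zb * zc - zpoly X b t * zpoly X c t)%C
        with (zpoly X b t * (zc - zpoly X c t) + (zb - zpoly X b t) * zpoly X c t
              + (zb - zpoly X b t) * (zc - zpoly X c t))%C by ring.
      eapply Rle_trans; [apply Cmod_triangle|].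
      eapply Rle_trans; [apply Rplus_le_compat_r, Cmod_triangle|].
      rewrite !Cmod_mult.
      pose proof (Cmod_zpoly X b t Hb). pose proof (Cmod_zpoly X c t Hc).
      assert (Hr : 0 < / sqrt (INR X) <= 1).
      { split; [apply Rinv_0_lt_compat; lra|]. rewrite <- Rinv_1. apply Rinv_le_contravar; lra. }
      set (r := / sqrt (INR X)) in *.
      assert (Cmod (zpoly X b t) * Cmod (zc - zpoly X c t) <= 3 * r)
        by (apply Rmult_le_compat; try apply Cmod_ge_0; assumption).
      assert (Cmod (zb - zpoly X b t) * Cmod (zpoly X c t) <= r * 3)
        by (apply Rmult_le_compat; try apply Cmod_ge_0; assumption).
      assert (Cmod (zb - zpoly X b t) * Cmod (zc - zpoly X c t) <= r * 1)
        by (apply Rmult_le_compat; try apply Cmod_ge_0; lra).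
      lra.
    - apply Rle_trans with (7 * / sqrt (INR X) * sqrt (INR X)).
      + apply Rmult_le_compat_l; [|lra].
        apply Rmult_le_pos; [lra|left; apply Rinv_0_lt_compat; lra].
      + rewrite Rmult_assoc, Rinv_l; lra. }
  match goal with |- Cmod (l - ?x) <= _ =>
    replace (l - x)%C with ((l - I) + (I - x))%C by ring end.
  eapply Rle_trans; [apply Cmod_triangle|]. lra.
Qed.

Lemma rsum_pair_weight_le (b c X : nat) (g : nat -> nat -> R) (G : R) :
  (2 <= b)%nat -> (2 <= c)%nat -> 0 <= G ->
  (forall m k, (1 <= m)%nat -> (1 <= k)%nat -> g m k <= G) ->
  rsum (fun m => rsum (fun k => pair_weight b c m k * g m k) X) X <= 9 * G.
Proof.
  intros Hb Hc HG Hg.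
  apply Rle_trans with (rsum (fun m => rsum (fun k => pair_weight b c m k * G) X) X).
  - apply rsum_le. intros m Hm. apply rsum_le. intros k Hk.
    apply Rmult_le_compat_l; [left; apply pair_weight_pos|apply Hg; lia].
  - apply Rle_trans with (rsum (fun m => Rpower (INR m) (- half_exp b) * (3 * G)) X).
    + apply rsum_le. intros m Hm. unfold pair_weight.
      rewrite (rsum_ext _ (fun k => (Rpower (INR m) (- half_exp b) * G)
        * Rpower (INR k) (- half_exp c))) by (intros; ring).
      rewrite rsum_scal. rewrite Rmult_assoc.
      apply Rmult_le_compat_l; [apply Rpower_nneg|].
      pose proof (rsum_half_exp c X Hc). nra.
    + rewrite (rsum_ext _ (fun m => (3 * G) * Rpower (INR m) (- half_exp b)))
        by (intros; ring).
      rewrite rsum_scal. pose proof (rsum_half_exp b X Hb). nra.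
Qed.

(** * Sums of powers *)

Definition zeta_real (a : R) : R := Re (zeta (RtoC a)).

Lemma Rpower_2_neq_1 (e : R) : e <> 0 -> Rpower 2 e <> 1.
Proof.
  intros He H. apply (f_equal ln) in H. unfold Rpower in H. rewrite ln_exp, ln_1 in H.
  pose proof ln_lt_2. apply Rmult_integral in H. destruct H; [contradiction|lra].
Qed.

Lemma zeta_real_zapprox (a : R) (N : nat) :
  0 < a -> a <> 1 -> (1 <= N)%nat ->
  Cmod (zeta (RtoC a)
        - RtoC (rsum (fun k => Rpower (INR k) (- a)) N - Rpower (INR N) (1 - a) / (1 - a)))
    <= Rpower (INR N) (- a).
Proof.
  intros Ha Ha1 HN.
  pose proof (zeta_zapprox (RtoC a) N Ha) as H.
  replace (RtoC (rsum (fun k => Rpower (INR k) (- a)) N - Rpower (INR N) (1 - a) / (1 - a)))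
    with (zapprox N (RtoC a)).
  - eapply Rle_trans; [apply H|]; [|assumption|].
    + rewrite <- RtoC_minus, cpow_RtoC. intros E. apply RtoC_inj in E. revert E.
      apply Rpower_2_neq_1. lra.
    + simpl Re. rewrite Cmod_RtoC_nneg by lra. right. field. lra.
  - unfold zapprox. rewrite <- !RtoC_minus, cpow_RtoC, <- RtoC_div by lra.
    rewrite (csum_ext _ (fun k => RtoC (Rpower (INR k) (- a)))).
    + rewrite csum_RtoC, <- RtoC_plus. f_equal. field. lra.
    + intros m _. rewrite <- RtoC_opp. apply cpow_RtoC.
Qed.

(** The truncations at a real point are real, so the imaginary part is at most N^(-a) for every
    N. *)
Lemma zeta_RtoC (a : R) : 0 < a -> a <> 1 -> zeta (RtoC a) = RtoC (zeta_real a).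
Proof.
  intros Ha Ha1. apply C_eq; [reflexivity|]. simpl Im.
  destruct (Req_dec (Im (zeta (RtoC a))) 0) as [H|H]; [exact H|exfalso].
  apply Rabs_pos_lt in H. destruct (Rpower_INR_small a _ Ha H) as [N [HN HN']].
  specialize (HN' N (le_n _)).
  pose proof (zeta_real_zapprox a N Ha Ha1 HN) as Hz.
  eapply Rle_trans in Hz; [|apply Rabs_Im_le].
  match type of Hz with Rabs (Im (?z - RtoC ?x)%C) <= _ =>
    replace (Im (z - RtoC x)%C) with (Im z) in Hz by (symmetry; apply Rminus_0_r) end.
  lra.
Qed.

Lemma is_derive_Rpower_div (e x : R) :
  e <> 0 -> 0 < x -> is_derive (fun t => Rpower t e / e) x (Rpower x (e - 1)).
Proof.
  intros He Hx. apply (is_derive_ext (fun t => / e * Rpower t e)).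
  - intros t. unfold Rdiv. apply Rmult_comm.
  - evar_last; [apply (is_derive_scal (fun t => Rpower t e)), is_derive_Rpower, Hx|].
    field. assumption.
Qed.

Lemma Rpower_primitive_increment (e x y : R) :
  e <> 0 -> 0 < x <= y ->
  exists c, x <= c <= y /\ Rpower y e / e - Rpower x e / e = Rpower c (e - 1) * (y - x).
Proof.
  intros He Hxy.
  destruct (MVT_gen (fun t => Rpower t e / e) x y (fun t => Rpower t (e - 1))) as [c [Hc Heq]].
  - intros t. rewrite Rmin_left, Rmax_right by lra. intros Ht.
    apply is_derive_Rpower_div; [assumption|lra].
  - intros t. rewrite Rmin_left, Rmax_right by lra. intros Ht.
    apply derivable_continuous_pt. exists (Rpower t (e - 1)).
    apply is_derive_Reals, is_derive_Rpower_div; [assumption|lra].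
  - rewrite Rmin_left, Rmax_right in Hc by lra. exists c. split; assumption.
Qed.

Lemma floor_pos (y : R) (N : nat) : 1 <= y -> INR N <= y < INR N + 1 -> (1 <= N)%nat.
Proof. intros Hy HN. destruct N; [simpl in HN; lra|lia]. Qed.

(** From y < N + 1 and N >= 1 it follows that N >= y/2. *)
Lemma Rpower_neg_floor (a y : R) (N : nat) :
  0 < a -> 1 <= y -> INR N <= y < INR N + 1 ->
  Rpower (INR N) (- a) <= Rpower 2 a * Rpower y (- a).
Proof.
  intros Ha Hy HN. pose proof (INR_ge_1 N (floor_pos y N Hy HN)) as HN1.
  replace (Rpower 2 a) with (Rpower (/ 2) (- a)).
  - rewrite Rpower_mult_distr by lra. apply Rpower_neg_antitone; lra.
  - rewrite Rpower_Ropp. unfold Rpower. rewrite ln_Rinv by lra.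
    rewrite <- exp_Ropp. f_equal. ring.
Qed.

(** The truncation at N has error N^(-a), and moving N^(1-a)/(1-a) to y^(1-a)/(1-a) costs at most
    N^(-a) more; both are measured by y^(-a). The cases a < 1 and a > 1 are treated alike. *)
Lemma power_sum_zeta (a : R) :
  0 < a -> a <> 1 -> exists K, 0 <= K /\ forall y N, 1 <= y -> INR N <= y < INR N + 1 ->
    Rabs (rsum (fun k => Rpower (INR k) (- a)) N - (zeta_real a + Rpower y (1 - a) / (1 - a)))
      <= K * Rpower y (- a).
Proof.
  intros Ha Ha1. exists (2 * Rpower 2 a).
  split; [pose proof (Rpower_pos 2 a); lra|]. intros y N Hy HN.
  pose proof (floor_pos y N Hy HN) as HN1.
  pose proof (zeta_real_zapprox a N Ha Ha1 HN1) as Hz.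
  eapply Rle_trans in Hz; [|apply Rabs_Re_le].
  change (Re (zeta (RtoC a)
    - RtoC (rsum (fun k => Rpower (INR k) (- a)) N - Rpower (INR N) (1 - a) / (1 - a)))%C)
    with (zeta_real a - (rsum (fun k => Rpower (INR k) (- a)) N
      - Rpower (INR N) (1 - a) / (1 - a))) in Hz.
  destruct (Rpower_primitive_increment (1 - a) (INR N) y) as [c [Hc Heq]];
    [lra|split; [apply INR_pos, HN1|lra]|].
  replace (1 - a - 1) with (- a) in Heq by ring.
  assert (Hc' : Rpower c (- a) <= Rpower (INR N) (- a)).
  { apply Rpower_neg_antitone; [lra|]. split; [apply INR_pos, HN1|lra]. }
  pose proof (Rpower_pos c (- a)) as Hc0.
  assert (H0 : 0 <= Rpower c (- a) * (y - INR N) <= Rpower (INR N) (- a)) by nra.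
  pose proof (Rpower_neg_floor a y N Ha Hy HN) as HF.
  apply Rabs_le_between in Hz. apply Rabs_le. lra.
Qed.

Lemma power_sum_growing (a : R) :
  0 < a -> forall y N, 1 <= y -> INR N <= y < INR N + 1 ->
    Rabs (rsum (fun k => Rpower (INR k) a) N - Rpower y (a + 1) / (a + 1)) <= Rpower y a.
Proof.
  intros Ha y N Hy HN.
  assert (H : forall n, (1 <= n)%nat ->
    0 <= rsum (fun k => Rpower (INR k) a) n - Rpower (INR n) (a + 1) / (a + 1)
      <= Rpower (INR n) a).
  { intros n Hn. induction Hn as [|n Hn IH].
    - simpl. unfold Rpower. rewrite ln_1, !Rmult_0_r, exp_0.
      assert (0 < 1 / (a + 1)) by (apply Rdiv_lt_0_compat; lra).
      assert (1 / (a + 1) <= 1).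
      { apply div_le_1; lra. }
      lra.
    - cbn [rsum]. apply INR_pos in Hn.
      destruct (Rpower_primitive_increment (a + 1) (INR n) (INR (S n))) as [c [Hc Heq]];
        [lra|rewrite S_INR; lra|].
      rewrite S_INR in Heq at 2. replace (INR n + 1 - INR n) with 1 in Heq by ring.
      replace (a + 1 - 1) with a in Heq by ring.
      assert (Rpower c a <= Rpower (INR (S n)) a) by (apply Rle_Rpower_l; lra).
      assert (Rpower (INR n) a <= Rpower c a) by (apply Rle_Rpower_l; lra).
      lra. }
  pose proof (floor_pos y N Hy HN) as HN1. specialize (H N HN1).
  apply INR_pos in HN1.
  destruct (Rpower_primitive_increment (a + 1) (INR N) y) as [c [Hc Heq]]; [lra|lra|].
  replace (a + 1 - 1) with a in Heq by ring.
  assert (Rpower c a <= Rpower y a) by (apply Rle_Rpower_l; lra).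
  assert (Rpower (INR N) a <= Rpower y a) by (apply Rle_Rpower_l; lra).
  pose proof (Rpower_pos c a).
  apply Rabs_le. nra.
Qed.

(** The sequence harmonic n - ln n decreases, by at most 1/n - 1/(n+1) at each step, so it is within
    1/N of its limit. Replacing ln N by ln y costs another 1/N, and 1/N <= 2/y. *)
Lemma harmonic_euler_gamma (y : R) (N : nat) :
  1 <= y -> INR N <= y < INR N + 1 -> Rabs (harmonic N - (euler_gamma + ln y)) <= 4 * / y.
Proof.
  intros Hy HN.
  (* Embedded in C so that [C_Cauchy_bound] applies. *)
  set (d := fun n => RtoC (harmonic n - ln (INR n))).
  assert (Hd : forall n, (1 <= n)%nat ->
    0 <= ln (INR (S n)) - ln (INR n) - / INR (S n) <= / INR n - / INR (S n)).
  { intros n Hn. apply INR_pos in Hn. rewrite S_INR.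
    rewrite ln_sub by lra.
    assert (H0 : 0 < (INR n + 1) / INR n) by (apply Rdiv_lt_0_compat; lra).
    pose proof (ln_ge_1_inv _ H0) as H1. pose proof (ln_le_pred _ H0) as H2.
    replace (1 - / ((INR n + 1) / INR n)) with (/ (INR n + 1)) in H1 by (field; lra).
    replace ((INR n + 1) / INR n - 1) with (/ INR n) in H2 by (field; lra). lra. }
  destruct (C_Cauchy_bound d (fun n => / INR n)) as [l Hl].
  { intros A B [HA HAB].
    assert (H : 0 <= (harmonic A - ln (INR A)) - (harmonic B - ln (INR B)) <= / INR A - / INR B).
    { induction HAB as [|B HB IH]; [lra|]. specialize (Hd B ltac:(lia)).
      unfold harmonic in *. cbn [rsum]. lra. }
    unfold d. rewrite <- RtoC_minus, Cmod_R, <- Rabs_Ropp, Rabs_pos_eq by lra.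
    destruct (Nat.eq_dec B 0) as [->|HB0]; [lia|].
    assert (0 < / INR B) by (apply Rinv_0_lt_compat, INR_pos; lia). lra. }
  { intros eps He. destruct (Rpower_INR_small 1 eps Rlt_0_1 He) as [N0 [H1 H2]].
    exists N0. split; [exact H1|]. intros n Hn. specialize (H2 n Hn).
    rewrite Rpower_Ropp, Rpower_1 in H2 by (apply INR_pos; lia). exact H2. }
  assert (Hg : euler_gamma = Re l).
  { unfold euler_gamma. rewrite (is_lim_seq_unique _ (Finite (Re l))); [reflexivity|].
    apply is_lim_seq_spec. intros eps.
    destruct (Rpower_INR_small 1 eps Rlt_0_1 (cond_pos eps)) as [N0 [H1 H2]].
    (* The n-th member of the sequence that defines [euler_gamma] is the one belonging to n + 1. *)
    exists N0. intros n Hn. specialize (H2 (S n) ltac:(lia)).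
    rewrite Rpower_Ropp, Rpower_1 in H2 by (apply INR_pos; lia).
    specialize (Hl (S n) ltac:(lia)).
    eapply Rle_trans in Hl; [|apply Rabs_Re_le].
    replace (sum_f_R0 (fun k : nat => / INR (S k)) n) with (harmonic (S n)).
    - rewrite Rabs_minus_sym. eapply Rle_lt_trans; [exact Hl|exact H2].
    - clear. induction n as [|n IH]; [unfold harmonic; simpl; ring|].
      rewrite tech5, <- IH. reflexivity. }
  pose proof (floor_pos y N Hy HN) as HN1. pose proof (INR_ge_1 N HN1) as HN1'.
  specialize (Hl N HN1). eapply Rle_trans in Hl; [|apply Rabs_Re_le].
  change (Re (l - d N)%C) with (Re l - (harmonic N - ln (INR N))) in Hl.
  rewrite <- Hg in Hl.
  assert (Hln : 0 <= ln y - ln (INR N) <= / INR N).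
  { rewrite ln_sub by lra.
    assert (H0 : 0 < y / INR N) by (apply Rdiv_lt_0_compat; lra).
    pose proof (ln_ge_1_inv _ H0) as H1. pose proof (ln_le_pred _ H0) as H2.
    replace (1 - / (y / INR N)) with ((y - INR N) / y) in H1 by (field; lra).
    replace (y / INR N - 1) with ((y - INR N) * / INR N) in H2 by (field; lra).
    assert (0 <= (y - INR N) / y) by (apply Rdiv_le_0_compat; lra).
    assert (0 < / INR N) by (apply Rinv_0_lt_compat; lra). nra. }
  assert (HNy : / INR N <= 2 * / y).
  { replace (2 * / y) with (/ (y / 2)) by (field; lra). apply Rinv_le_contravar; lra. }
  apply Rabs_le_between in Hl. apply Rabs_le. lra.
Qed.

(** Write k^e = k^(e+1/2) k^(-1/2) and bound the first factor by its value at y, which e >= -1/2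
    permits. *)
Lemma power_sum_upper (e y : R) (N : nat) :
  - (1 / 2) <= e -> 1 <= y -> INR N <= y ->
  rsum (fun k => Rpower (INR k) e) N <= 2 * Rpower y (e + 1).
Proof.
  intros He Hy HN.
  apply Rle_trans with (rsum (fun k => Rpower y (e + 1 / 2) * / sqrt (INR k)) N).
  - apply rsum_le. intros k Hk. assert (Hk1 : 1 <= INR k) by (apply INR_ge_1; lia).
    assert (INR k <= INR N) by (apply le_INR; lia).
    replace (Rpower (INR k) e) with (Rpower (INR k) (e + 1 / 2) * / sqrt (INR k)).
    + apply Rmult_le_compat_r; [left; apply Rinv_0_lt_compat, sqrt_lt_R0; lra|].
      apply Rle_Rpower_l; lra.
    + rewrite <- Rpower_half, <- Rpower_Ropp, <- Rpower_plus by lra. f_equal. ring.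
  - rewrite rsum_scal. replace (e + 1) with (e + 1 / 2 + 1 / 2) by field.
    rewrite (Rpower_plus (e + 1 / 2)), Rpower_half by lra.
    pose proof (rsum_inv_sqrt N).
    assert (sqrt (INR N) <= sqrt y) by (apply sqrt_le_1_alt; exact HN).
    pose proof (Rpower_pos y (e + 1 / 2)). nra.
Qed.

(** For e = 1/theta and x = n/V, T times this weight is the length T - 2 pi n^(1/theta) of the
    interval on which the n-th term of [D_theta] is present, and 0 if it never enters. *)
Definition cutoff (e x : R) : R := if Rle_dec x 1 then 1 - Rpower x e else 0.

Lemma cutoff_power (e b x : R) : 0 < b -> 0 < x -> cutoff e (Rpower x b) = cutoff (b * e) x.
Proof.
  intros Hb Hx. unfold cutoff. rewrite Rpower_mult.
  destruct (Rle_dec x 1) as [H|H]; destruct (Rle_dec (Rpower x b) 1) as [H'|H']; trivial.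
  - exfalso. apply H'. rewrite <- (Rpower_O 1) by lra.
    replace (Rpower 1 0) with (Rpower 1 b); [apply Rle_Rpower_l; lra|].
    unfold Rpower. rewrite ln_1. f_equal. ring.
  - exfalso. apply H. apply Rnot_lt_le. intros H1.
    assert (Rpower 1 b < Rpower x b) by (apply Rlt_Rpower_l; lra).
    unfold Rpower in H0 at 1. rewrite ln_1, Rmult_0_r, exp_0 in H0. lra.
Qed.

Lemma real_floor (y : R) : 1 <= y -> exists N : nat, INR N <= y < INR N + 1.
Proof. intros Hy. destruct (nfloor_ex y) as [N HN]; [lra|]. exists N. exact HN. Qed.

Lemma rsum_zero_tail (f : nat -> R) (N X : nat) :
  (N <= X)%nat -> (forall m, (N < m <= X)%nat -> f m = 0) -> rsum f X = rsum f N.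
Proof.
  intros HNX Hf. replace X with (N + (X - N))%nat by lia. rewrite rsum_split.
  rewrite (rsum_ext (fun k => f (N + k)%nat) (fun _ => 0)) by (intros; apply Hf; lia).
  rewrite rsum_const. ring.
Qed.

(* 1/p comes from the term 1 of the cut-off and 1/p' from its term (m/M)^(p + p'). *)
Lemma cutoff_power_sum (p p' : R) :
  0 < p -> 1 < p' -> exists K, 0 <= K /\ forall M X, 1 <= M <= INR X ->
    Rabs (rsum (fun m => Rpower (INR m) (- (p + 1)) * cutoff (p + p') (INR m / M)) X
          - (zeta_real (p + 1) - (1 / p + 1 / p') * Rpower M (- p)))
      <= K * Rpower M (- (p + 1)).
Proof.
  intros Hp Hp'.
  destruct (power_sum_zeta (p + 1)) as [K [HK0 HK]]; [lra|lra|].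
  exists (K + 1). split; [lra|]. intros M X HMX.
  destruct (real_floor M) as [N HN]; [lra|].
  pose proof (floor_pos M N ltac:(lra) HN) as HN1.
  assert (HNX : (N <= X)%nat) by (apply INR_le; lra).
  rewrite (rsum_zero_tail _ N X HNX).
  2:{ intros m Hm. unfold cutoff. destruct (Rle_dec (INR m / M) 1) as [H|H]; [exfalso|ring].
      assert (INR (S N) <= INR m) by (apply le_INR; lia). rewrite S_INR in *.
      apply (Rmult_le_compat_r M) in H; [|lra].
      replace (INR m / M * M) with (INR m) in H by (field; lra). lra. }
  assert (Hsum : rsum (fun m => Rpower (INR m) (- (p + 1)) * cutoff (p + p') (INR m / M)) N
    = rsum (fun m => Rpower (INR m) (- (p + 1))) N
      - Rpower M (- (p + p')) * rsum (fun m => Rpower (INR m) (p' - 1)) N).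
  { rewrite <- rsum_scal, <- rsum_minus. apply rsum_ext. intros m Hm.
    assert (Hm0 : 0 < INR m) by (apply INR_pos; lia).
    assert (INR m <= INR N) by (apply le_INR; lia).
    unfold cutoff. destruct (Rle_dec (INR m / M) 1) as [H1|H1].
    - unfold Rdiv. rewrite <- Rpower_mult_distr by (try apply Rinv_0_lt_compat; lra).
      replace (Rpower (/ M) (p + p')) with (Rpower M (- (p + p'))).
      2:{ unfold Rpower. rewrite ln_Rinv by lra. f_equal. ring. }
      replace (p' - 1) with (- (p + 1) + (p + p')) by ring.
      rewrite (Rpower_plus (- (p + 1)) (p + p')). ring.
    - exfalso. apply H1. apply (Rmult_le_reg_r M); [lra|].
      replace (INR m / M * M) with (INR m) by (field; lra). lra. }
  rewrite Hsum.
  specialize (HK M N ltac:(lra) HN).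
  pose proof (power_sum_growing (p' - 1) ltac:(lra) M N ltac:(lra) HN) as HG.
  replace (p' - 1 + 1) with p' in HG by ring.
  replace (1 - (p + 1)) with (- p) in HK by ring.
  set (S1 := rsum (fun m => Rpower (INR m) (- (p + 1))) N) in *.
  set (S2 := rsum (fun m => Rpower (INR m) (p' - 1)) N) in *.
  replace (S1 - Rpower M (- (p + p')) * S2
    - (zeta_real (p + 1) - (1 / p + 1 / p') * Rpower M (- p)))
    with ((S1 - (zeta_real (p + 1) + Rpower M (- p) / - p))
      - Rpower M (- (p + p')) * (S2 - Rpower M p' / p')).
  - eapply Rle_trans; [apply Rabs_triang|]. rewrite Rabs_Ropp, Rabs_mult.
    rewrite (Rabs_pos_eq (Rpower M (- (p + p')))) by (apply Rpower_nneg).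
    apply (Rmult_le_compat_l (Rpower M (- (p + p')))) in HG; [|apply Rpower_nneg].
    rewrite <- Rpower_plus in HG.
    replace (- (p + p') + (p' - 1)) with (- (p + 1)) in HG by ring. lra.
  - replace (Rpower M (- p)) with (Rpower M (- (p + p')) * Rpower M p').
    + field. lra.
    + rewrite <- Rpower_plus. f_equal. ring.
Qed.

(** * The hyperbola method *)

(** Inclusion-exclusion for the region where m <= Y or k <= Y: the square is counted twice. *)
Lemma rsum_square_split (t : nat -> nat -> R) (Y X : nat) :
  (Y <= X)%nat -> (forall m k, (Y < m)%nat -> (Y < k)%nat -> t m k = 0) ->
  rsum (fun m => rsum (t m) X) X
  = rsum (fun m => rsum (t m) X) Y + rsum (fun k => rsum (fun m => t m k) X) Y
    - rsum (fun m => rsum (t m) Y) Y.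
Proof.
  intros HYX Ht.
  rewrite (rsum_exchange t Y Y).
  assert (H1 : rsum (fun m => rsum (t m) X) X = rsum (fun m => rsum (t m) X) Y
    + rsum (fun k => rsum (fun m => t (Y + m)%nat k) (X - Y)) Y).
  { pose proof (rsum_split (fun m => rsum (t m) X) Y (X - Y)) as E.
    replace (Y + (X - Y))%nat with X in E by lia. rewrite E. f_equal.
    rewrite <- (rsum_exchange (fun m k => t (Y + m)%nat k)). apply rsum_ext. intros m Hm.
    apply rsum_zero_tail; [assumption|]. intros k Hk. apply Ht; lia. }
  assert (H2 : rsum (fun k => rsum (fun m => t m k) X) Y = rsum (fun k => rsum (fun m => t m k) Y) Y
    + rsum (fun k => rsum (fun m => t (Y + m)%nat k) (X - Y)) Y).
  { rewrite <- rsum_plus. apply rsum_ext. intros k Hk.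
    rewrite <- rsum_split. f_equal. lia. }
  lra.
Qed.

Lemma Rabs_rsum_le (f : nat -> R) (n : nat) : Rabs (rsum f n) <= rsum (fun m => Rabs (f m)) n.
Proof.
  induction n as [|n IH]; simpl; [rewrite Rabs_R0; lra|].
  eapply Rle_trans; [apply Rabs_triang|]. lra.
Qed.

(** Used for the products of one-variable sums over the square. The product of the two errors has
    order y^(s+s'-2), absorbed because y >= 1. *)
Lemma product_power_asymptotic (x x' al al' K K' s s' y : R) :
  1 <= y -> 0 <= al -> 0 <= al' -> 0 <= K -> 0 <= K' ->
  Rabs (x - al * Rpower y s) <= K * Rpower y (s - 1) ->
  Rabs (x' - al' * Rpower y s') <= K' * Rpower y (s' - 1) ->
  Rabs (x * x' - al * al' * Rpower y (s + s'))
    <= (al * K' + al' * K + K * K') * Rpower y (s + s' - 1).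
Proof.
  intros Hy Hal Hal' HK HK' Hx Hx'.
  set (u := x - al * Rpower y s) in *. set (u' := x' - al' * Rpower y s') in *.
  assert (E : x * x' - al * al' * Rpower y (s + s')
    = al * Rpower y s * u' + al' * Rpower y s' * u + u * u').
  { unfold u, u'. rewrite Rpower_plus. ring. }
  rewrite E.
  assert (Hmixed : forall a v L r r', 0 <= a -> Rabs v <= L * Rpower y (r' - 1) ->
    Rabs (a * Rpower y r * v) <= a * L * Rpower y (r + r' - 1)).
  { intros a v L r r' Ha Hv. replace (r + r' - 1) with (r + (r' - 1)) by ring.
    rewrite (Rpower_plus r).
    replace (a * L * (Rpower y r * Rpower y (r' - 1)))
      with (a * Rpower y r * (L * Rpower y (r' - 1))) by ring.
    apply Rabs_scal_le; [|exact Hv]. apply Rmult_le_pos; [exact Ha|apply Rpower_nneg]. }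
  pose proof (Hmixed al u' K' s s' Hal Hx') as H1.
  pose proof (Hmixed al' u K s' s Hal' Hx) as H2. rewrite (Rplus_comm s' s) in H2.
  assert (H3 : Rabs (u * u') <= K * K' * Rpower y (s + s' - 1)).
  { rewrite Rabs_mult.
    apply Rle_trans with (K * Rpower y (s - 1) * (K' * Rpower y (s' - 1))).
    - apply Rmult_le_compat; try apply Rabs_pos; assumption.
    - replace (K * Rpower y (s - 1) * (K' * Rpower y (s' - 1)))
        with (K * K' * (Rpower y (s - 1) * Rpower y (s' - 1))) by ring.
      apply Rmult_le_compat_l; [apply Rmult_le_pos; assumption|].
      rewrite <- Rpower_plus. apply Rle_Rpower; lra. }
  eapply Rle_trans; [apply Rabs_triang|].
  eapply Rle_trans; [apply Rplus_le_compat_r, Rabs_triang|]. lra.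
Qed.

(** The summand of the diagonal sum with V = y^(B+C) and nu = 1/theta. The exponent (1+B)/2 is
    written p + 1 with p = (B-1)/2, the form in which [cutoff_power_sum] takes it. *)
Definition lattice_term (B C nu y : R) (m k : nat) : R :=
  Rpower (INR m) (- ((B - 1) / 2 + 1)) * Rpower (INR k) (- ((C - 1) / 2 + 1))
  * cutoff nu (Rpower (INR m) B * Rpower (INR k) C / Rpower y (B + C)).

Lemma lattice_term_sym (B C nu y : R) (m k : nat) :
  lattice_term B C nu y m k = lattice_term C B nu y k m.
Proof.
  unfold lattice_term. rewrite (Rplus_comm C B).
  rewrite (Rmult_comm (Rpower (INR k) C)). ring.
Qed.

(** The constant 1/p + 1/p' of [cutoff_power_sum] for p = (B-1)/2 and p + p' = B nu. *)
Definition main_coef (B nu : R) : R := 1 / ((B - 1) / 2) + 1 / (B * nu - (B - 1) / 2).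

Definition power_sum (a : R) (N : nat) : R := rsum (fun k => Rpower (INR k) (- a)) N.

(** For fixed k the sum over m is a cut-off power sum of length M k = y^((B+C)/B) k^(-C/B), and k <=
    y ensures M k >= y >= 1. Its secondary term M^(-p) k^(-(q+1)) is a power of y times k^(-(1/2 +
    C/(2B))); the errors M^(-(p+1)) k^(-(q+1)) add up to O(y^(-(B+C)/2)), that is O(V^(-1/2)). *)
Lemma lattice_side_sum (B C nu : R) :
  2 <= B -> 2 <= C -> 1 < nu ->
  exists K, 0 <= K /\ forall y Y X, 1 <= y -> INR Y <= y < INR Y + 1 ->
    Rpower y (B + C) <= INR X ->
    Rabs (rsum (fun k => rsum (fun m => lattice_term B C nu y m k) X) Y
      - (zeta_real ((B - 1) / 2 + 1) * power_sum ((C - 1) / 2 + 1) Y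
         - main_coef B nu * Rpower y (- ((B + C) / B * ((B - 1) / 2)))
           * power_sum (1 / 2 + C / (2 * B)) Y))
    <= K * Rpower y (- ((B + C) / 2)).
Proof.
  intros HB HC Hnu.
  set (p := (B - 1) / 2). set (q := (C - 1) / 2). set (p' := B * nu - p).
  (* Since nu > 1, p' exceeds B - (B-1)/2 = (B+1)/2. *)
  assert (Hp' : 1 < p') by (unfold p', p; nra).
  destruct (cutoff_power_sum p p') as [K [HK0 HK]]; [unfold p; lra|assumption|].
  exists (K * 2). split; [lra|]. intros y Y X Hy HY HX.
  (* The solution m of m^B k^C = y^(B+C). *)
  set (M := fun k : nat => Rpower y ((B + C) / B) * Rpower (INR k) (- (C / B))).
  assert (HCB : 0 < C / B) by (apply Rdiv_lt_0_compat; lra).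
  assert (Hterm : forall k, (1 <= k <= Y)%nat ->
    rsum (fun m => lattice_term B C nu y m k) X
    = Rpower (INR k) (- (q + 1)) * rsum (fun m => Rpower (INR m) (- (p + 1))
        * cutoff (p + p') (INR m / M k)) X).
  { intros k Hk. rewrite <- rsum_scal. apply rsum_ext. intros m Hm.
    assert (Hk0 : 0 < INR k) by (apply INR_pos; lia).
    assert (Hm0 : 0 < INR m) by (apply INR_pos; lia).
    assert (HM0 : 0 < M k) by (apply Rmult_lt_0_compat; apply Rpower_pos).
    unfold lattice_term. fold p q.
    replace (Rpower (INR m) B * Rpower (INR k) C / Rpower y (B + C))
      with (Rpower (INR m / M k) B).
    - rewrite cutoff_power by (try apply Rdiv_lt_0_compat; lra).
      replace (B * nu) with (p + p') by (unfold p'; ring). ring.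
    - unfold Rdiv. rewrite <- Rpower_mult_distr by (try apply Rinv_0_lt_compat; assumption).
      rewrite Rmult_assoc. f_equal. unfold M, Rpower.
      rewrite ln_Rinv, ln_mult, !ln_exp, <- !exp_Ropp, <- exp_plus
        by (try apply Rmult_lt_0_compat; apply exp_pos).
      f_equal. field. lra. }
  rewrite (rsum_ext _ _ _ Hterm).
  assert (HM : forall k, (1 <= k <= Y)%nat -> 1 <= M k <= INR X).
  { intros k Hk. assert (Hk1 : 1 <= INR k) by (apply INR_ge_1; lia).
    assert (Hky : INR k <= y) by (apply Rle_trans with (INR Y); [apply le_INR; lia|lra]).
    unfold M. split.
    - apply Rle_trans with (Rpower y ((B + C) / B) * Rpower y (- (C / B))).
      + rewrite <- Rpower_plus. replace ((B + C) / B + - (C / B)) with 1 by (field; lra).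
        rewrite Rpower_1; lra.
      + apply Rmult_le_compat_l; [apply Rpower_nneg|]. apply Rpower_neg_antitone; lra.
    - eapply Rle_trans; [|exact HX].
      apply Rle_trans with (Rpower y ((B + C) / B) * 1).
      + apply Rmult_le_compat_l; [apply Rpower_nneg|].
        rewrite <- (Rpower_O (INR k)) by lra. apply Rle_Rpower; lra.
      + rewrite Rmult_1_r. apply Rle_Rpower; [assumption|].
        apply (Rmult_le_reg_r B); [lra|]. replace ((B + C) / B * B) with (B + C) by (field; lra).
        nra. }
  assert (HMp : forall k e, (1 <= k <= Y)%nat ->
    Rpower (M k) (- e) = Rpower y (- ((B + C) / B * e)) * Rpower (INR k) (C / B * e)).
  { intros k e Hk. unfold M. rewrite <- Rpower_mult_distr by apply Rpower_pos.
    rewrite !Rpower_mult. f_equal; f_equal; ring. }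
  set (G := main_coef B nu).
  assert (HGe : G = 1 / p + 1 / p') by reflexivity.
  replace (zeta_real (p + 1) * power_sum (q + 1) Y
         - G * Rpower y (- ((B + C) / B * p)) * power_sum (1 / 2 + C / (2 * B)) Y)
    with (rsum (fun k => Rpower (INR k) (- (q + 1))
            * (zeta_real (p + 1) - G * Rpower (M k) (- p))) Y).
  - rewrite <- rsum_minus.
    eapply Rle_trans; [apply Rabs_rsum_le|].
    apply Rle_trans with (rsum (fun k => (K * Rpower y (- ((B + C) / B * (p + 1))))
      * Rpower (INR k) (- (1 / 2) + C / (2 * B))) Y).
    + apply rsum_le. intros k Hk. rewrite <- Rmult_minus_distr_l, Rabs_mult.
      rewrite Rabs_pos_eq by (apply Rpower_nneg).
      apply Rle_trans with (Rpower (INR k) (- (q + 1)) * (K * Rpower (M k) (- (p + 1)))).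
      * apply Rmult_le_compat_l; [apply Rpower_nneg|]. rewrite HGe. apply HK, HM, Hk.
      * right. rewrite HMp by assumption.
        replace (- (1 / 2) + C / (2 * B)) with (- (q + 1) + C / B * (p + 1))
          by (unfold p, q; field; lra).
        rewrite (Rpower_plus (- (q + 1))). ring.
    + rewrite rsum_scal.
      apply Rle_trans with (K * Rpower y (- ((B + C) / B * (p + 1)))
        * (2 * Rpower y (- (1 / 2) + C / (2 * B) + 1))).
      * apply Rmult_le_compat_l; [apply Rmult_le_pos; [assumption|apply Rpower_nneg]|].
        apply power_sum_upper; [|assumption|lra].
        assert (0 < C / (2 * B)) by (apply Rdiv_lt_0_compat; lra). lra.
      * right. replace (- ((B + C) / 2)) with (- ((B + C) / B * (p + 1))
          + (- (1 / 2) + C / (2 * B) + 1)) by (unfold p; field; lra).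
        rewrite (Rpower_plus (- ((B + C) / B * (p + 1)))). ring.
  - unfold power_sum. rewrite <- !rsum_scal, <- rsum_minus. apply rsum_ext. intros k Hk.
    rewrite HMp by assumption.
    replace (- (1 / 2 + C / (2 * B))) with (- (q + 1) + C / B * p) by (unfold p, q; field; lra).
    rewrite (Rpower_plus (- (q + 1))). ring.
Qed.

(** Inside the square the cut-off is given by its formula 1 - x^nu, and both of its parts factor
    into a function of m times a function of k. *)
Lemma lattice_term_small (B C nu y : R) (m k : nat) :
  0 < B -> 0 < C -> (1 <= m)%nat -> (1 <= k)%nat -> INR m <= y -> INR k <= y ->
  lattice_term B C nu y m k
  = Rpower (INR m) (- ((B - 1) / 2 + 1)) * Rpower (INR k) (- ((C - 1) / 2 + 1))
    - Rpower y (- ((B + C) * nu)) * (Rpower (INR m) (- (1 - (B * nu - (B - 1) / 2)))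
        * Rpower (INR k) (- (1 - (C * nu - (C - 1) / 2)))).
Proof.
  intros HB HC Hm Hk Hmy Hky. apply INR_pos in Hm. apply INR_pos in Hk.
  unfold lattice_term, cutoff.
  assert (H0 : 0 < / Rpower y (B + C)) by apply Rinv_0_lt_compat, Rpower_pos.
  destruct (Rle_dec (Rpower (INR m) B * Rpower (INR k) C / Rpower y (B + C)) 1) as [H|H].
  - replace (- (1 - (B * nu - (B - 1) / 2))) with (- ((B - 1) / 2 + 1) + B * nu) by field.
    replace (- (1 - (C * nu - (C - 1) / 2))) with (- ((C - 1) / 2 + 1) + C * nu) by field.
    rewrite (Rpower_plus (- ((B - 1) / 2 + 1))), (Rpower_plus (- ((C - 1) / 2 + 1))).
    unfold Rdiv at 3. rewrite <- !Rpower_mult_distr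
      by (try apply Rmult_lt_0_compat; try apply Rpower_pos; assumption).
    rewrite !Rpower_mult.
    replace (Rpower (/ Rpower y (B + C)) nu) with (Rpower y (- ((B + C) * nu))); [ring|].
    rewrite <- Rpower_Ropp, Rpower_mult. f_equal. ring.
  - exfalso. apply H, div_le_1; [apply Rpower_pos|]. rewrite Rpower_plus.
    apply Rmult_le_compat; try apply Rpower_nneg; apply Rle_Rpower_l; lra.
Qed.

Lemma lattice_term_large (B C nu y : R) (m k : nat) :
  0 < B -> 0 < C -> 0 < y -> y < INR m -> y < INR k -> lattice_term B C nu y m k = 0.
Proof.
  intros HB HC Hy Hm Hk. unfold lattice_term, cutoff.
  destruct (Rle_dec (Rpower (INR m) B * Rpower (INR k) C / Rpower y (B + C)) 1) as [H|H]; [|ring].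
  exfalso. apply (Rmult_le_compat_r (Rpower y (B + C))) in H; [|apply Rpower_nneg].
  unfold Rdiv in H. rewrite Rmult_assoc, Rinv_l in H by (pose proof (Rpower_pos y (B + C)); lra).
  rewrite Rmult_1_r, Rmult_1_l, Rpower_plus in H.
  assert (H1 : Rpower y B < Rpower (INR m) B) by (apply Rlt_Rpower_l; lra).
  assert (H2 : Rpower y C < Rpower (INR k) C) by (apply Rlt_Rpower_l; lra).
  pose proof (Rpower_pos y B). pose proof (Rpower_pos y C). nra.
Qed.

Lemma rsum_product (f g : nat -> R) (n p : nat) :
  rsum (fun m => rsum (fun k => f m * g k) p) n = rsum f n * rsum g p.
Proof.
  rewrite (rsum_ext _ (fun m => rsum g p * f m)).
  - rewrite rsum_scal. ring.
  - intros m _. rewrite rsum_scal. ring.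
Qed.

(* Dirichlet's hyperbola method at m, k <= y, where the cut-off variable m^B k^C / y^(B+C)
   equals 1 at the corner m = k = y. *)
Lemma lattice_sum_hyperbola (B C nu : R) :
  2 <= B -> 2 <= C -> 1 < nu ->
  let p := (B - 1) / 2 in let q := (C - 1) / 2 in
  exists K, 0 <= K /\ forall y Y X, 1 <= y -> INR Y <= y < INR Y + 1 ->
    Rpower y (B + C) <= INR X ->
    Rabs (rsum (fun m => rsum (lattice_term B C nu y m) X) X
      - (zeta_real (p + 1) * zeta_real (q + 1)
         - (1 / (p * q) - 1 / ((B * nu - p) * (C * nu - q))) * Rpower y (- (p + q))
         - main_coef B nu * Rpower y (- ((B + C) / B * p)) * power_sum (1 / 2 + C / (2 * B)) Y
         - main_coef C nu * Rpower y (- ((B + C) / C * q)) * power_sum (1 / 2 + B / (2 * C)) Y))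
    <= K * Rpower y (- ((B + C) / 2)).
Proof.
  intros HB HC Hnu p q.
  set (p' := B * nu - p). set (q' := C * nu - q).
  assert (Hp : 0 < p) by (unfold p; lra). assert (Hq : 0 < q) by (unfold q; lra).
  assert (Hp' : 1 < p') by (unfold p', p; nra). assert (Hq' : 1 < q') by (unfold q', q; nra).
  destruct (lattice_side_sum B C nu HB HC Hnu) as [K1 [HK1 HS1]].
  destruct (lattice_side_sum C B nu HC HB Hnu) as [K2 [HK2 HS2]].
  destruct (power_sum_zeta (p + 1)) as [K3 [HK3 HZ3]]; [lra|lra|].
  destruct (power_sum_zeta (q + 1)) as [K4 [HK4 HZ4]]; [lra|lra|].
  assert (Hip : 0 < 1 / p) by (apply Rdiv_lt_0_compat; lra).
  assert (Hiq : 0 < 1 / q) by (apply Rdiv_lt_0_compat; lra).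
  assert (Hip' : 0 < 1 / p') by (apply Rdiv_lt_0_compat; lra).
  assert (Hiq' : 0 < 1 / q') by (apply Rdiv_lt_0_compat; lra).
  set (K5 := 1 / p * K4 + 1 / q * K3 + K3 * K4).
  set (K6 := 1 / p' * 1 + 1 / q' * 1 + 1 * 1).
  assert (HK5 : 0 <= K5).
  { unfold K5. pose proof (Rmult_le_pos _ _ (Rlt_le _ _ Hip) HK4).
    pose proof (Rmult_le_pos _ _ (Rlt_le _ _ Hiq) HK3).
    pose proof (Rmult_le_pos _ _ HK3 HK4). lra. }
  exists (K1 + K2 + K5 + K6). split; [unfold K6; lra|].
  intros y Y X Hy HY HX.
  assert (HYX : (Y <= X)%nat).
  { apply INR_le. apply Rle_trans with (Rpower y 1); [rewrite Rpower_1; lra|].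
    eapply Rle_trans; [|exact HX]. apply Rle_Rpower; lra. }
  assert (HYy : forall m, (1 <= m <= Y)%nat -> INR m <= y).
  { intros m Hm. apply Rle_trans with (INR Y); [apply le_INR; lia|lra]. }
  assert (HYy' : forall m, (Y < m)%nat -> y < INR m).
  { intros m Hm. apply Rlt_le_trans with (INR (S Y)); [rewrite S_INR; lra|apply le_INR; lia]. }
  rewrite (rsum_square_split _ Y X HYX).
  2:{ intros m k Hm Hk. apply lattice_term_large; try lra; apply HYy'; assumption. }
  specialize (HS1 y Y X Hy HY HX).
  rewrite (Rplus_comm C B) in HS2. specialize (HS2 y Y X Hy HY HX).
  rewrite (rsum_ext (fun k => rsum (fun m => lattice_term C B nu y m k) X)
    (fun k => rsum (lattice_term B C nu y k) X)) in HS2.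
  2:{ intros k _. apply rsum_ext. intros m _. apply lattice_term_sym. }
  fold p q in HS1, HS2.
  assert (Hsq : rsum (fun m => rsum (lattice_term B C nu y m) Y) Y
    = power_sum (p + 1) Y * power_sum (q + 1) Y
      - Rpower y (- ((B + C) * nu)) * (power_sum (1 - p') Y * power_sum (1 - q') Y)).
  { unfold power_sum. rewrite <- !rsum_product, <- rsum_scal, <- rsum_minus.
    apply rsum_ext. intros m Hm. rewrite <- rsum_scal, <- rsum_minus.
    apply rsum_ext. intros k Hk.
    apply lattice_term_small; try lra; try lia; apply HYy; assumption. }
  rewrite Hsq.
  specialize (HZ3 y Y Hy HY). specialize (HZ4 y Y Hy HY).
  fold (power_sum (p + 1) Y) in HZ3. fold (power_sum (q + 1) Y) in HZ4.
  replace (1 - (p + 1)) with (- p) in HZ3 by ring.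
  replace (1 - (q + 1)) with (- q) in HZ4 by ring.
  (* With P and Q the partial sums for p + 1 and q + 1, the two sides minus the square give
     zeta(p+1) Q + zeta(q+1) P - P Q, which equals zeta(p+1) zeta(q+1) - (zeta(p+1) - P)(zeta(q+1) -
     Q). Only this product of tails has to be expanded. *)
  assert (H5 : Rabs ((zeta_real (p + 1) - power_sum (p + 1) Y)
     * (zeta_real (q + 1) - power_sum (q + 1) Y) - 1 / p * (1 / q) * Rpower y (- p + - q))
    <= K5 * Rpower y (- p + - q - 1)).
  { apply product_power_asymptotic; try lra.
    - rewrite Rabs_minus_sym in HZ3. replace (- p - 1) with (- (p + 1)) by ring.
      replace (zeta_real (p + 1) - power_sum (p + 1) Y - 1 / p * Rpower y (- p))
        with (zeta_real (p + 1) + Rpower y (- p) / - p - power_sum (p + 1) Y) by (field; lra).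
      exact HZ3.
    - rewrite Rabs_minus_sym in HZ4. replace (- q - 1) with (- (q + 1)) by ring.
      replace (zeta_real (q + 1) - power_sum (q + 1) Y - 1 / q * Rpower y (- q))
        with (zeta_real (q + 1) + Rpower y (- q) / - q - power_sum (q + 1) Y) by (field; lra).
      exact HZ4. }
  assert (Hgrow : forall r, 1 < r ->
    Rabs (power_sum (1 - r) Y - 1 / r * Rpower y r) <= 1 * Rpower y (r - 1)).
  { intros r Hr. pose proof (power_sum_growing (r - 1) ltac:(lra) y Y Hy HY) as H.
    replace (r - 1 + 1) with r in H by ring. unfold power_sum.
    rewrite (rsum_ext _ (fun k => Rpower (INR k) (r - 1))) by (intros; f_equal; ring).
    rewrite Rmult_1_l. replace (1 / r * Rpower y r) with (Rpower y r / r) by (field; lra).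
    exact H. }
  (* The part of the square coming from the subtracted power in the cut-off; it supplies the term
     1/(p' q') of the corner coefficient. *)
  assert (H6 : Rabs (power_sum (1 - p') Y * power_sum (1 - q') Y
      - 1 / p' * (1 / q') * Rpower y (p' + q')) <= K6 * Rpower y (p' + q' - 1)).
  { apply product_power_asymptotic; try lra; apply Hgrow; assumption. }
  apply (Rabs_scal_le (Rpower y (- ((B + C) * nu)))) in H6; [|apply Rpower_nneg].
  replace (Rpower y (- ((B + C) * nu)) * (K6 * Rpower y (p' + q' - 1)))
    with (K6 * Rpower y (- ((B + C) / 2))) in H6.
  2:{ replace (- ((B + C) / 2)) with (- ((B + C) * nu) + (p' + q' - 1))
        by (unfold p', q', p, q; field).
      rewrite (Rpower_plus (- ((B + C) * nu))). ring. }
  replace (- p + - q - 1) with (- ((B + C) / 2)) in H5 by (unfold p, q; field).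
  replace (- p + - q) with (- (p + q)) in H5 by ring.
  rewrite Rmult_minus_distr_l in H6.
  replace (Rpower y (- ((B + C) * nu)) * (1 / p' * (1 / q') * Rpower y (p' + q')))
    with (1 / (p' * q') * Rpower y (- (p + q))) in H6.
  2:{ replace (- (p + q)) with (- ((B + C) * nu) + (p' + q')) by (unfold p', q'; ring).
      rewrite (Rpower_plus (- ((B + C) * nu))). field. lra. }
  replace (1 / p * (1 / q)) with (1 / (p * q)) in H5 by (field; lra).
  apply Rabs_le_between in HS1. apply Rabs_le_between in HS2.
  apply Rabs_le_between in H5. apply Rabs_le_between in H6.
  apply Rabs_le. lra.
Qed.

(** As B <> C, the exponents 1/2 + C/(2B) and 1/2 + B/(2C) differ from 1, and each remaining partial
    sum is a zeta value plus a power of y. These powers, multiplied by their prefactors, are all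
    y^(-(p+q)), the order of the corner term. *)
Lemma lattice_sum_distinct (B C nu : R) :
  2 <= B -> 2 <= C -> B <> C -> 1 < nu ->
  let p := (B - 1) / 2 in let q := (C - 1) / 2 in
  exists K, 0 <= K /\ forall y X, 1 <= y -> Rpower y (B + C) <= INR X ->
    Rabs (rsum (fun m => rsum (lattice_term B C nu y m) X) X
      - (zeta_real (p + 1) * zeta_real (q + 1)
         - main_coef B nu * Rpower y (- ((B + C) / B * p)) * zeta_real (1 / 2 + C / (2 * B))
         - main_coef C nu * Rpower y (- ((B + C) / C * q)) * zeta_real (1 / 2 + B / (2 * C))))
    <= K * Rpower y (- ((B + C) / 2)).
Proof.
  intros HB HC HBC Hnu p q.
  destruct (lattice_sum_hyperbola B C nu HB HC Hnu) as [K [HK0 HK]]. fold p q in HK.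
  assert (H1 : 0 < C / (2 * B)) by (apply Rdiv_lt_0_compat; lra).
  assert (H2 : 0 < B / (2 * C)) by (apply Rdiv_lt_0_compat; lra).
  assert (E1 : 1 - (1 / 2 + C / (2 * B)) = (B - C) / (2 * B)) by (field; lra).
  assert (E2 : 1 - (1 / 2 + B / (2 * C)) = (C - B) / (2 * C)) by (field; lra).
  assert (N1 : (B - C) / (2 * B) <> 0).
  { unfold Rdiv. apply Rmult_integral_contrapositive. split; [lra|apply Rinv_neq_0_compat; lra]. }
  assert (N2 : (C - B) / (2 * C) <> 0).
  { unfold Rdiv. apply Rmult_integral_contrapositive. split; [lra|apply Rinv_neq_0_compat; lra]. }
  destruct (power_sum_zeta (1 / 2 + C / (2 * B))) as [K1 [HK1 HZ1]]; [lra|lra|].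
  destruct (power_sum_zeta (1 / 2 + B / (2 * C))) as [K2 [HK2 HZ2]]; [lra|lra|].
  set (Gb := main_coef B nu) in *. set (Gc := main_coef C nu) in *.
  assert (Hp : 0 < p) by (unfold p; lra). assert (Hq : 0 < q) by (unfold q; lra).
  assert (Hp' : 0 < B * nu - p) by (unfold p; nra).
  assert (Hq' : 0 < C * nu - q) by (unfold q; nra).
  assert (HGb : 0 < Gb).
  { unfold Gb, main_coef. fold p. apply Rplus_lt_0_compat; apply Rdiv_lt_0_compat; lra. }
  assert (HGc : 0 < Gc).
  { unfold Gc, main_coef. fold q. apply Rplus_lt_0_compat; apply Rdiv_lt_0_compat; lra. }
  exists (K + Gb * K1 + Gc * K2). split.
  { pose proof (Rmult_le_pos _ _ (Rlt_le _ _ HGb) HK1).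
    pose proof (Rmult_le_pos _ _ (Rlt_le _ _ HGc) HK2). lra. }
  intros y X Hy HX. destruct (real_floor y Hy) as [Y HY].
  specialize (HK y Y X Hy HY HX). specialize (HZ1 y Y Hy HY). specialize (HZ2 y Y Hy HY).
  fold (power_sum (1 / 2 + C / (2 * B)) Y) in HZ1. fold (power_sum (1 / 2 + B / (2 * C)) Y) in HZ2.
  rewrite E1 in HZ1. rewrite E2 in HZ2.
  set (Ub := Rpower y (- ((B + C) / B * p))) in *. set (Uc := Rpower y (- ((B + C) / C * q))) in *.
  assert (HUb : 0 < Ub) by apply Rpower_pos. assert (HUc : 0 < Uc) by apply Rpower_pos.
  assert (F1 : Ub * Rpower y ((B - C) / (2 * B)) = Rpower y (- (p + q))).
  { unfold Ub. rewrite <- Rpower_plus. f_equal. unfold p, q. field. lra. }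
  assert (F2 : Uc * Rpower y ((C - B) / (2 * C)) = Rpower y (- (p + q))).
  { unfold Uc. rewrite <- Rpower_plus. f_equal. unfold p, q. field. lra. }
  assert (F3 : Ub * Rpower y (- (1 / 2 + C / (2 * B))) = Rpower y (- ((B + C) / 2))).
  { unfold Ub. rewrite <- Rpower_plus. f_equal. unfold p. field. lra. }
  assert (F4 : Uc * Rpower y (- (1 / 2 + B / (2 * C))) = Rpower y (- ((B + C) / 2))).
  { unfold Uc. rewrite <- Rpower_plus. f_equal. unfold q. field. lra. }
  set (Q1 := power_sum (1 / 2 + C / (2 * B)) Y) in *.
  set (Q2 := power_sum (1 / 2 + B / (2 * C)) Y) in *.
  apply (Rabs_scal_le (Gb * Ub)) in HZ1; [|apply Rmult_le_pos; lra].
  apply (Rabs_scal_le (Gc * Uc)) in HZ2; [|apply Rmult_le_pos; lra].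
  replace (Gb * Ub * (K1 * Rpower y (- (1 / 2 + C / (2 * B)))))
    with (Gb * K1 * Rpower y (- ((B + C) / 2))) in HZ1 by (rewrite <- F3; ring).
  replace (Gc * Uc * (K2 * Rpower y (- (1 / 2 + B / (2 * C)))))
    with (Gc * K2 * Rpower y (- ((B + C) / 2))) in HZ2 by (rewrite <- F4; ring).
  set (E := Rpower y (- (p + q))) in *.
  (* Cutting at m, k = y is artificial, and its boundary contributions cancel identically. *)
  assert (Hcancel : (1 / (p * q) - 1 / ((B * nu - p) * (C * nu - q))) * E
    + Gb * Ub * (Rpower y ((B - C) / (2 * B)) / ((B - C) / (2 * B)))
    + Gc * Uc * (Rpower y ((C - B) / (2 * C)) / ((C - B) / (2 * C))) = 0).
  { replace (Gb * Ub * (Rpower y ((B - C) / (2 * B)) / ((B - C) / (2 * B))))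
      with (Gb * (Ub * Rpower y ((B - C) / (2 * B))) / ((B - C) / (2 * B))) by (field; lra).
    replace (Gc * Uc * (Rpower y ((C - B) / (2 * C)) / ((C - B) / (2 * C))))
      with (Gc * (Uc * Rpower y ((C - B) / (2 * C))) / ((C - B) / (2 * C))) by (field; lra).
    rewrite F1, F2. unfold Gb, Gc, main_coef, p, q in *. field. repeat split; try lra. }
  apply Rabs_le_between in HK. apply Rabs_le_between in HZ1. apply Rabs_le_between in HZ2.
  apply Rabs_le. lra.
Qed.

(** For B = C the exponent 1/2 + C/(2B) is 1, so both remaining partial sums are harmonic and
    contribute gamma + ln y; the corner term survives. *)
Lemma lattice_sum_equal (B nu : R) :
  2 <= B -> 1 < nu ->
  let p := (B - 1) / 2 in
  exists K, 0 <= K /\ forall y X, 1 <= y -> Rpower y (B + B) <= INR X ->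
    Rabs (rsum (fun m => rsum (lattice_term B B nu y m) X) X
      - (zeta_real (p + 1) * zeta_real (p + 1)
         - (1 / (p * p) - 1 / ((B * nu - p) * (B * nu - p))
            + 2 * main_coef B nu * (euler_gamma + ln y)) * Rpower y (- (p + p))))
    <= K * Rpower y (- ((B + B) / 2)).
Proof.
  intros HB Hnu p.
  destruct (lattice_sum_hyperbola B B nu HB HB Hnu) as [K [HK0 HK]]. fold p in HK.
  set (G := main_coef B nu) in *.
  assert (Hp : 0 < p) by (unfold p; lra).
  assert (Hp' : 0 < B * nu - p) by (unfold p; nra).
  assert (HG : 0 < G).
  { unfold G, main_coef. fold p. apply Rplus_lt_0_compat; apply Rdiv_lt_0_compat; lra. }
  exists (K + 8 * G). split; [lra|].
  intros y X Hy HX. destruct (real_floor y Hy) as [Y HY].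
  specialize (HK y Y X Hy HY HX).
  pose proof (harmonic_euler_gamma y Y Hy HY) as HZ.
  replace (harmonic Y) with (power_sum (1 / 2 + B / (2 * B)) Y) in HZ.
  2:{ unfold harmonic, power_sum. apply rsum_ext. intros k Hk.
      replace (1 / 2 + B / (2 * B)) with 1 by (field; lra).
      rewrite Rpower_Ropp, Rpower_1; [reflexivity|apply INR_pos; lia]. }
  set (Q := power_sum (1 / 2 + B / (2 * B)) Y) in *.
  replace ((B + B) / B * p) with (p + p) in HK by (field; lra).
  set (U := Rpower y (- (p + p))) in *.
  assert (HU : 0 < U) by apply Rpower_pos.
  assert (F : U * / y = Rpower y (- ((B + B) / 2))).
  { unfold U. rewrite <- (Rpower_1 y) at 2 by lra. rewrite <- Rpower_Ropp, <- Rpower_plus.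
    f_equal. unfold p. field. }
  apply (Rabs_scal_le (2 * G * U)) in HZ; [|apply Rmult_le_pos; lra].
  replace (2 * G * U * (4 * / y)) with (8 * G * Rpower y (- ((B + B) / 2))) in HZ
    by (rewrite <- F; ring).
  apply Rabs_le_between in HK. apply Rabs_le_between in HZ. apply Rabs_le. lra.
Qed.

(** * The mean value as a sum of integrals *)

(** On the critical line |2^(1-s)| = sqrt 2, so 2^(1-s) <> 1 also at t = 0; the constant comes from
    |s| / Re s <= 1 + 2 b t. *)
Lemma zeta_critical_zapprox (b t : R) (X : nat) :
  0 <= b -> 0 <= t -> (1 <= X)%nat ->
  Cmod (zeta ((1 / 2)%R, (- (b * t))%R) - zapprox X ((1 / 2)%R, (- (b * t))%R))
    <= (1 + 2 * (b * t)) * / sqrt (INR X).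
Proof.
  intros Hb Ht HX. set (s := ((1 / 2)%R, (- (b * t))%R) : C).
  assert (Hre : Re s = 1 / 2) by reflexivity.
  assert (Hbt : 0 <= b * t) by (apply Rmult_le_pos; assumption).
  eapply Rle_trans; [apply (zeta_zapprox s X)|]; rewrite ?Hre; [lra| |assumption|].
  - intros E. apply (f_equal Cmod) in E. rewrite Cmod_cpow, Cmod_1 in E.
    unfold s in E. simpl in E. replace (1 + - (1 / 2)) with (1 / 2) in E by lra.
    rewrite Rpower_half in E by lra.
    pose proof sqrt_2_ge.
    lra.
  - rewrite Rpower_Ropp, Rpower_half by (apply INR_pos, HX).
    apply Rmult_le_compat_r; [left; apply Rinv_0_lt_compat, sqrt_lt_R0, INR_pos, HX|].
    pose proof (Cmod_le_Rabs s) as H. unfold s in H at 2 3. simpl in H.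
    rewrite Rabs_Ropp, !Rabs_pos_eq in H by lra. lra.
Qed.

Lemma ccontinuous_uniform_limit (f : R -> C) (g : nat -> R -> C) (t0 : R) :
  (forall n, ccontinuous (g n) t0) ->
  (forall eps, 0 < eps -> exists n d, 0 < d /\
     forall t, Rabs (t - t0) < d -> Cmod (f t - g n t) <= eps) ->
  ccontinuous f t0.
Proof.
  intros Hg Hlim.
  assert (H : forall p : C -> R, (forall z w, Rabs (p z - p w) <= Cmod (z - w)%C) ->
    (forall n, continuous (fun t => p (g n t)) t0) -> continuous (fun t => p (f t)) t0).
  { intros p Hp Hc. apply filterlim_locally. intros eps.
    assert (He : 0 < eps / 4) by (pose proof (cond_pos eps); lra).
    destruct (Hlim (eps / 4) He) as [n [d [Hd Hn]]].
    destruct (proj1 (filterlim_locally _ _) (Hc n) (mkposreal _ He)) as [d' Hd'].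
    assert (Hm : 0 < Rmin d d') by (apply Rmin_pos; [exact Hd|apply cond_pos]).
    exists (mkposreal _ Hm). intros t Ht.
    assert (Ht1 : Rabs (t - t0) < Rmin d d') by exact Ht.
    assert (Htd : Rabs (t - t0) < d) by (eapply Rlt_le_trans; [exact Ht1|apply Rmin_l]).
    assert (Htd' : Rabs (t - t0) < d') by (eapply Rlt_le_trans; [exact Ht1|apply Rmin_r]).
    assert (H1 : Rabs (p (g n t) - p (g n t0)) < eps / 4) by exact (Hd' t Htd').
    pose proof (Rle_trans _ _ _ (Hp _ _) (Hn t Htd)) as H2.
    assert (H0 : Rabs (t0 - t0) < d) by (rewrite Rminus_diag, Rabs_R0; exact Hd).
    pose proof (Rle_trans _ _ _ (Hp _ _) (Hn t0 H0)) as H3.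
    change (Rabs (p (f t) - p (f t0)) < eps).
    apply Rabs_lt_between in H1. apply Rabs_le_between in H2. apply Rabs_le_between in H3.
    apply Rabs_lt_between. lra. }
  split.
  - apply (H Re); [intros z w; apply (Rabs_Re_le (z - w))|intros n; apply Hg].
  - apply (H Im); [intros z w; apply (Rabs_Im_le (z - w))|intros n; apply Hg].
Qed.

Lemma inv_sqrt_small (eps : R) :
  0 < eps -> exists X, (1 <= X)%nat /\ / sqrt (INR X) < eps.
Proof.
  intros He. destruct (Rpower_INR_small (1 / 2) eps) as [X [H1 H2]]; [lra|exact He|].
  exists X. split; [exact H1|]. specialize (H2 X (le_n _)).
  rewrite Rpower_Ropp, Rpower_half in H2 by (apply INR_pos, H1). exact H2.
Qed.

(** Locally uniform limit of truncations: W bounds 1 + 2 b t for all t within t0 of t0. Continuity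
    is needed for the integrals of [critical_term] to exist. *)
Lemma zeta_critical_continuous (b t0 : R) :
  0 < b -> 0 < t0 -> ccontinuous (fun t => zeta ((1 / 2)%R, (- (b * t))%R)) t0.
Proof.
  intros Hb Ht0.
  apply (ccontinuous_uniform_limit _ (fun X t => zapprox X ((1 / 2)%R, (- (b * t))%R))).
  - intros X. assert (H : b <> 0) by lra.
    pose proof (holo_slice_continuous _ 0 t0 (holo_zapprox X b H) Ht0) as Hc. cbv beta in Hc.
    replace (1 / 2 + b * 0) with (1 / 2) in Hc by ring. exact Hc.
  - intros eps He. set (W := 1 + 2 * (b * (2 * t0))).
    assert (HW : 1 <= W) by (unfold W; nra).
    destruct (inv_sqrt_small (eps / W)) as [X [HX1 HX2]]; [apply Rdiv_lt_0_compat; lra|].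
    exists X, t0. split; [exact Ht0|]. intros t Ht.
    apply Rabs_lt_between' in Ht.
    eapply Rle_trans; [apply zeta_critical_zapprox; [lra|lra|exact HX1]|].
    apply Rle_trans with (W * (eps / W)); [|right; field; lra].
    apply Rmult_le_compat; [nra| |unfold W; nra|lra].
    left. apply Rinv_0_lt_compat, sqrt_lt_R0, INR_pos, HX1.
Qed.

Lemma ccontinuous_mult (f g : R -> C) (t : R) :
  ccontinuous f t -> ccontinuous g t -> ccontinuous (fun t => f t * g t)%C t.
Proof.
  intros [F1 F2] [G1 G2]; split.
  - apply (continuous_minus (fun t => Re (f t) * Re (g t)) (fun t => Im (f t) * Im (g t)));
      apply (continuous_mult (K := R_AbsRing)); assumption.
  - apply (continuous_plus (fun t => Re (f t) * Im (g t)) (fun t => Im (f t) * Re (g t)));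
      apply (continuous_mult (K := R_AbsRing)); assumption.
Qed.

Definition critical_term (b c n : nat) (t : R) : C :=
  (cpow (INR n) ((- (1 / 2))%R, (- t)%R)
   * (zeta ((1 / 2)%R, (- (INR b * t))%R) * zeta ((1 / 2)%R, (- (INR c * t))%R)))%C.

Lemma critical_term_continuous (b c n : nat) (t : R) :
  (1 <= b)%nat -> (1 <= c)%nat -> 0 < t -> ccontinuous (critical_term b c n) t.
Proof.
  intros Hb Hc Ht. apply ccontinuous_mult; [|apply ccontinuous_mult].
  - pose proof (holo_slice_continuous _ 0 t (holo_cpow (INR n) (- (1 / 2)) 1) Ht) as H.
    cbv beta in H. unfold ccontinuous in *.
    replace (- (1 / 2) + 1 * 0) with (- (1 / 2)) in H by ring.
    destruct H as [H1 H2]. split.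
    + eapply continuous_ext; [|exact H1]. intros x. simpl. rewrite Rmult_1_l. reflexivity.
    + eapply continuous_ext; [|exact H2]. intros x. simpl. rewrite Rmult_1_l. reflexivity.
  - apply zeta_critical_continuous; [apply INR_pos, Hb|exact Ht].
  - apply zeta_critical_continuous; [apply INR_pos, Hc|exact Ht].
Qed.

Lemma nat_floor_spec (x : R) : 0 <= x -> INR (nat_floor x) <= x < INR (nat_floor x) + 1.
Proof.
  intros Hx. unfold nat_floor. destruct (base_Int_part x) as [H1 H2].
  assert (Hz : (0 <= Int_part x)%Z).
  { apply Z.lt_succ_r. apply lt_IZR. rewrite succ_IZR. lra. }
  rewrite INR_IZR_INZ, Z2Nat.id by exact Hz. lra.
Qed.

Lemma le_nat_floor (x : R) (n : nat) : 0 <= x -> (n <= nat_floor x)%nat <-> INR n <= x.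
Proof.
  intros Hx. pose proof (nat_floor_spec x Hx) as H. split; intros Hn.
  - apply le_INR in Hn. lra.
  - apply Nat.lt_succ_r, INR_lt. rewrite S_INR. lra.
Qed.

(* The height at which the n-th term enters D_theta. *)
Definition entry_height (theta : R) (n : nat) : R := 2 * PI * Rpower (INR n) (1 / theta).

Lemma entry_height_le (theta t : R) (n : nat) :
  0 < theta -> 0 < t -> (1 <= n)%nat ->
  entry_height theta n <= t <-> INR n <= Rpower (t / (2 * PI)) theta.
Proof.
  intros Hth Ht Hn. pose proof PI_RGT_0 as HPI. unfold entry_height.
  assert (Hn0 : 0 < INR n) by (apply INR_pos, Hn).
  assert (Ht' : 0 < t / (2 * PI)) by (apply Rdiv_lt_0_compat; lra).
  split; intros H.
  - replace (INR n) with (Rpower (Rpower (INR n) (1 / theta)) theta).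
    + apply Rle_Rpower_l; [lra|]. split; [apply Rpower_pos|].
      apply (Rmult_le_reg_l (2 * PI)); [lra|].
      replace (2 * PI * (t / (2 * PI))) with t by (field; lra). exact H.
    + rewrite Rpower_mult. replace (1 / theta * theta) with 1 by (field; lra).
      apply Rpower_1, Hn0.
  - replace t with (2 * PI * Rpower (Rpower (t / (2 * PI)) theta) (1 / theta)).
    + apply Rmult_le_compat_l; [lra|]. apply Rle_Rpower_l; [|lra].
      left. apply Rdiv_lt_0_compat; lra.
    + rewrite Rpower_mult. replace (theta * (1 / theta)) with 1 by (field; lra).
      rewrite Rpower_1 by exact Ht'. field. lra.
Qed.

Lemma csum_zero_tail (f : nat -> C) (N X : nat) :
  (N <= X)%nat -> (forall m, (N < m <= X)%nat -> f m = RtoC 0) -> csum f X = csum f N.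
Proof.
  intros HNX. induction HNX as [|X HX IH]; intros Hf; [reflexivity|].
  cbn [csum]. rewrite IH, (Hf (S X)) by (try lia; intros; apply Hf; lia). ring.
Qed.

(** The length of [D_theta] jumps with t, so sum and integral cannot be exchanged directly; each
    term is integrated from the height at which it enters. *)
Lemma M1_sum_integrals (theta : R) (b c : nat) (T : R) (I : nat -> C) :
  0 < theta -> 0 < T ->
  (forall n, (1 <= n <= nat_floor (Rpower (T / (2 * PI)) theta))%nat ->
     is_CRInt (critical_term b c n) (entry_height theta n) T (I n)) ->
  M1 theta b c T = csum I (nat_floor (Rpower (T / (2 * PI)) theta)).
Proof.
  intros Hth HT HI. pose proof PI_RGT_0 as HPI.
  set (N := nat_floor (Rpower (T / (2 * PI)) theta)) in *.
  assert (Hpos : forall t, 0 <= Rpower (t / (2 * PI)) theta) by (intros; apply Rpower_nneg).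
  (* Extended by zero below its entry height, every term lives on all of [0, T], and the number of
     terms no longer depends on t. *)
  set (H := fun n t => if Rle_dec (entry_height theta n) t then critical_term b c n t else RtoC 0).
  unfold M1. apply is_CRInt_unique.
  apply (is_CRInt_ext (fun t => csum (fun n => H n t) N)); [lra| |].
  - intros t Ht.
    set (N' := nat_floor (Rpower (t / (2 * PI)) theta)).
    assert (HN' : (N' <= N)%nat).
    { apply le_nat_floor; [apply Hpos|].
      apply Rle_trans with (Rpower (t / (2 * PI)) theta); [apply nat_floor_spec, Hpos|].
      apply Rle_Rpower_l; [lra|]. split; [apply Rdiv_lt_0_compat; lra|].
      apply Rmult_le_compat_r; [left; apply Rinv_0_lt_compat; lra|lra]. }
    rewrite (csum_zero_tail _ N' N HN').
    + unfold D_theta. fold N'. rewrite csum_sum_n_m.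
      set (z := zeta ((1 / 2)%R, (- INR b * t)%R)). set (w := zeta ((1 / 2)%R, (- INR c * t)%R)).
      match goal with |- _ = (csum ?f N' * z * w)%C =>
        transitivity (csum (fun n => z * w * f n)%C N'); [|rewrite csum_scal; ring] end.
      apply csum_ext. intros n Hn. unfold H.
      destruct (Rle_dec (entry_height theta n) t) as [_|Hne].
      * unfold critical_term, z, w. rewrite !Ropp_mult_distr_l. ring.
      * exfalso. apply Hne, entry_height_le; try lra; try lia.
        apply le_nat_floor; [apply Hpos|]. apply Hn.
    + intros n Hn. unfold H. destruct (Rle_dec (entry_height theta n) t) as [Hle|_]; [|reflexivity].
      exfalso. apply entry_height_le in Hle; try lra; try lia.
      apply le_nat_floor in Hle; [|apply Hpos]. fold N' in Hle. lia.
  - apply is_CRInt_csum. intros n Hn.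
    assert (HnT : entry_height theta n <= T).
    { apply entry_height_le; try lra; try lia. apply le_nat_floor; [apply Hpos|]. apply Hn. }
    assert (Hn0 : 0 < entry_height theta n).
    { unfold entry_height. apply Rmult_lt_0_compat; [lra|apply Rpower_pos]. }
    replace (I n) with (RtoC (entry_height theta n - 0) * RtoC 0 + I n)%C by ring.
    apply is_CRInt_Chasles with (entry_height theta n).
    + apply (is_CRInt_ext (fun _ => RtoC 0)); [lra| |apply is_CRInt_const].
      intros t Ht. unfold H. destruct (Rle_dec (entry_height theta n) t); [lra|reflexivity].
    + apply (is_CRInt_ext (critical_term b c n)); [lra| |apply HI, Hn].
      intros t Ht. unfold H. destruct (Rle_dec (entry_height theta n) t); [reflexivity|lra].
Qed.

(** * The asymptotic formula *)

Lemma shifted_0 (X b c n : nat) (t : R) :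
  shifted X b c n 0 t
  = (cpow (INR n) ((- (1 / 2))%R, (- t)%R)
     * (zapprox X ((1 / 2)%R, (- (INR b * t))%R) * zapprox X ((1 / 2)%R, (- (INR c * t))%R)))%C.
Proof.
  unfold shifted. f_equal; [|f_equal]; f_equal; apply C_eq; simpl; ring.
Qed.

Lemma Rpower_le_self (t e : R) : 1 <= t -> e <= 1 -> Rpower t e <= t.
Proof. intros Ht He. rewrite <- (Rpower_1 t) at 2 by lra. apply Rle_Rpower; lra. Qed.

Lemma Cmod_product_diff (z w z' w' : C) (W r : R) :
  0 <= W -> 0 <= r <= 1 ->
  Cmod z' <= W -> Cmod w' <= W -> Cmod (z - z') <= W * r -> Cmod (w - w') <= W * r ->
  Cmod (z * w - z' * w') <= 3 * W ^ 2 * r.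
Proof.
  intros HW Hr Hz Hw Hzz Hww.
  replace (z * w - z' * w')%C with (z' * (w - w') + (z - z') * w' + (z - z') * (w - w'))%C by ring.
  eapply Rle_trans; [apply Cmod_triangle|].
  eapply Rle_trans; [apply Rplus_le_compat_r, Cmod_triangle|].
  rewrite !Cmod_mult.
  assert (0 <= W * r) by (apply Rmult_le_pos; lra).
  assert (Cmod z' * Cmod (w - w') <= W * (W * r))
    by (apply Rmult_le_compat; try apply Cmod_ge_0; assumption).
  assert (Cmod (z - z') * Cmod w' <= W * r * W)
    by (apply Rmult_le_compat; try apply Cmod_ge_0; assumption).
  assert (Cmod (z - z') * Cmod (w - w') <= W * r * (W * 1)).
  { apply Rmult_le_compat; try apply Cmod_ge_0; try assumption.
    eapply Rle_trans; [exact Hww|]. apply Rmult_le_compat_l; lra. }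
  nra.
Qed.

(** W is a crude bound, quadratic in T, for both truncated zeta factors, and W/sqrt(X) bounds both
    truncation errors; the accuracy comes from X alone. *)
Lemma critical_shifted_close (X b c n : nat) (t T W : R) :
  (2 <= b)%nat -> (2 <= c)%nat -> (1 <= n)%nat -> 6 <= t <= T ->
  W = 1000 * (1 + INR b * T) * (1 + INR c * T) ->
  (1 <= X)%nat -> 2 * (INR b * T) ^ 2 <= INR X -> 2 * (INR c * T) ^ 2 <= INR X ->
  Cmod (critical_term b c n t - shifted X b c n 0 t) <= 3 * W ^ 2 * / sqrt (INR X).
Proof.
  intros Hb Hc Hn Ht HW HX HXb HXc. rewrite shifted_0. unfold critical_term.
  match goal with |- Cmod (?p * ?x - ?p * ?y) <= _ =>
    replace (p * x - p * y)%C with (p * (x - y))%C by ring end.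
  rewrite Cmod_mult, Cmod_cpow. simpl Re.
  pose proof (INR_ge_1 n Hn) as Hn1. pose proof (INR_ge_1 X HX) as HX1.
  assert (HP : Rpower (INR n) (- (1 / 2)) <= 1).
  { apply Rle_trans with (Rpower (INR n) 0); [apply Rle_Rpower; lra|rewrite Rpower_O; lra]. }
  assert (Hr : 0 <= / sqrt (INR X) <= 1).
  { assert (1 <= sqrt (INR X)) by (apply sqrt_ge_1; lra).
    split; [left; apply Rinv_0_lt_compat; lra|].
    apply Rle_trans with (/ 1); [apply Rinv_le_contravar; lra|rewrite Rinv_1; lra]. }
  assert (HbT : 0 <= INR b * T) by (apply Rmult_le_pos; [apply pos_INR|lra]).
  assert (HcT : 0 <= INR c * T) by (apply Rmult_le_pos; [apply pos_INR|lra]).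
  assert (HWb : 1000 * (1 + INR b * T) <= W) by (rewrite HW; nra).
  assert (HWc : 1000 * (1 + INR c * T) <= W) by (rewrite HW; nra).
  assert (Hsize : forall d, (2 <= d)%nat -> 2 * (INR d * T) ^ 2 <= INR X ->
    1000 * (1 + INR d * T) <= W ->
    Cmod (zapprox X ((1 / 2)%R, (- (INR d * t))%R)) <= W /\
    Cmod (zeta ((1 / 2)%R, (- (INR d * t))%R) - zapprox X ((1 / 2)%R, (- (INR d * t))%R))
      <= W * / sqrt (INR X)).
  { intros d Hd HXd HWd. pose proof (pos_INR d) as Hd0.
    assert (Hdt : INR d * t <= INR d * T) by (apply Rmult_le_compat_l; lra).
    assert (0 <= INR d * t) by (apply Rmult_le_pos; lra).
    split.
    - pose proof (zapprox_bound_dilated X d 0 t Hd ltac:(lra) ltac:(lra)) as H0.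
      replace (1 / 2 + INR d * 0) with (1 / 2) in H0 by ring.
      eapply Rle_trans; [apply H0|].
      + eapply Rle_trans; [|exact HXd]. apply Rmult_le_compat_l; [lra|]. apply pow_incr; lra.
      + assert (Rpower t (1 / 4 - 0 / 2) <= t) by (apply Rpower_le_self; lra).
        assert (500 * INR d * Rpower t (1 / 4 - 0 / 2) <= 500 * INR d * t)
          by (apply Rmult_le_compat_l; lra). lra.
    - eapply Rle_trans; [apply zeta_critical_zapprox; [lra|lra|exact HX]|].
      apply Rmult_le_compat_r; lra. }
  destruct (Hsize b Hb HXb HWb) as [B1 B2]. destruct (Hsize c Hc HXc HWc) as [C1 C2].
  rewrite <- (Rmult_1_l (3 * W ^ 2 * / sqrt (INR X))).
  apply Rmult_le_compat; [apply Rpower_nneg|apply Cmod_ge_0|exact HP|].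
  apply Cmod_product_diff; try assumption. nra.
Qed.

(** The conditions on X serve, in order, the growth bounds on the horizontal sides, the passage to
    polynomials on u = 1/2 (cost 7), and the replacement of zeta by its truncation on u = 0 (cost
    1); hence the 8. *)
Lemma critical_integral_diagonal (X b c n : nat) (a T W : R) :
  (2 <= b)%nat -> (2 <= c)%nat -> (1 <= n)%nat -> 6 <= a <= T -> INR n <= a ->
  W = 1000 * (1 + INR b * T) * (1 + INR c * T) ->
  2 * (INR b * T) ^ 2 <= INR X -> 2 * (INR c * T) ^ 2 <= INR X ->
  T ^ 2 <= INR X -> (3 * T * W ^ 2) ^ 2 <= INR X ->
  exists l, is_CRInt (critical_term b c n) a T l /\
    Cmod (l - RtoC (rsum (fun m => rsum (fun k =>
                      pair_weight b c m k * diag_term b c n m k) X) X * (T - a)))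
    <= 8 + 250000 * (INR b * INR c) * (/ sqrt (INR n) * sqrt T)
       + rsum (fun m => rsum (fun k =>
           pair_weight b c m k * off_log_recip (m ^ b * k ^ c) n) X) X.
Proof.
  intros Hb Hc Hn Ha Hna HW HXb HXc HXT HXW.
  assert (HX1 : (1 <= X)%nat).
  { destruct X; [simpl in HXT; nra|lia]. }
  assert (Hl : is_CRInt (critical_term b c n) a T (CRInt (critical_term b c n) a T)).
  { apply is_CRInt_continuous; [lra|]. intros t Ht.
    apply critical_term_continuous; [lia|lia|lra]. }
  set (l := CRInt (critical_term b c n) a T) in *.
  destruct (shifted_vertical_shift X b c n a T Hb Hc Hn Ha Hna HXb HXc)
    as [l0 [l1 [Hl0 [Hl1 Hd01]]]].
  pose proof (shifted_half_integral X b c n a T l1 Hb Hc Hn ltac:(lra) HXT Hl1) as Hd1.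
  exists l. split; [exact Hl|].
  pose proof (INR_ge_1 X HX1) as HX1'.
  assert (Hs0 : 0 < sqrt (INR X)) by (apply sqrt_lt_R0; lra).
  assert (HsX : 3 * T * W ^ 2 <= sqrt (INR X)).
  { rewrite <- (sqrt_Rsqr (3 * T * W ^ 2)).
    - apply sqrt_le_1_alt. unfold Rsqr. simpl in HXW. lra.
    - pose proof (pow2_ge_0 W). apply Rmult_le_pos; lra. }
  assert (Hd0 : Cmod (l - l0) <= 1).
  { pose proof (is_CRInt_minus _ _ _ _ _ _ Hl Hl0) as H.
    eapply Rle_trans.
    - apply (is_CRInt_Cmod_le (fun t => critical_term b c n t - shifted X b c n 0 t)%C
        a T (3 * W ^ 2 * / sqrt (INR X))); [lra| |exact H].
      intros t Ht. apply (critical_shifted_close X b c n t T W); try assumption. lra.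
    - assert (0 <= 3 * W ^ 2 * / sqrt (INR X)).
      { apply Rmult_le_pos; [pose proof (pow2_ge_0 W); lra|left; apply Rinv_0_lt_compat, Hs0]. }
      apply Rle_trans with (3 * W ^ 2 * / sqrt (INR X) * T); [apply Rmult_le_compat_l; lra|].
      apply (Rmult_le_reg_r (sqrt (INR X))); [exact Hs0|].
      replace (3 * W ^ 2 * / sqrt (INR X) * T * sqrt (INR X)) with (3 * T * W ^ 2)
        by (field; lra). lra. }
  match goal with |- Cmod (l - ?x) <= _ =>
    replace (l - x)%C with ((l - l0) + - (l1 - l0) + (l1 - x))%C by ring end.
  eapply Rle_trans; [apply Cmod_triangle|].
  eapply Rle_trans; [apply Rplus_le_compat_r, Cmod_triangle|].
  rewrite Cmod_opp. lra.
Qed.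

Lemma rsum_indicator (A N : nat) (h : nat -> R) :
  (1 <= A)%nat ->
  rsum (fun n => (if Nat.eq_dec A n then 1 else 0) * h n) N
  = if le_dec A N then h A else 0.
Proof.
  intros HA. induction N as [|N IH].
  - simpl. destruct (le_dec A 0); [lia|reflexivity].
  - cbn [rsum]. rewrite IH.
    destruct (Nat.eq_dec A (S N)) as [->|Hne].
    + destruct (le_dec (S N) N); [lia|].
      destruct (le_dec (S N) (S N)); [ring|lia].
    + destruct (le_dec A N); destruct (le_dec A (S N)); try lia; ring.
Qed.

(** Only n = m^b k^c contributes, provided n <= V, and since V^(1/theta) = T/(2 pi) its length T - 2
    pi n^(1/theta) is T (1 - (n/V)^(1/theta)). *)
Lemma diagonal_sum_cutoff (theta T : R) (b c m k : nat) :
  0 < theta -> 0 < T -> (1 <= m)%nat -> (1 <= k)%nat ->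
  let V := Rpower (T / (2 * PI)) theta in
  rsum (fun n => diag_term b c n m k * (T - entry_height theta n)) (nat_floor V)
  = T * cutoff (1 / theta) (Rpower (INR m) (INR b) * Rpower (INR k) (INR c) / V).
Proof.
  intros Hth HT Hm Hk V. pose proof PI_RGT_0 as HPI.
  unfold diag_term. rewrite rsum_indicator by (apply pow_mul_pos; assumption).
  assert (HV : 0 < V) by apply Rpower_pos.
  pose proof (pow_mul_pos b c m k Hm Hk) as HA.
  replace (Rpower (INR m) (INR b) * Rpower (INR k) (INR c)) with (INR (m ^ b * k ^ c)).
  2:{ rewrite mult_INR, !pow_INR, !Rpower_pow by (apply INR_pos; assumption). reflexivity. }
  set (A := (m ^ b * k ^ c)%nat) in *.
  assert (HAV : (A <= nat_floor V)%nat <-> INR A / V <= 1).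
  { rewrite le_nat_floor by lra. split; intros H.
    - apply div_le_1; lra.
    - apply (Rmult_le_compat_r V) in H; [|lra].
      unfold Rdiv in H. rewrite Rmult_assoc, Rinv_l in H; lra. }
  unfold cutoff.
  destruct (le_dec A (nat_floor V)) as [H1|H1];
    destruct (Rle_dec (INR A / V) 1) as [H2|H2]; try tauto; [|ring].
  unfold entry_height. unfold Rdiv at 2.
  rewrite <- Rpower_mult_distr by (try apply Rinv_0_lt_compat; try apply INR_pos; assumption).
  replace (Rpower (/ V) (1 / theta)) with (2 * PI / T); [field; lra|].
  rewrite <- (Rpower_1 V) at 1 by exact HV. rewrite <- Rpower_Ropp, Rpower_mult.
  unfold V. rewrite Rpower_mult.
  replace (theta * (- (1) * (1 / theta))) with (- (1)) by (field; lra).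
  rewrite Rpower_Ropp, Rpower_1 by (apply Rdiv_lt_0_compat; lra). field. lra.
Qed.

(** The y for which m = k = y lies on the hyperbola m^b k^c = V. *)
Definition corner (theta : R) (b c : nat) (T : R) : R :=
  Rpower (T / (2 * PI)) (theta / (INR b + INR c)).

Definition lattice_sum (theta : R) (b c X : nat) (T : R) : R :=
  rsum (fun m => rsum (lattice_term (INR b) (INR c) (1 / theta) (corner theta b c T) m) X) X.

Lemma corner_pow (theta : R) (b c : nat) (T : R) :
  (1 <= b)%nat ->
  Rpower (corner theta b c T) (INR b + INR c) = Rpower (T / (2 * PI)) theta.
Proof.
  intros Hb. unfold corner. rewrite Rpower_mult. f_equal. field.
  pose proof (INR_pos b Hb). pose proof (pos_INR c). lra.
Qed.

Lemma rsum_diagonal_lattice (theta T : R) (b c X : nat) :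
  0 < theta -> 0 < T -> (1 <= b)%nat ->
  rsum (fun n => rsum (fun m => rsum (fun k => pair_weight b c m k * diag_term b c n m k) X) X
      * (T - entry_height theta n)) (nat_floor (Rpower (T / (2 * PI)) theta))
  = T * lattice_sum theta b c X T.
Proof.
  intros Hth HT Hb. set (N := nat_floor (Rpower (T / (2 * PI)) theta)).
  transitivity (rsum (fun n => rsum (fun m => rsum (fun k =>
    pair_weight b c m k * (diag_term b c n m k * (T - entry_height theta n))) X) X) N).
  - apply rsum_ext. intros n _. rewrite Rmult_comm, <- rsum_scal.
    apply rsum_ext. intros m _. rewrite <- rsum_scal. apply rsum_ext. intros k _. ring.
  - rewrite (rsum_exchange (fun n m => rsum (fun k =>
      pair_weight b c m k * (diag_term b c n m k * (T - entry_height theta n))) X)).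
    unfold lattice_sum. rewrite <- rsum_scal. apply rsum_ext. intros m Hm.
    rewrite (rsum_exchange (fun n k =>
      pair_weight b c m k * (diag_term b c n m k * (T - entry_height theta n)))).
    rewrite <- rsum_scal. apply rsum_ext. intros k Hk.
    rewrite rsum_scal. unfold N. rewrite diagonal_sum_cutoff by (try assumption; lia).
    unfold lattice_term. rewrite corner_pow by exact Hb. unfold pair_weight, half_exp.
    replace (- ((INR b - 1) / 2 + 1)) with (- ((1 + INR b) / 2)) by field.
    replace (- ((INR c - 1) / 2 + 1)) with (- ((1 + INR c) / 2)) by field. ring.
Qed.

Lemma ln_le_Rpower (T d : R) : 0 < T -> 0 < d -> ln T <= 1 / d * Rpower T d.
Proof.
  intros HT Hd. pose proof (exp_ineq1_le (d * ln T)) as H.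
  unfold Rpower. apply (Rmult_le_reg_l d); [exact Hd|].
  replace (d * (1 / d * exp (d * ln T))) with (exp (d * ln T)) by (field; lra). lra.
Qed.

(** Summation over n <= N of the errors of [critical_integral_diagonal]. With P = T^(1/2 + theta/2),
    the constants give 8 N, the horizontal sides 2 Kh sqrt(T N), and the off-diagonal terms 9 times
    2 N (3 + 2 ln N); each is O(P). X depends on T, the constant does not. *)
Theorem M1_lattice_sum (theta : R) (b c : nat) :
  0 < theta < 1 -> (2 <= b)%nat -> (2 <= c)%nat ->
  exists K, 0 <= K /\ forall T, 2 * PI <= T ->
    exists X, Rpower (T / (2 * PI)) theta <= INR X /\
      Cmod (M1 theta b c T - RtoC (T * lattice_sum theta b c X T))
        <= K * Rpower T (1 / 2 + theta / 2).
Proof.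
  intros Hth Hb Hc. set (Kh := 250000 * (INR b * INR c)).
  assert (HKh : 0 <= Kh) by (unfold Kh; repeat apply Rmult_le_pos; try apply pos_INR; lra).
  (* Since theta + d = 1/2 + theta/2, there is a factor T^d to spare over N <= T^theta, and it
     absorbs the logarithm; theta < 1 makes d positive. *)
  set (d := (1 - theta) / 2). assert (Hd : 0 < d) by (unfold d; lra).
  assert (Hid : 0 < 1 / d) by (apply Rdiv_lt_0_compat; lra).
  exists (62 + 2 * Kh + 36 * (1 / d)). split; [lra|]. intros T HT.
  pose proof PI2_3_2 as HPI. assert (HT6 : 6 <= T) by lra.
  assert (HT1 : 1 <= T / (2 * PI)).
  { apply one_le_div; lra. }
  set (V := Rpower (T / (2 * PI)) theta).
  assert (HV1 : 1 <= V).
  { apply Rpower_ge_1; lra. }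
  set (N := nat_floor V).
  assert (HN : INR N <= V < INR N + 1) by (apply nat_floor_spec; lra).
  assert (HN1 : (1 <= N)%nat) by (apply (floor_pos V); assumption).
  set (W := 1000 * (1 + INR b * T) * (1 + INR c * T)).
  (* All the thresholds are nonnegative, so exceeding their sum exceeds each of them. *)
  destruct (INR_unbounded (2 * (INR b * T) ^ 2 + 2 * (INR c * T) ^ 2 + T ^ 2
    + (3 * T * W ^ 2) ^ 2 + V)) as [X HX].
  pose proof (pow2_ge_0 (INR b * T)). pose proof (pow2_ge_0 (INR c * T)).
  pose proof (pow2_ge_0 T). pose proof (pow2_ge_0 (3 * T * W ^ 2)).
  exists X. split; [fold V; lra|].
  (* From theta < 1 and 2 pi > 6 the entry height is at least 6 n, which yields both t >= 6 and n <=
     t on the contour. *)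
  assert (Hheight : forall n, (1 <= n <= N)%nat ->
    6 <= entry_height theta n <= T /\ INR n <= entry_height theta n).
  { intros n Hn. pose proof (INR_ge_1 n ltac:(lia)) as Hn1.
    assert (Hnp : INR n <= Rpower (INR n) (1 / theta)).
    { rewrite <- (Rpower_1 (INR n)) at 1 by lra. apply Rle_Rpower; [exact Hn1|].
      apply one_le_div; lra. }
    assert (Hh : 6 * INR n <= entry_height theta n)
      by (unfold entry_height; apply Rmult_le_compat; lra).
    split; [split|]; [lra| |lra].
    apply entry_height_le; [lra|lra|lia|]. fold V. apply le_nat_floor; [lra|]. apply Hn. }
  set (I := fun n => CRInt (critical_term b c n) (entry_height theta n) T).
  set (D := fun n => rsum (fun m => rsum (fun k =>
      pair_weight b c m k * diag_term b c n m k) X) X * (T - entry_height theta n)).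
  set (O := fun n => rsum (fun m => rsum (fun k =>
      pair_weight b c m k * off_log_recip (m ^ b * k ^ c) n) X) X).
  assert (HI : forall n, (1 <= n <= N)%nat ->
    is_CRInt (critical_term b c n) (entry_height theta n) T (I n) /\
    Cmod (I n - RtoC (D n)) <= 8 + Kh * (/ sqrt (INR n) * sqrt T) + O n).
  { intros n Hn. destruct (Hheight n Hn) as [H3 H4].
    destruct (critical_integral_diagonal X b c n (entry_height theta n) T W)
      as [l [Hl1 Hl2]]; try assumption; try lia; try reflexivity; try lra.
    unfold I. rewrite (is_CRInt_unique _ _ _ _ Hl1). split; assumption. }
  rewrite (M1_sum_integrals theta b c T I); [|lra|lra|intros n Hn; apply HI, Hn].
  rewrite <- rsum_diagonal_lattice by (try lra; lia). fold V N.
  rewrite <- csum_RtoC, <- csum_minus.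
  eapply Rle_trans; [apply csum_Cmod|].
  eapply Rle_trans; [apply rsum_le; intros n Hn; apply HI, Hn|].
  rewrite (rsum_plus (fun n => 8 + Kh * (/ sqrt (INR n) * sqrt T)) O).
  rewrite (rsum_plus (fun _ => 8)), rsum_const.
  rewrite (rsum_scal Kh (fun n => / sqrt (INR n) * sqrt T)).
  rewrite (rsum_ext (fun n => / sqrt (INR n) * sqrt T) (fun n => sqrt T * / sqrt (INR n)))
    by (intros; ring).
  rewrite rsum_scal.
  set (P := Rpower T (1 / 2 + theta / 2)).
  assert (HVT : V <= Rpower T theta).
  { unfold V. apply Rle_Rpower_l; [lra|]. split; [lra|].
    apply (Rmult_le_reg_r (2 * PI)); [lra|]. unfold Rdiv. rewrite Rmult_assoc, Rinv_l; nra. }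
  assert (HNP : INR N <= P).
  { apply Rle_trans with (Rpower T theta); [lra|]. apply Rle_Rpower; lra. }
  assert (Hsq : sqrt T * sqrt (INR N) <= P).
  { unfold P. rewrite Rpower_plus, Rpower_half by lra.
    apply Rmult_le_compat_l; [apply sqrt_pos|].
    replace (Rpower T (theta / 2)) with (sqrt (Rpower T theta)).
    - apply sqrt_le_1_alt. lra.
    - rewrite <- Rpower_half by apply Rpower_pos. rewrite Rpower_mult. f_equal. field. }
  assert (Hlog : INR N * ln (INR N) <= 1 / d * P).
  { assert (HlN : ln (INR N) <= ln T).
    { apply ln_le; [apply INR_pos, HN1|]. apply Rle_trans with (Rpower T theta); [lra|].
      apply Rpower_le_self; lra. }
    pose proof (ln_le_Rpower T d ltac:(lra) Hd) as HlT.
    replace P with (Rpower T theta * Rpower T d).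
    2:{ unfold P. rewrite <- Rpower_plus. f_equal. unfold d. field. }
    replace (1 / d * (Rpower T theta * Rpower T d)) with (Rpower T theta * (1 / d * Rpower T d))
      by ring.
    apply Rmult_le_compat; [apply pos_INR| |lra|lra].
    rewrite <- ln_1. apply ln_le; [lra|]. apply INR_ge_1, HN1. }
  assert (HO : rsum O N <= 9 * (2 * INR N * (3 + 2 * ln (INR N)))).
  { unfold O. rewrite (rsum_exchange (fun n m => rsum (fun k =>
      pair_weight b c m k * off_log_recip (m ^ b * k ^ c) n) X)).
    rewrite (rsum_ext _ (fun m => rsum (fun k => pair_weight b c m k
      * rsum (off_log_recip (m ^ b * k ^ c)) N) X)).
    - apply (rsum_pair_weight_le b c X
        (fun m k => rsum (off_log_recip (m ^ b * k ^ c)) N)); try assumption.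
      + pose proof (pos_INR N). assert (0 <= ln (INR N)).
        { rewrite <- ln_1. apply ln_le; [lra|]. apply INR_ge_1, HN1. }
        apply Rmult_le_pos; lra.
      + intros m k Hm Hk. apply rsum_off_log_recip; [apply pow_mul_pos; assumption|exact HN1].
    - intros m _. rewrite (rsum_exchange (fun n k =>
        pair_weight b c m k * off_log_recip (m ^ b * k ^ c) n)).
      apply rsum_ext. intros k _. apply rsum_scal. }
  pose proof (rsum_inv_sqrt N) as Hinv.
  assert (Hmid : Kh * (sqrt T * rsum (fun m => / sqrt (INR m)) N) <= Kh * (2 * P)).
  { apply Rmult_le_compat_l; [exact HKh|].
    apply Rle_trans with (sqrt T * (2 * sqrt (INR N))); [|lra].
    apply Rmult_le_compat_l; [apply sqrt_pos|exact Hinv]. }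
  lra.
Qed.

(** * From powers of the corner to powers of T and the stated constants *)

Lemma corner_Rpower (theta : R) (b c : nat) (T e : R) :
  0 < T ->
  Rpower (corner theta b c T) e
  = Rpower T (theta / (INR b + INR c) * e) * Rpower (2 * PI) (- (theta / (INR b + INR c) * e)).
Proof.
  intros HT. pose proof PI_RGT_0. unfold corner. rewrite Rpower_mult.
  unfold Rdiv at 1. rewrite <- Rpower_mult_distr by (try apply Rinv_0_lt_compat; lra).
  f_equal. unfold Rpower. rewrite ln_Rinv by lra. f_equal. ring.
Qed.

(** The power of y is V^(-p/b) with p = (b-1)/2, and p/b = 1/2 - 1/(2b); the factor [pow2pi] comes
    from the 2 pi in V. *)
Lemma corner_secondary (theta : R) (b c : nat) (T : R) :
  0 < T -> (1 <= b)%nat ->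
  T * Rpower (corner theta b c T) (- ((INR b + INR c) / INR b * ((INR b - 1) / 2)))
  = pow2pi theta b * Rpower T (1 - theta * (1 / 2 - 1 / (2 * INR b))).
Proof.
  intros HT Hb. apply INR_pos in Hb. pose proof (pos_INR c).
  rewrite corner_Rpower by exact HT. unfold pow2pi.
  replace (theta / (INR b + INR c) * - ((INR b + INR c) / INR b * ((INR b - 1) / 2)))
    with (- (theta * (1 / 2 - 1 / (2 * INR b)))) by (field; lra).
  replace (1 - theta * (1 / 2 - 1 / (2 * INR b)))
    with (1 + - (theta * (1 / 2 - 1 / (2 * INR b)))) by ring.
  rewrite Ropp_involutive, (Rpower_plus 1), Rpower_1 by exact HT. ring.
Qed.

Lemma corner_error (theta : R) (b c : nat) (T : R) :
  0 < T -> (1 <= b)%nat ->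
  T * Rpower (corner theta b c T) (- ((INR b + INR c) / 2))
  = Rpower (2 * PI) (theta / 2) * Rpower T (1 - theta / 2).
Proof.
  intros HT Hb. apply INR_pos in Hb. pose proof (pos_INR c).
  rewrite corner_Rpower by exact HT.
  replace (theta / (INR b + INR c) * - ((INR b + INR c) / 2)) with (- (theta / 2))
    by (field; lra).
  rewrite Ropp_involutive. unfold Rminus. rewrite (Rpower_plus 1), Rpower_1 by exact HT. ring.
Qed.

Lemma corner_ge_1 (theta : R) (b c : nat) (T : R) :
  0 < theta -> (1 <= b)%nat -> 2 * PI <= T -> 1 <= corner theta b c T.
Proof.
  intros Hth Hb HT. pose proof PI_RGT_0. apply INR_pos in Hb. pose proof (pos_INR c).
  assert (HT1 : 1 <= T / (2 * PI)).
  { apply one_le_div; lra. }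
  apply Rpower_ge_1; [exact HT1|]. apply Rdiv_le_0_compat; lra.
Qed.

(** With nu = 1/theta one has p' = (lambda_theta B + 1)/2 and p + p' = B/theta, so 1/p + 1/p' =
    (B/theta)/(p p'). *)
Lemma main_coef_lambda (theta B : R) :
  0 < theta < 1 -> 2 <= B ->
  main_coef B (1 / theta) = 4 * B / (theta * (B - 1) * (lambda_theta theta * B + 1)).
Proof.
  intros Hth HB. unfold main_coef, lambda_theta.
  assert (H : 0 < B * 2 - (B - 1) * theta) by nra.
  assert (H' : 0 < (2 - theta) * B + theta) by nra.
  field. repeat split; lra.
Qed.

Lemma zeta_half_exp (b : nat) :
  (2 <= b)%nat -> zeta (RtoC ((1 + INR b) / 2)) = RtoC (zeta_real ((INR b - 1) / 2 + 1)).
Proof.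
  intros Hb. apply (le_INR 2) in Hb. change (INR 2) with 2 in Hb.
  rewrite zeta_RtoC by lra. do 2 f_equal. field.
Qed.

(** The condition r <> s keeps the argument s/(2r) + 1/2 away from the pole of zeta. *)
Lemma Ccoef_real (theta : R) (r s : nat) :
  0 < theta < 1 -> (2 <= r)%nat -> (1 <= s)%nat -> r <> s ->
  Ccoef theta r s = RtoC (main_coef (INR r) (1 / theta)
    * zeta_real (1 / 2 + INR s / (2 * INR r)) * pow2pi theta r).
Proof.
  intros Hth Hr Hs Hrs. apply not_INR in Hrs. apply INR_pos in Hs.
  apply (le_INR 2) in Hr. change (INR 2) with 2 in Hr.
  assert (H : 0 < INR s / (2 * INR r)) by (apply Rdiv_lt_0_compat; lra).
  unfold Ccoef. rewrite zeta_RtoC.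
  - rewrite <- !RtoC_mult. f_equal. rewrite main_coef_lambda by assumption.
    rewrite (Rplus_comm (INR s / (2 * INR r))). ring.
  - lra.
  - intros E. apply Hrs.
    apply (Rmult_eq_reg_r (/ (2 * INR r))); [|apply Rinv_neq_0_compat; lra].
    replace (INR r * / (2 * INR r)) with (1 / 2) by (field; lra).
    unfold Rdiv in E at 1. lra.
Qed.

(** By [corner_error], T times the error of the lattice sum is a multiple of T^(1 - theta/2); T >= 3
    gives ln T >= 1, so this is below the first part of [err_term]. *)
Lemma M1_error_transfer (theta : R) (b c : nat) (K K' T S S0 : R) :
  (2 <= b)%nat -> 0 <= K -> 0 <= K' -> 3 <= T ->
  Cmod (M1 theta b c T - RtoC (T * S)) <= K * Rpower T (1 / 2 + theta / 2) ->
  Rabs (S - S0) <= K' * Rpower (corner theta b c T) (- ((INR b + INR c) / 2)) ->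
  Cmod (M1 theta b c T - RtoC (T * S0))
    <= (K + K' * Rpower (2 * PI) (theta / 2)) * err_term theta T.
Proof.
  intros Hb HK HK' HT HM HS.
  replace (M1 theta b c T - RtoC (T * S0))%C
    with ((M1 theta b c T - RtoC (T * S)) + RtoC (T * (S - S0)))%C
    by (rewrite !RtoC_mult, RtoC_minus; ring).
  eapply Rle_trans; [apply Cmod_triangle|].
  rewrite Cmod_R, Rabs_mult, (Rabs_pos_eq T) by lra.
  apply (Rmult_le_compat_l T) in HS; [|lra].
  replace (T * (K' * Rpower (corner theta b c T) (- ((INR b + INR c) / 2))))
    with (K' * (T * Rpower (corner theta b c T) (- ((INR b + INR c) / 2)))) in HS by ring.
  rewrite corner_error in HS by (lra || lia).
  assert (Hl : 1 <= ln T ^ 2).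
  { assert (1 <= ln T).
    { rewrite <- (ln_exp 1). apply ln_le; [apply exp_pos|]. pose proof exp_le_3. lra. }
    nra. }
  unfold err_term.
  pose proof (Rpower_pos T (1 - theta / 2)) as P1.
  pose proof (Rpower_pos T (1 / 2 + theta / 2)) as P2.
  pose proof (Rpower_pos (2 * PI) (theta / 2)) as P3.
  set (A := Rpower T (1 - theta / 2)) in *. set (R := Rpower T (1 / 2 + theta / 2)) in *.
  set (Q := Rpower (2 * PI) (theta / 2)) in *.
  assert (HA : A <= A * ln T ^ 2).
  { rewrite <- (Rmult_1_r A) at 1. apply Rmult_le_compat_l; lra. }
  assert (HQ : 0 <= K' * Q) by (apply Rmult_le_pos; lra).
  apply (Rmult_le_compat_l _ _ _ HQ) in HA.
  assert (0 <= K * (A * ln T ^ 2)) by (apply Rmult_le_pos; [exact HK|nra]).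
  assert (0 <= K' * Q * R) by (apply Rmult_le_pos; lra).
  lra.
Qed.

Lemma one_lt_inv (x : R) : 0 < x < 1 -> 1 < 1 / x.
Proof.
  intros H. apply (Rmult_lt_reg_r x); [lra|]. unfold Rdiv. rewrite Rmult_assoc, Rinv_l; lra.
Qed.

(** With p and p' as in [main_coef], 1/p^2 and 1/p'^2 are the squares in E_0 and F_0, twice
    [main_coef] times gamma gives their gamma terms, and theta/(2b) times twice [main_coef] is theta
    H_1. *)
Lemma Hpoly_corner (theta : R) (b : nat) (x : R) :
  0 < theta < 1 -> 2 <= INR b ->
  Hpoly theta b x = pow2pi theta b *
    (1 / ((INR b - 1) / 2 * ((INR b - 1) / 2))
     - 1 / ((INR b * (1 / theta) - (INR b - 1) / 2) * (INR b * (1 / theta) - (INR b - 1) / 2))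
     + 2 * main_coef (INR b) (1 / theta)
       * (euler_gamma + theta / (INR b + INR b) * (x - ln (2 * PI)))).
Proof.
  intros Hth HB. unfold Hpoly. f_equal.
  unfold H0, E0, F0, H1, Defs.E1, F1, main_coef, lambda_theta.
  set (L := ln (2 * PI)). clearbody L. set (B := INR b) in *. clearbody B.
  assert (0 < B * 2 - (B - 1) * theta) by nra.
  assert (0 < (2 - theta) * B + theta) by nra.
  field. repeat split; lra.
Qed.

Theorem theorem1p3 (theta : R) (htheta : 0 < theta < 1) :
  (forall b c : nat, Nat.lt 1 c -> Nat.lt c b ->
     exists A T0 : R, forall T : R, T0 <= T ->
       Cmod (Cminus (M1 theta b c T)
               (Cminus (Cminus (Cmult (K1 b c) (RtoC T))
                           (Cmult (Ccoef theta c b)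
                                  (RtoC (Rpower T (1 - theta * (1/2 - 1 / (2 * INR c)))))))
                     (Cmult (Ccoef theta b c)
                            (RtoC (Rpower T (1 - theta * (1/2 - 1 / (2 * INR b))))))))
       <= A * err_term theta T) /\
  (forall b : nat, Nat.lt 1 b ->
     exists A T0 : R, forall T : R, T0 <= T ->
       Cmod (Cminus (M1 theta b b T)
               (Cminus (Cmult (K1 b b) (RtoC T))
                     (RtoC (Hpoly theta b (ln T)
                            * Rpower T (1 - theta * (1/2 - 1 / (2 * INR b)))))))
       <= A * err_term theta T).
Proof.
  pose proof (one_lt_inv theta htheta) as Hnu.
  pose proof PI2_3_2 as HPI.
  split.
  - intros b c Hc Hcb. unfold Nat.lt in *.
    assert (Hb : (2 <= b)%nat) by lia. assert (Hbc : b <> c) by lia.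
    assert (HB : 2 <= INR b) by (apply (le_INR 2) in Hb; exact Hb).
    assert (HC : 2 <= INR c) by (apply (le_INR 2) in Hc; exact Hc).
    destruct (M1_lattice_sum theta b c htheta Hb Hc) as [K [HK HM]].
    destruct (lattice_sum_distinct (INR b) (INR c) (1 / theta) HB HC (not_INR _ _ Hbc) Hnu)
      as [K' [HK' HS]].
    (* From T = 2 pi on, V and the corner are at least 1. *)
    exists (K + K' * Rpower (2 * PI) (theta / 2)), (2 * PI). intros T HT.
    destruct (HM T HT) as [X [HX HMX]].
    pose proof (corner_ge_1 theta b c T ltac:(lra) ltac:(lia) HT) as Hy.
    specialize (HS (corner theta b c T) X Hy).
    rewrite corner_pow in HS by lia. specialize (HS HX).
    pose proof (M1_error_transfer theta b c K K' T _ _ Hb HK HK' ltac:(lra) HMX HS) as H.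
    eapply Rle_trans; [right|exact H]. do 2 f_equal.
    unfold K1. rewrite !zeta_half_exp, !Ccoef_real by (try assumption; try lia; auto).
    rewrite <- !RtoC_mult, <- !RtoC_minus. f_equal.
    rewrite (Rmult_minus_distr_l T), (Rmult_minus_distr_l T).
    pose proof (corner_secondary theta b c T ltac:(lra) ltac:(lia)) as Eb.
    pose proof (corner_secondary theta c b T ltac:(lra) ltac:(lia)) as Ec.
    (* The corner depends only on b + c, so one lemma serves both secondary terms. *)
    replace (corner theta c b T) with (corner theta b c T) in Ec
      by (unfold corner; rewrite (Rplus_comm (INR b)); reflexivity).
    rewrite (Rplus_comm (INR c)) in Ec.
    match type of Eb with T * ?u = _ => set (ub := u) in * end.
    match type of Ec with T * ?u = _ => set (uc := u) in * end.
    transitivity (T * (zeta_real ((INR b - 1) / 2 + 1) * zeta_real ((INR c - 1) / 2 + 1))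
      - main_coef (INR c) (1 / theta) * zeta_real (1 / 2 + INR b / (2 * INR c)) * (T * uc)
      - main_coef (INR b) (1 / theta) * zeta_real (1 / 2 + INR c / (2 * INR b)) * (T * ub)).
    + rewrite Eb, Ec. ring.
    + ring.
  - intros b Hb.
    assert (HB : 2 <= INR b) by (apply (le_INR 2) in Hb; exact Hb).
    destruct (M1_lattice_sum theta b b htheta Hb Hb) as [K [HK HM]].
    destruct (lattice_sum_equal (INR b) (1 / theta) HB Hnu) as [K' [HK' HS]].
    exists (K + K' * Rpower (2 * PI) (theta / 2)), (2 * PI). intros T HT.
    destruct (HM T HT) as [X [HX HMX]].
    pose proof (corner_ge_1 theta b b T ltac:(lra) ltac:(lia) HT) as Hy.
    specialize (HS (corner theta b b T) X Hy).
    rewrite corner_pow in HS by lia. specialize (HS HX).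
    pose proof (M1_error_transfer theta b b K K' T _ _ Hb HK HK' ltac:(lra) HMX HS) as H.
    eapply Rle_trans; [right|exact H]. do 2 f_equal.
    unfold K1. rewrite !zeta_half_exp by assumption.
    rewrite <- !RtoC_mult, <- !RtoC_minus. f_equal.
    pose proof (corner_secondary theta b b T ltac:(lra) ltac:(lia)) as E.
    replace ((INR b + INR b) / INR b * ((INR b - 1) / 2))
      with ((INR b - 1) / 2 + (INR b - 1) / 2) in E by (field; lra).
    rewrite (Rmult_minus_distr_l T).
    match type of E with T * ?u = _ => set (w := u) in * end.
    assert (Hln : ln (corner theta b b T) = theta / (INR b + INR b) * (ln T - ln (2 * PI))).
    { unfold corner, Rpower. rewrite ln_exp, ln_div by lra. reflexivity. }
    rewrite Hln.
    rewrite Hpoly_corner by assumption.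
    match goal with |- context [pow2pi theta b * ?Z * ?W] =>
      replace (pow2pi theta b * Z * W) with (Z * (pow2pi theta b * W)) by ring end.
    rewrite <- E. ring.
Qed.
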